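(* Let $k(u,v,x)$ be an interaction rate of type 1 and assume $k(u,v,x)\ge k_1(x)(u+v)^\alpha$ for all $u,v\ge0$, $x\in\mathbb{T}$, for some $\alpha\in[0,1]$ and some $k_1\in L^\infty(\mathbb{T})$ with $\operatorname{ess\,inf}_{\mathbb{T}}k_1>0$. Let $0\le u_0,v_0\in L^\infty(\mathbb{T})$, $M:=\max\{\|u_0\|_{L^\infty},\|v_0\|_{L^\infty}\}$, and assume $m_\infty:=\frac12\int_{\mathbb{T}}(u_0+v_0)dx>0$. Let $(u,v)$ be the weak solution of the one-dimensional system with initial data $(u_0,v_0)$. Then there exist positive constants $\Lambda_\alpha$ (depending only on $M,m_\infty$, $c$) and $\lambda_\alpha$ (depending only on $M,m_\infty,c,\alpha$, $\operatorname{ess\,inf}k_1$ and the bound $\kappa_1(M)$ of $k$) such that for all $t\ge0$ $$\int_{\mathbb{T}}(u(t)-m_\infty)^2dx+\int_{\mathbb{T}}(v(t)-m_\infty)^2dx\le\Lambda_\alpha e^{-2\lambda_\alpha t}\Big[\int_{\mathbb{T}}(u_0-m_\infty)^2dx+\int_{\mathbb{T}}(v_0-m_\infty)^2dx\Big].$$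
   Context: $\mathbb{T}=\mathbb{R}/\mathbb{Z}$ with Lebesgue measure of total mass $1$; $c>0$ is fixed. The one-dimensional system is $\partial_t u+c\partial_x u=k(u,v,x)(v-u)$, $\partial_t v-c\partial_x v=k(u,v,x)(u-v)$ on $(0,\infty)\times\mathbb{T}$, $u(0)=u_0$, $v(0)=v_0$. A weak solution is a pair of nonnegative $u,v\in L^\infty([0,T)\times\mathbb{T})\cap C([0,T];L^p(\mathbb{T}))$ for all $T>0,p\in[1,\infty)$ satisfying, for all $\psi\in C_c^\infty([0,\infty)\times\mathbb{T})$, $\int_0^\infty\!\int u(\partial_t\psi+c\partial_x\psi)+\int\psi(0)u_0+\int_0^\infty\!\int k(v-u)\psi=0$ and $\int_0^\infty\!\int v(\partial_t\psi-c\partial_x\psi)+\int\psi(0)v_0+\int_0^\infty\!\int k(u-v)\psi=0$. An interaction rate is a nonnegative measurable $k(u,v,x)$ on $[0,\infty)^2\times\mathbb{T}$; it is of type 1 if for every $\gamma>0$ there is $\kappa_1(\gamma)>0$ with $k(u,v,x)\le\kappa_1(\gamma)$ for $0\le u,v\le\gamma$, $x\in\mathbb{T}$. Known fact (Lions–Toscani): for $k$ of type 1 and nonnegative $L^\infty$ data there is a unique weak solution, and it satisfies $0\le u(t),v(t)\le M$ a.e. for all $t\ge0$. *)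

(* Defs.v *)
From HB Require Import structures.
From mathcomp Require Import all_boot all_order all_algebra.
From mathcomp Require Import all_classical all_reals all_analysis.
Set Implicit Arguments. Unset Strict Implicit. Unset Printing Implicit Defensive.
Import Order.TTheory GRing.Theory Num.Theory.
Import numFieldNormedType.Exports.
Local Open Scope classical_set_scope.
Local Open Scope ring_scope.

Section Defs.
Context {R : realType}.
Notation leb := (@lebesgue_measure R).

(* The torus T = R/Z is represented by the fundamental domain [0,1]
   (Lebesgue measure of mass 1); functions on T are functions R -> R of which
   only the values on [0,1] matter (test functions are 1-periodic). *)
Definition T01 : set R := `[0, 1]%classic.
Definition Tpos : set R := [set t | 0 <= t].

Definition intT (f : R -> R) : R := \int[leb]_(x in T01) f x.

Definition LinfT (f : R -> R) : Prop :=
  measurable_fun T01 f /\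
  exists C : R, {ae leb, forall x, T01 x -> `|f x| <= C}.

Definition normLinfT (f : R -> R) : R :=
  inf [set C : R | 0 <= C /\ {ae leb, forall x, T01 x -> `|f x| <= C}].

Definition essinfT (f : R -> R) : R :=
  sup [set C : R | {ae leb, forall x, T01 x -> C <= f x}].

Definition pdt (f : R -> R -> R) : R -> R -> R :=
  fun t x => derive1 (fun s => f s x) t.
Definition pdx (f : R -> R -> R) : R -> R -> R :=
  fun t x => derive1 (fun y => f t y) x.

Fixpoint iterpd (w : seq bool) (f : R -> R -> R) : R -> R -> R :=
  match w with
  | [::] => f
  | b :: w' => (if b then pdt else pdx) (iterpd w' f)
  end.

Definition smooth2 (f : R -> R -> R) : Prop :=
  forall w : seq bool,
    (forall t x, derivable (fun s => iterpd w f s x) t 1 /\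
                 derivable (fun y => iterpd w f t y) x 1) /\
    continuous (fun p : R * R => iterpd w f p.1 p.2).

Definition test_fun (psi : R -> R -> R) : Prop :=
  smooth2 psi /\
  (forall t x, psi t (x + 1) = psi t x) /\
  (exists T : R, forall t x, T <= t -> psi t x = 0).

Definition interaction_rate (k : R -> R -> R -> R) : Prop :=
  (forall u v x, 0 <= u -> 0 <= v -> T01 x -> 0 <= k u v x) /\
  measurable_fun [set p : (R * R) * R | 0 <= p.1.1 /\ 0 <= p.1.2 /\ T01 p.2]
                 (fun p : (R * R) * R => k p.1.1 p.1.2 p.2).

Definition type1 (k : R -> R -> R -> R) : Prop :=
  forall gamma : R, 0 < gamma -> exists kappa : R, 0 < kappa /\
    forall u v x, 0 <= u <= gamma -> 0 <= v <= gamma -> T01 x ->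
      k u v x <= kappa.

Definition sol_space (u : R -> R -> R) : Prop :=
  measurable_fun [set p : R * R | Tpos p.1 /\ T01 p.2]
                 (fun p : R * R => u p.1 p.2) /\
  (forall t, Tpos t -> measurable_fun T01 (u t)) /\
  (forall t, Tpos t -> {ae leb, forall x, T01 x -> 0 <= u t x}) /\
  (forall Tf : R, 0 < Tf -> exists C : R, forall t, 0 <= t < Tf ->
       {ae leb, forall x, T01 x -> `|u t x| <= C}) /\
  (forall p : R, 1 <= p -> forall t0, Tpos t0 ->
     (fun t => intT (fun x => `|u t x - u t0 x| `^ p))
       @ within Tpos (nbhs t0) --> (0 : R)).

(* weak solution of
     d_t u + c d_x u = k(u,v,x)(v-u),  d_t v - c d_x v = k(u,v,x)(u-v) *)
Definition weak_solution (c : R) (k : R -> R -> R -> R)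
    (u0 v0 : R -> R) (u v : R -> R -> R) : Prop :=
  sol_space u /\ sol_space v /\
  forall psi, test_fun psi ->
    (\int[leb]_(t in Tpos) intT (fun x =>
        u t x * (pdt psi t x + c * pdx psi t x))
     + intT (fun x => psi 0 x * u0 x)
     + \int[leb]_(t in Tpos) intT (fun x =>
        k (u t x) (v t x) x * (v t x - u t x) * psi t x) = 0) /\
    (\int[leb]_(t in Tpos) intT (fun x =>
        v t x * (pdt psi t x - c * pdx psi t x))
     + intT (fun x => psi 0 x * v0 x)
     + \int[leb]_(t in Tpos) intT (fun x =>
        k (u t x) (v t x) x * (u t x - v t x) * psi t x) = 0).

End Defs.

(* Main.v *)
Require Import Defs.
From HB Require Import structures.
From mathcomp Require Import all_boot all_order all_algebra.
From mathcomp Require Import all_classical all_reals all_analysis.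
From mathcomp Require Import measurable_realfun ring lra.
Set Implicit Arguments. Unset Strict Implicit. Unset Printing Implicit Defensive.
Import Order.TTheory GRing.Theory Num.Theory.
Import numFieldNormedType.Exports.
Local Open Scope classical_set_scope.
Local Open Scope ring_scope.

(* With rho = u + v and w = u - v the system reads rho_t + c w_x = 0, w_t + c rho_x = -2 k w, and the energy |rho - 2m|^2 + |w|^2 only dissipates 4 \int k w^2, where k may degenerate as rho -> 0. Since |w| <= rho, however, w^2 <= (rho - 2m)^2 / 4 wherever rho < 2m/3, while elsewhere k is bounded below; hence |w|^2 is controlled by |rho - 2m|^2 / 4 and the dissipation. Adding a small multiple of the cross term sum_n (w_n, i rho_n) / (2 pi n) over the Fourier modes yields dissipation of |rho - 2m|^2, and the modified energy decays exponentially.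

   The computation is done on the first N Fourier modes, whose equations follow from the weak formulation tested against trigonometric functions times the cutoffs exp(-1/(n (t0 - t))); Parseval's identity then lets N -> oo. The bound u, v <= M is obtained from the weak formulation by testing against e^(lam t) times nonnegative travelling trigonometric polynomials. *)

(** * Bounded measurable functions and interval integrals *)

(** Two reductions precede the estimate. Since $\alpha\le1$ and $u+v\le2M$, one has
    $(u+v)^\alpha\ge(2M)^{\alpha-1}(u+v)$, so for every $\alpha$ the rate has a lower bound linear
    in the density. And along a solution the rate can be frozen as a bounded coefficient [kap] of
    $(t,x)$; only $\kappa_0(U+V)\le kap\le K$ is remembered, and the system becomes linear.

    The obstacle is regularity: the solution is controlled only almost everywhere at each time, and
    its energy cannot be differentiated directly. Each Fourier coefficient, however, is the time
    integral of a bounded function, and such primitives obey a product rule. The price is that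
    multiplication by [kap] is not diagonal in the modes: the truncated energy satisfies its
    differential inequality up to an error, which is bounded uniformly in $N$ and vanishes pointwise
    in time, hence also in the integral.

    The bound by $M$ is reached by bootstrap: on a finite time interval some bound is part of the
    notion of solution, and its excess over $M$ is contracted by a fixed factor again and again. *)

Section BoundedMeasurable.
Context d (T : measurableType d) (R : realType).
Implicit Types (D : set T) (f g : T -> R).

(** The bound holds at every point of [D], so closure under sums and products is a pointwise matter
    and membership gives integrability on sets of finite measure. Solutions, bounded only almost
    everywhere, enter this class by clipping. *)
Definition bm D f := measurable_fun D f /\ exists C : R, forall x, D x -> `|f x| <= C.

Lemma bm_cst D (r : R) : bm D (fun=> r).
Proof. by split; [exact: measurable_cst|exists `|r|]. Qed.

Lemma bm_ext D f g : (forall x, D x -> f x = g x) -> bm D f -> bm D g.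
Proof.
move=> fg [mf [C fC]]; split.
  by apply: eq_measurable_fun mf => x /set_mem Dx; exact: fg.
by exists C => x Dx; rewrite -fg// fC.
Qed.

Lemma bmD D f g : bm D f -> bm D g -> bm D (fun x => f x + g x).
Proof.
move=> [mf [C fC]] [mg [C' gC]]; split; first exact: measurable_funD.
exists (C + C') => x Dx; apply: le_trans (ler_normD _ _) _.
by rewrite lerD// ?fC// gC.
Qed.

Lemma bmM D f g : bm D f -> bm D g -> bm D (fun x => f x * g x).
Proof.
move=> [mf [C fC]] [mg [C' gC]]; split; first exact: measurable_funM.
exists (C * C') => x Dx; rewrite normrM.
by rewrite ler_pM// ?fC// gC.
Qed.

Lemma bmZ D f (r : R) : bm D f -> bm D (fun x => r * f x).
Proof. by move=> bf; apply: bmM => //; exact: bm_cst. Qed.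

Lemma bmN D f : bm D f -> bm D (fun x => - f x).
Proof.
by move=> bf; apply: (bm_ext _ (bmZ (-1) bf)) => x _; rewrite mulN1r.
Qed.

Lemma bmB D f g : bm D f -> bm D g -> bm D (fun x => f x - g x).
Proof. by move=> bf bg; apply: bmD => //; exact: bmN. Qed.

Lemma bmX D f n : bm D f -> bm D (fun x => f x ^+ n).
Proof.
move=> bf; elim: n => [|n IH]; first exact: bm_cst.
by apply: (bm_ext _ (bmM bf IH)) => x _; rewrite exprS.
Qed.

Lemma bm_norm D f : bm D f -> bm D (fun x => `|f x|).
Proof.
move=> [mf [C fC]]; split; first exact: measurableT_comp.
by exists C => x Dx; rewrite normr_id fC.
Qed.

Lemma bm_sum D (I : Type) (s : seq I) (F : I -> T -> R) :
  (forall i, bm D (F i)) -> bm D (fun x => \sum_(i <- s) F i x).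
Proof.
move=> bF; elim: s => [|i s IH].
  by apply: (bm_ext _ (bm_cst D 0)) => x _; rewrite big_nil.
by apply: (bm_ext _ (bmD (bF i) IH)) => x _; rewrite big_cons.
Qed.

Lemma bm_sub D E f : measurable E -> D `<=` E -> bm E f -> bm D f.
Proof.
move=> mE DE [mf [C fC]]; split; first exact: measurable_funS mf.
by exists C => x /DE; exact: fC.
Qed.

Variable mu : {measure set T -> \bar R}.

Lemma bm_integrable D f : measurable D -> (mu D < +oo)%E -> bm D f ->
  mu.-integrable D (EFin \o f).
Proof.
move=> mD Dfin [mf [C fC]]; apply: measurable_bounded_integrable => //.
exists C; split; first exact: num_real.
by move=> y Cy x Dx; apply: le_trans (fC _ Dx) (ltW Cy).
Qed.

Import HBNNSimple.

(* No measurability is required of [f] and [g]: the integral of a nonnegative function is a supremum over simple functions below it. *)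
Lemma ge0_integral_eq_off_null D (N : set T) (f g : T -> \bar R) :
  measurable D -> measurable N -> mu N = 0%E ->
  (forall x, D x -> 0 <= f x)%E -> (forall x, D x -> 0 <= g x)%E ->
  (forall x, D x -> ~ N x -> f x = g x) ->
  (\int[mu]_(x in D) f x = \int[mu]_(x in D) g x)%E.
Proof.
move=> mD mN N0.
have key (f' g' : T -> \bar R) : (forall x, D x -> 0 <= f' x)%E ->
    (forall x, D x -> 0 <= g' x)%E ->
    (forall x, D x -> ~ N x -> f' x = g' x) ->
    (\int[mu]_(x in D) f' x <= \int[mu]_(x in D) g' x)%E.
  move=> f0 g0 fg.
  rewrite [leLHS]ge0_integralE// [leRHS]ge0_integralE//.
  apply: ge_ereal_sup => _ [h hf <-].
  have mNc := measurableC mN.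
  (* Setting a simple minorant of [f'] to zero on the null set keeps its integral and makes it a
     minorant of [g']. *)
  have -> : sintegral mu h = sintegral mu (proj_nnsfun h mNc).
    rewrite -!integralT_nnsfun//.
    apply: ge0_ae_eq_integral => //.
    - exact/measurable_EFinP.
    - exact/measurable_EFinP.
    - by move=> x _; rewrite lee_fin.
    - by move=> x _; rewrite lee_fin.
    - exists N; split => // x /= xh; apply: contrapT => nNx; apply: xh => _.
      by rewrite mindicE mem_set// mulr1.
  apply: ereal_sup_ubound; exists (proj_nnsfun h mNc) => //= x.
  rewrite mindicE; have [xN|xN] := boolP (x \in ~` N); last first.
    rewrite mulr0; rewrite patchE; case: ifPn => // /set_mem Dx; exact: g0.
  rewrite mulr1; apply: le_trans (hf x) _.
  rewrite !patchE; case: ifPn => // /set_mem Dx.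
  by rewrite fg//; exact: set_mem xN.
move=> f0 g0 fg; apply/eqP; rewrite eq_le; apply/andP; split; apply: key => //.
by move=> x Dx Nx; rewrite fg.
Qed.

(** Positive and negative parts are compared separately, so equality holds even for integrands that
    are not measurable or not integrable. This is what allows the solution inside the weak
    formulation to be traded for a bounded representative. *)
Lemma Rintegral_ae_eq D f g : measurable D ->
  {ae mu, forall x, D x -> f x = g x} ->
  \int[mu]_(x in D) f x = \int[mu]_(x in D) g x.
Proof.
move=> mD [N [mN N0 fgN]]; congr fine.
have fg x : D x -> ~ N x -> f x = g x.
  by move=> Dx Nx; apply: contrapT => h; apply: Nx; apply: fgN => /= /(_ Dx).
rewrite integralE [RHS]integralE; congr (_ - _)%E;
  apply: (ge0_integral_eq_off_null mD mN N0) => //.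
- by move=> x Dx Nx; rewrite !funeposE /= fg.
- by move=> x Dx Nx; rewrite !funenegE /= fg.
Qed.

End BoundedMeasurable.

(** * Calculus of integrals over compact intervals *)

Section IntervalIntegral.
Context {R : realType}.
Notation leb := (@lebesgue_measure R).
Implicit Types (a b c : R) (f g : R -> R).

Definition lint a b f : R := \int[leb]_(x in `[a, b]) f x.

Lemma intTE f : intT f = lint 0 1 f. Proof. by []. Qed.

Lemma leb_itv_fin a b : (leb `[a, b]%classic < +oo)%E.
Proof. by rewrite lebesgue_measure_itv; case: ifP => _; rewrite ?ltry// ltey. Qed.

Lemma bm_lint a b f : bm `[a, b] f -> leb.-integrable `[a, b] (EFin \o f).
Proof.
exact: (@bm_integrable _ (measurableTypeR R) R leb _ f (measurable_itv _)
  (leb_itv_fin a b)).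
Qed.

Lemma bm_cont a b f : continuous f -> bm `[a, b] f.
Proof.
move=> cf; split.
  by apply: measurable_funTS; exact: continuous_measurable_fun.
have [ab|ba] := leP a b; last first.
  exists 0 => x /=; rewrite in_itv/= => /andP[ax xb].
  by move: (le_lt_trans (le_trans ax xb) ba); rewrite ltxx.
have cf' : {within `[a, b], continuous (fun x => `|f x|)}.
  apply: continuous_subspaceT => x.
  by apply: continuous_comp; [exact: cf|exact: norm_continuous].
have [c _ cmax] := EVT_max ab cf'.
by exists `|f c| => x /= xab; apply: cmax.
Qed.

Lemma eq_lint a b f g : (forall x, a <= x <= b -> f x = g x) ->
  lint a b f = lint a b g.
Proof. by move=> fg; apply: eq_Rintegral => x /set_mem /=; rewrite in_itv/=; exact: fg. Qed.

Lemma lintD a b f g : bm `[a, b] f -> bm `[a, b] g ->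
  lint a b (fun x => f x + g x) = lint a b f + lint a b g.
Proof. by move=> bf bg; apply: RintegralD => //; exact: bm_lint. Qed.

Lemma lintB a b f g : bm `[a, b] f -> bm `[a, b] g ->
  lint a b (fun x => f x - g x) = lint a b f - lint a b g.
Proof. by move=> bf bg; apply: RintegralB => //; exact: bm_lint. Qed.

Lemma lintZ a b r f : bm `[a, b] f ->
  lint a b (fun x => r * f x) = r * lint a b f.
Proof. by move=> bf; apply: RintegralZl (bm_lint bf). Qed.

Lemma lintN a b f : bm `[a, b] f -> lint a b (fun x => - f x) = - lint a b f.
Proof.
move=> bf; rewrite -mulN1r -lintZ//; apply: eq_lint => x _.
by rewrite mulN1r.
Qed.

Lemma lint_cst a b r : a <= b -> lint a b (fun=> r) = r * (b - a).
Proof.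
move=> ab; rewrite /lint Rintegral_cst//= lebesgue_measure_itv/= lte_fin.
by move: ab; rewrite le_eqVlt => /predU1P[->|->]//; rewrite ltxx subrr.
Qed.

Lemma lint0 a b : lint a b (fun=> 0) = 0.
Proof. by rewrite /lint Rintegral_cst// mul0r. Qed.

Lemma lint_sum a b (I : Type) (s : seq I) (F : I -> R -> R) :
  (forall i, bm `[a, b] (F i)) ->
  lint a b (fun x => \sum_(i <- s) F i x) = \sum_(i <- s) lint a b (F i).
Proof.
move=> bF; elim: s => [|i s IH].
  by rewrite big_nil -[RHS](lint0 a b); apply: eq_lint => x _; rewrite big_nil.
rewrite big_cons -IH -lintD//; last exact: bm_sum.
by apply: eq_lint => x _; rewrite big_cons.
Qed.

Lemma le_lint a b f g : bm `[a, b] f -> bm `[a, b] g ->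
  (forall x, a <= x <= b -> f x <= g x) -> lint a b f <= lint a b g.
Proof.
move=> bf bg fg; apply: (le_Rintegral _ (bm_lint bf) (bm_lint bg)) => //.
Qed.

Lemma lint_ge0 a b f : (forall x, a <= x <= b -> 0 <= f x) -> 0 <= lint a b f.
Proof. by move=> f0; apply: Rintegral_ge0 => x /=; rewrite in_itv/=; exact: f0. Qed.

Lemma lint_norm a b f : bm `[a, b] f ->
  `|lint a b f| <= lint a b (fun x => `|f x|).
Proof. by move=> bf; apply: le_normr_Rintegral (bm_lint bf). Qed.

Lemma lint_norm_le a b f C : a <= b -> bm `[a, b] f ->
  (forall x, a <= x <= b -> `|f x| <= C) -> `|lint a b f| <= C * (b - a).
Proof.
move=> ab bf fC; apply: le_trans (lint_norm bf) _.
by rewrite -lint_cst//; apply: le_lint => //; [exact: bm_norm|exact: bm_cst].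
Qed.

Lemma bm_itvS a b c e f : a <= c -> e <= b -> bm `[a, b] f -> bm `[c, e] f.
Proof.
move=> ac eb; apply: bm_sub => //.
by apply: subset_itv; rewrite bnd_simp.
Qed.

Lemma lint_split a b c f : a <= b -> b <= c -> bm `[a, c] f ->
  lint a c f = lint a b f + lint b c f.
Proof.
move=> ab bc bf; apply/eqP; rewrite addrC -subr_eq; apply/eqP.
rewrite /lint Rintegral_itvB ?bnd_simp//; last exact: bm_lint.
rewrite Rintegral_itv_obnd_cbnd//.
apply: (@integrableS _ (measurableTypeR R) _ leb `[a, c]%classic) => //; last exact: bm_lint.
by apply: subset_itv; rewrite bnd_simp.
Qed.

Lemma lint_pt a f : lint a a f = 0.
Proof. by rewrite /lint set_itv1 Rintegral_set1. Qed.

Lemma lint_ae_eq a b f g :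
  {ae leb, forall x, `[a, b]%classic x -> f x = g x} -> lint a b f = lint a b g.
Proof. exact: Rintegral_ae_eq. Qed.

Lemma ae_mono (P Q : R -> Prop) : (forall x, P x -> Q x) ->
  {ae leb, forall x, P x} -> {ae leb, forall x, Q x}.
Proof.
move=> PQ [N [mN N0 PN]]; exists N; split => // x nQ.
by apply: PN => Px; apply: nQ; exact: PQ.
Qed.

Lemma ae_and (P Q : R -> Prop) : {ae leb, forall x, P x} ->
  {ae leb, forall x, Q x} -> {ae leb, forall x, P x /\ Q x}.
Proof.
move=> [N [mN N0 PN]] [N' [mN' N'0 QN]]; exists (N `|` N'); split.
- exact: measurableU.
- by rewrite measureU0.
- move=> x /= nPQ; have [Px|nPx] := pselect (P x); last by left; apply: PN.
  by right; apply: QN => Qx; apply: nPQ.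
Qed.

Lemma lint_cvg a b (f_ : nat -> R -> R) f C :
  (forall n, bm `[a, b] (f_ n)) -> bm `[a, b] f ->
  (forall n x, a <= x <= b -> `|f_ n x| <= C) ->
  {ae leb, forall x, `[a, b]%classic x -> f_ ^~ x @ \oo --> f x} ->
  lint a b (f_ n) @[n --> \oo] --> lint a b f.
Proof.
move=> bf_ bf fC fcvg.
have [] := @dominated_convergence _ _ _ leb `[a, b]%classic (measurable_itv _)
  (fun n => EFin \o f_ n) (EFin \o f) (cst C%:E).
- by move=> n; apply/measurable_EFinP; exact: (bf_ n).1.
- by apply/measurable_EFinP; exact: bf.1.
- apply: ae_mono fcvg => x h xab; apply/fine_cvgP; split.
    by near=> n.
  exact: h.
- exact: (bm_lint (bm_cst _ C)).
- by apply: aeW => x n /=; rewrite in_itv/= lee_fin; exact: fC.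
- move=> _ _.
  have -> : (\int[leb]_(x in `[a, b]) (EFin \o f) x = (lint a b f)%:E)%E.
    by rewrite /lint /Rintegral fineK//; exact: (integrable_fin_num _ (bm_lint bf)).
  by move/fine_cvg.
Unshelve. all: by end_near. Qed.

End IntervalIntegral.

(** * Functions of time and space, and their space integrals *)

Section Strip.
Context {R : realType}.
Notation leb := (@lebesgue_measure R).

Implicit Types (T t : R).

Definition strip (T : R) : set (R * R) := `[0, T]%classic `*` `[0, 1]%classic.

Lemma measurable_strip T : measurable (strip T).
Proof. by apply: measurableX; exact: measurable_itv. Qed.

Lemma bm_strip_slice T (F : R * R -> R) t : 0 <= t <= T ->
  bm (strip T) F -> bm (@T01 R) (fun x => F (t, x)).
Proof.
move=> tT [mF [C FC]]; split; last first.
  by exists C => x x01; apply: FC; split; rewrite //= in_itv.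
apply: (@measurable_comp _ _ _ _ _ _ (strip T)) => //.
- exact: measurable_strip.
- by move=> _ /= [x x01 <-]; split; rewrite //= in_itv.
- apply: measurable_funTS; exact: pair1_measurable.
Qed.

(** Tonelli's theorem gives measurability of the inner integral for nonnegative functions on the
    whole plane; hence [F] is shifted by its bound, extended by zero, and shifted back after
    integration. *)
Lemma bm_strip_lint T (F : R * R -> R) : bm (strip T) F ->
  bm `[0, T] (fun t => lint 0 1 (fun x => F (t, x))).
Proof.
move=> bF; have [mF [C FC]] := bF; split; last first.
  exists C => t /=; rewrite in_itv/= => tT.
  rewrite -[leRHS]mulr1 -[X in _ * X]subr0; apply: lint_norm_le => //.
    exact: (bm_strip_slice tT bF).
  by move=> x x01; apply: FC; split; rewrite /= in_itv.
pose G := (fun p => (F p + C)%:E) \_ (strip T).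
have G0 p : (0 <= G p)%E.
  rewrite /G patchE; case: ifPn => // /set_mem Sp.
  by rewrite lee_fin -lerBlDr sub0r; have := FC _ Sp; rewrite ler_norml => /andP[].
have mG : measurable_fun setT G.
  apply/(measurable_restrictT _ (measurable_strip T)).
  by apply/measurable_EFinP; apply: measurable_funD => //; exact: measurable_cst.
have := @measurable_fun_fubini_tonelli_F _ _ (measurableTypeR R)
  (measurableTypeR R) R leb G mG G0.
rewrite /fubini_F => mI.
have : measurable_fun `[0, T] (fun t => fine (\int[leb]_y G (t, y))%E - C).
  apply: measurable_funB; last exact: measurable_cst.
  by apply: measurable_funTS; apply: measurableT_comp.
apply: eq_measurable_fun => t /set_mem /= tT.
have E y : G (t, y) = ((fun x => (F (t, x) + C)%:E) \_ `[0, 1]) y.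
  rewrite /G !patchE; congr (if _ then _ else _).
  by apply/idP/idP => /set_mem h; apply/mem_set; [case: h|split].
under eq_integral do rewrite E.
rewrite -integral_mkcond.
have bt : bm (@T01 R) (fun x => F (t, x)).
  by apply: (bm_strip_slice _ bF); move: tT; rewrite in_itv.
transitivity (lint 0 1 (fun x => F (t, x) + C) - C); first by [].
by rewrite lintD//; [rewrite lint_cst// subr0 mulr1 addrK|exact: bm_cst].
Qed.

End Strip.

(** * Lipschitz functions of time as primitives of bounded functions *)

Section Prim.
Context {R : realType}.
Implicit Types (A B : R -> R) (T : R).

(** Integrated form of $A'=B$ for a [B] that is merely bounded and measurable, where no pointwise
    derivative is available. *)
Definition prim T A B := bm `[0, T] B /\
  forall s t, 0 <= s -> s <= t -> t <= T -> A t - A s = lint s t B.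

(** Over $n+1$ equal steps the total increment is at most $(n+1)\,C\,(T/(n+1))^2$, which tends to
    $0$. *)
Lemma quadratic_increment_cst (G : R -> R) T C : 0 <= T ->
  (forall s t, 0 <= s -> s <= t -> t <= T -> `|G t - G s| <= C * (t - s) ^+ 2) ->
  G T = G 0.
Proof.
move=> T0 GC.
have C0 : 0 <= C * T ^+ 2.
  by apply: le_trans (normr_ge0 (G T - G 0)) _; rewrite -[X in _ * X ^+ 2]subr0; exact: GC.
have key (n i : nat) : (i <= n.+1)%N ->
    `|G (i%:R * (T / n.+1%:R)) - G 0| <= i%:R * (C * (T / n.+1%:R) ^+ 2).
  have h0 : 0 <= T / n.+1%:R by rewrite divr_ge0.
  elim: i => [|i IH] ilen; first by rewrite !mul0r subrr normr0.
  rewrite -(subrKA (G (i%:R * (T / n.+1%:R)))) (le_trans (ler_normD _ _))//.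
  rewrite -[i.+1]addn1 natrD [X in _ <= X]mulrDl addrC lerD ?IH//; first exact: ltnW.
  rewrite mul1r; have -> : (T / n.+1%:R) ^+ 2 =
     ((i%:R + 1) * (T / n.+1%:R) - i%:R * (T / n.+1%:R)) ^+ 2 by congr (_ ^+ 2); ring.
  apply: GC.
  - by rewrite mulr_ge0.
  - by rewrite ler_wpM2r// lerDl.
  - rewrite mulrA ler_pdivrMr// mulrC ler_wpM2l//.
    by rewrite natr1 ler_nat.
apply/eqP; rewrite -subr_eq0 -normr_le0; apply/ler_addgt0Pr => e e0.
rewrite add0r; have [n hn] : exists n : nat, C * T ^+ 2 / e < n.+1%:R.
  by have := archi_boundP (divr_ge0 C0 (ltW e0)) => h; exists (Num.bound (C * T ^+ 2 / e));
   rewrite (lt_le_trans h)// ler_nat.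
have := key n n.+1 (leqnn _).
rewrite mulrCA divff ?mulr1// => /le_trans; apply.
have -> : n.+1%:R * (C * (T / n.+1%:R) ^+ 2) = C * T ^+ 2 / n.+1%:R :> R.
  by field; rewrite nat1r pnatr_eq0.
by rewrite ler_pdivrMr// -ler_pdivrMl// [X in X <= _]mulrC ltW.
Qed.

Lemma prim_lip T A B : 0 <= T -> prim T A B -> exists C, [/\ 0 <= C,
  (forall s t, 0 <= s -> s <= t -> t <= T -> `|A t - A s| <= C * (t - s)),
  (forall t, 0 <= t -> t <= T -> `|A t| <= C) &
  (forall t, 0 <= t -> t <= T -> `|B t| <= C)].
Proof.
move=> T0 [[mB [C BC]] AB].
have BC' t : 0 <= t -> t <= T -> `|B t| <= C.
  by move=> t0 tT; apply: BC; rewrite /= in_itv/= t0.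
have C0 : 0 <= C := le_trans (normr_ge0 _) (BC' 0 (lexx _) T0).
have lip s t : 0 <= s -> s <= t -> t <= T -> `|A t - A s| <= C * (t - s).
  move=> s0 st tT; rewrite AB//; apply: lint_norm_le => //.
    by apply: (@bm_itvS _ 0 T); first exact: s0; first exact: tT; split => //; exists C.
  by move=> x /andP[sx xt]; apply: BC'; [exact: le_trans sx|exact: le_trans tT].
exists (C + (`|A 0| + C * T)); split => //.
- by rewrite addr_ge0// addr_ge0// mulr_ge0.
- move=> s t s0 st tT; apply: le_trans (lip _ _ s0 st tT) _.
  by rewrite ler_wpM2r ?subr_ge0// lerDl addr_ge0// mulr_ge0.
- move=> t t0 tT; rewrite -(subrK (A 0) (A t)) (le_trans (ler_normD _ _))//.
  rewrite addrC; apply: (@le_trans _ _ (`|A 0| + C * T)); last by rewrite lerDr.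
  rewrite lerD2l; apply: le_trans (lip 0 t _ _ _) _ => //.
  by rewrite subr0 ler_wpM2l.
- by move=> t t0 tT; apply: le_trans (BC' _ t0 tT) _; rewrite lerDl addr_ge0// mulr_ge0.
Qed.

(** [A] is Lipschitz on $[0,T]$; composed with the clamp to $[0,T]$ it is Lipschitz on the whole
    line, hence continuous and measurable. *)
Lemma prim_bm T A B : 0 <= T -> prim T A B -> bm `[0, T] A.
Proof.
move=> T0 AB; have [C [C0 lip _ _]] := prim_lip T0 AB.
pose cl (t : R) := Num.max 0 (Num.min t T).
have clT t : 0 <= cl t <= T.
  by rewrite /cl le_max lexx/= ge_max T0 ge_min lexx orbT.
have clip s t : s <= t -> cl s <= cl t /\ cl t - cl s <= t - s.
  by move=> st; rewrite /cl; case: (leP s T) => sT; case: (leP t T) => tT;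
    case: (leP 0 s) => s0; case: (leP 0 t) => t0; case: (leP 0 T) => T0';
    split; lra.
have Alip s t : s <= t -> `|A (cl t) - A (cl s)| <= C * (t - s).
  move=> st; have [h1 h2] := clip _ _ st; have /andP[s0 _] := clT s; have /andP[_ tT] := clT t.
  by apply: le_trans (lip _ _ s0 h1 tT) _; rewrite ler_wpM2l.
have Alip' s t : `|A (cl s) - A (cl t)| <= C * `|s - t|.
  case: (lerP s t) => [st|/ltW ts]; last exact: Alip.
  by rewrite distrC; exact: Alip.
have cont : continuous (A \o cl).
  move=> x; apply/cvgrPdist_le => e e0; near=> y.
  apply: le_trans (Alip' _ _) _.
  have : `|x - y| <= e / (C + 1).
    near: y; apply: cvgr_dist_le; first exact: cvg_id.
    by rewrite divr_gt0// ltr_wpDl.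
  rewrite ler_pdivlMr ?ltr_wpDl// => h; apply: le_trans h.
  by rewrite mulrC ler_wpM2l// lerDl.
apply: (bm_ext _ (@bm_cont _ 0 T _ cont)) => t /=.
by rewrite in_itv/= /cl => /andP[t0 tT]; rewrite (min_idPl tT) (max_idPr t0).
Unshelve. all: by end_near. Qed.

(** A defect of second order cannot accumulate: $A$ minus the integral of $B$ has quadratic
    increments and is therefore constant. This is the tool for the product rule. *)
Lemma prim_quadratic T A B C : 0 <= T -> bm `[0, T] B ->
  (forall s t, 0 <= s -> s <= t -> t <= T ->
    `|A t - A s - lint s t B| <= C * (t - s) ^+ 2) -> prim T A B.
Proof.
move=> T0 bB hC; split => // s t s0 st tT.
pose G r := A (s + r) - lint s (s + r) B.
have bI a b : 0 <= a -> b <= T -> bm `[a, b] B by move=> a0 bT; exact: bm_itvS bB.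
have := @quadratic_increment_cst G (t - s) C.
rewrite /G subrKC addr0 lint_pt subr0 => H.
have st0 : 0 <= t - s by rewrite subr_ge0.
rewrite -(H st0); first by rewrite opprB addrCA subrr addr0.
move=> p q p0 pq qt.
have -> : lint s (s + q) B = lint s (s + p) B + lint (s + p) (s + q) B.
  by apply: lint_split; [lra|lra|apply: bI; lra].
have -> : A (s + q) - (lint s (s + p) B + lint (s + p) (s + q) B) -
   (A (s + p) - lint s (s + p) B) = A (s + q) - A (s + p) - lint (s + p) (s + q) B by lra.
have -> : q - p = (s + q) - (s + p) by lra.
by apply: hC; lra.
Qed.

Lemma prim_ext T A B A' B' : (forall t, 0 <= t <= T -> A t = A' t) ->
  (forall t, 0 <= t <= T -> B t = B' t) -> prim T A B -> prim T A' B'.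
Proof.
move=> AA BB [bB AB]; split.
  by apply: bm_ext bB => t /=; rewrite in_itv/=; exact: BB.
move=> s t s0 st tT; rewrite -!AA ?AB//.
- by apply: eq_lint => r /andP[sr rt]; apply: BB; rewrite (le_trans s0)//= (le_trans rt).
- by rewrite s0 (le_trans st).
- by rewrite tT (le_trans s0).
Qed.

Lemma primD T A B A' B' : prim T A B -> prim T A' B' ->
  prim T (fun t => A t + A' t) (fun t => B t + B' t).
Proof.
move=> [bB AB] [bB' AB']; split; first exact: bmD.
move=> s t s0 st tT; rewrite (lintD (bm_itvS s0 tT bB) (bm_itvS s0 tT bB')).
by rewrite -AB// -AB'//; ring.
Qed.

Lemma prim_restrict T T' A B : T' <= T -> prim T A B -> prim T' A B.
Proof.
move=> TT' [bB AB]; split; first exact: bm_itvS bB.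
by move=> s t s0 st tT'; apply: AB => //; exact: le_trans TT'.
Qed.

Lemma prim_cst T (r : R) : prim T (fun=> r) (fun=> 0).
Proof. by split; [exact: bm_cst|move=> s t _ _ _; rewrite lint0 subrr]. Qed.

Lemma primZ T r A B : prim T A B -> prim T (fun t => r * A t) (fun t => r * B t).
Proof.
move=> [bB AB]; split; first exact: bmZ.
by move=> s t s0 st tT; rewrite (lintZ _ (bm_itvS s0 tT bB)) -AB// mulrBr.
Qed.

Lemma prim_sum T (I : Type) (s : seq I) (A B : I -> R -> R) :
  (forall i, prim T (A i) (B i)) ->
  prim T (fun t => \sum_(i <- s) A i t) (fun t => \sum_(i <- s) B i t).
Proof.
move=> AB; elim: s => [|i s IH].
  by apply: (prim_ext _ _ (prim_cst T 0)) => t _; rewrite big_nil.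
by apply: (prim_ext _ _ (primD (AB i) IH)) => t _; rewrite big_cons.
Qed.

Lemma primM T A B A' B' : 0 <= T -> prim T A B -> prim T A' B' ->
  prim T (fun t => A t * A' t) (fun t => A t * B' t + B t * A' t).
Proof.
move=> T0 AB AB'.
have [C [C0 lip bA bB]] := prim_lip T0 AB.
have [C' [C'0 lip' bA' bB']] := prim_lip T0 AB'.
have mA := prim_bm T0 AB; have mA' := prim_bm T0 AB'.
have [mB dA] := AB; have [mB' dA'] := AB'.
apply: (@prim_quadratic _ _ _ (3 * (C * C'))) => //.
  by apply: bmD; exact: bmM.
move=> s t s0 st tT.
have sI f : bm `[0, T] f -> bm `[s, t] f := bm_itvS s0 tT.
(* With the values at [s] split off, each of the three remaining terms contains two increments, or
   one increment under an integral, and is at most $CC'(t-s)^2$. *)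
have -> : A t * A' t - A s * A' s - lint s t (fun r => A r * B' r + B r * A' r) =
  (A t - A s) * (A' t - A' s) -
  lint s t (fun r => (A r - A s) * B' r + B r * (A' r - A' s)).
  have -> : lint s t (fun r => A r * B' r + B r * A' r) =
     lint s t (fun r => (A r - A s) * B' r + B r * (A' r - A' s)) +
     (A s * lint s t B' + A' s * lint s t B).
    rewrite -!lintZ; try exact: sI.
    rewrite -!lintD; first (by apply: eq_lint => r _; ring); repeat first
      [exact: bm_cst | exact: sI | apply: bmB | apply: bmD | apply: bmM].
  by rewrite -dA// -dA'//; ring.
have -> : 3 * (C * C') * (t - s) ^+ 2 =
  C * (t - s) * (C' * (t - s)) + (C * C' * (t - s) + C * C' * (t - s)) * (t - s) by ring.
apply: le_trans (ler_normB _ _) _; rewrite lerD//.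
  by rewrite normrM ler_pM// ?lip// lip'.
apply: lint_norm_le => //.
  by repeat first [exact: bm_cst | exact: sI | apply: bmB | apply: bmD | apply: bmM].
move=> r /andP[sr rt].
have r0 : 0 <= r by apply: le_trans sr.
have rT : r <= T by apply: le_trans rt tT.
have sT : s <= T by apply: le_trans st tT.
have rs : r - s <= t - s by rewrite lerD2r.
apply: le_trans (ler_normD _ _) _; rewrite lerD//.
  rewrite normrM (mulrAC C) ler_pM//; last exact: bB'.
  by apply: le_trans (lip _ _ s0 sr rT) _; rewrite ler_wpM2l.
rewrite normrM -mulrA ler_pM//; first exact: bB.
by apply: le_trans (lip' _ _ s0 sr rT) _; rewrite ler_wpM2l.
Qed.

Lemma prim_derive T (F f : R -> R) : continuous f ->
  (forall x, is_derive x (1 : R) F (f x)) -> prim T F f.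
Proof.
move=> cf dF; split; first exact: bm_cont.
move=> s t _; rewrite le_eqVlt => /predU1P[->|st] _; first by rewrite lint_pt subrr.
have cF : continuous F.
  by move=> x; apply/differentiable_continuous/derivable1_diffP; case: (dF x).
rewrite /lint /Rintegral (@continuous_FTC2 _ f F)//.
- by apply: continuous_subspaceT.
- split.
  + by move=> x _; case: (dF x).
  + exact/cvg_at_right_filter/cF.
  + exact/cvg_at_left_filter/cF.
- by move=> x _; rewrite derive1E; case: (dF x).
Qed.

(** Integrating factor $e^{\lambda r}$. The weight $e^{-\lambda(T-r)}\le1$ on the error is
    discarded, as the error will only have to vanish in a limit. *)
Lemma prim_gronwall T L X (e : R -> R) lam : 0 <= T -> 0 <= lam -> prim T L X ->
  bm `[0, T] e -> (forall r, 0 <= r <= T -> X r <= - lam * L r + e r) ->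
  L T <= expR (- lam * T) * L 0 + lint 0 T (fun r => `|e r|).
Proof.
move=> T0 lam0 LX be Xle.
have cexp : continuous (fun r : R => lam * expR (lam * r)).
  move=> x; apply: cvgM; first exact: cvg_cst.
  apply: (@continuous_comp _ _ _ (fun r => lam * r) expR); last exact: continuous_expR.
  by apply: cvgM; [exact: cvg_cst|exact: cvg_id].
have pE : prim T (fun r => expR (lam * r)) (fun r => lam * expR (lam * r)).
  apply: prim_derive => // x.
  by apply: is_derive_eq; rewrite /GRing.scale/= mulr1 mulrC.
have [bP dP] := primM T0 pE LX.
have := dP 0 T (lexx _) T0 (lexx _); rewrite mulr0 expR0 mul1r.
have bL := prim_bm T0 LX; have bE := prim_bm T0 pE; have bX := LX.1.
move=> H.
have : expR (lam * T) * L T - L 0 <= expR (lam * T) * lint 0 T (fun r => `|e r|).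
  rewrite H -lintZ; last exact: bm_norm.
  apply: le_lint => //; first by apply: bmZ; exact: bm_norm.
  move=> r rT; have Er := expR_gt0 (lam * r).
  apply: (@le_trans _ _ (expR (lam * r) * e r)).
    have := Xle r rT; rewrite -(ler_pM2l Er) mulrDr; nra.
  apply: (@le_trans _ _ (expR (lam * r) * `|e r|)).
    by rewrite ler_pM2l// ler_norm.
  by rewrite ler_wpM2r// ler_expR ler_wpM2l//; case/andP: rT.
rewrite lerBlDr => /(ler_wpM2l (ltW (expR_gt0 (- lam * T)))).
rewrite mulrDr !mulrA mulNr -expRD addNr expR0 !mul1r; lra.
Qed.
End Prim.

(** * Trigonometric polynomials *)

Section Trig.
Context {R : realType}.
Implicit Types (x y phi d e h : R) (k l : int).
Notation leb := (@lebesgue_measure R).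

(** A free phase makes one family serve for everything: the sine is the phase $-\pi/2$,
    differentiation adds $\pi/2$, translation and products only change phases and frequencies. *)
Definition wave k phi x : R := cos (k%:~R * (pi *+ 2 * x) + phi).

Lemma cosDz (a : R) k : cos (a + k%:~R * (pi *+ 2)) = cos a.
Proof.
have H (b : R) (n : nat) : cos (b + n%:R * (pi *+ 2)) = cos b.
  elim: n b => [|n IH] b; first by rewrite mul0r addr0.
  by rewrite -natr1 mulrDl mul1r addrA cosD2pi IH.
case: k => n; first exact: H.
by rewrite NegzE mulrNz mulNr -[LHS](H _ n.+1) -pmulrn subrK.
Qed.

Lemma wave_periodic k phi x : wave k phi (x + 1) = wave k phi x.
Proof. by rewrite /wave mulrDr mulr1 mulrDr addrAC cosDz. Qed.

Lemma wave_derive k phi x : is_derive x (1 : R) (wave k phi)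
  ((k%:~R * (pi *+ 2)) * wave k (phi + pi / 2) x).
Proof.
rewrite /wave addrA cosDpihalf.
by apply: is_derive_eq; rewrite /GRing.scale/=; ring.
Qed.

Lemma continuous_wave k phi : continuous (wave k phi).
Proof.
move=> x; apply/differentiable_continuous/derivable1_diffP.
by case: (wave_derive k phi x).
Qed.

Lemma bm_wave k phi : bm (@T01 R) (wave k phi).
Proof. exact: (@bm_cont _ 0 1 _ (@continuous_wave k phi)). Qed.

Lemma lint_wave k phi : lint 0 1 (wave k phi) = if k == 0 then cos phi else 0.
Proof.
case: eqP => [->|/eqP k0].
  rewrite -[RHS](mulr1 (cos phi)) -[X in _ * X]subr0 -lint_cst//.
  by apply: eq_lint => x _; rewrite /wave mul0r add0r.
pose w : R := k%:~R * (pi *+ 2).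
have w0 : w != 0 by rewrite mulf_neq0// ?intr_eq0// mulrn_eq0/= gt_eqF// pi_gt0.
have dF x : is_derive x (1 : R) (fun x => w^-1 * wave k (phi - pi / 2) x) (wave k phi x).
  have D := wave_derive k (phi - pi / 2) x.
  apply: is_derive_eq; rewrite /GRing.scale/= -/w.
  by rewrite subrK mulrA mulVf// mul1r.
have [_ /(_ 0 1 (lexx _) ler01 (lexx _)) <-] := prim_derive 1 (@continuous_wave k phi) dF.
by rewrite -(wave_periodic _ _ 0) add0r subrr.
Qed.

Lemma waveM k l phi psi x :
  wave k phi x * wave l psi x = 2^-1 * (wave (k + l) (phi + psi) x + wave (k - l) (phi - psi) x).
Proof.
rewrite /wave !intrD mulrNz.
have -> : (k%:~R + l%:~R) * (pi *+ 2 * x) + (phi + psi) =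
  (k%:~R * (pi *+ 2 * x) + phi) + (l%:~R * (pi *+ 2 * x) + psi) by ring.
have -> : (k%:~R - l%:~R) * (pi *+ 2 * x) + (phi - psi) =
  (k%:~R * (pi *+ 2 * x) + phi) - (l%:~R * (pi *+ 2 * x) + psi) by ring.
move: (_ * _ + phi) (_ * _ + psi) => A B.
by rewrite cosD cosB; field.
Qed.

Lemma lint_waveM k l phi psi :
  lint 0 1 (fun x => wave k phi x * wave l psi x) =
  2^-1 * ((if k + l == 0 then cos (phi + psi) else 0) +
          (if k - l == 0 then cos (phi - psi) else 0)).
Proof.
under eq_lint do rewrite waveM.
by rewrite lintZ ?lintD ?lint_wave//; (try apply: bmD); exact: bm_wave.
Qed.

(* A trigonometric polynomial is encoded by a list of triples (amplitude, frequency, phase). *)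
Definition tpoly (s : seq (R * int * R)) x : R :=
  \sum_(q <- s) q.1.1 * wave q.1.2 q.2 x.

Lemma tpoly_periodic s x : tpoly s (x + 1) = tpoly s x.
Proof. by apply: eq_bigr => q _; rewrite wave_periodic. Qed.

Lemma tpoly_cons a k phi s x : tpoly ((a, k, phi) :: s) x = a * wave k phi x + tpoly s x.
Proof. by rewrite /tpoly big_cons. Qed.

Lemma continuous_tpoly s : continuous (tpoly s).
Proof.
elim: s => [|[[a k] phi] s IH].
  by rewrite (_ : tpoly [::] = fun=> 0); [move=> x; exact: cvg_cst|apply/funext => x; rewrite /tpoly big_nil].
rewrite (_ : tpoly _ = fun x => a * wave k phi x + tpoly s x); last first.
  by apply/funext => x; rewrite tpoly_cons.
move=> x; apply: cvgD; last exact: IH.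
by apply: cvgM; [exact: cvg_cst|exact: continuous_wave].
Qed.

Lemma bm_tpoly s : bm (@T01 R) (tpoly s).
Proof. exact: (@bm_cont _ 0 1 _ (@continuous_tpoly s)). Qed.

Definition tshift (h : R) (s : seq (R * int * R)) :=
  [seq (q.1.1, q.1.2, q.2 + q.1.2%:~R * (pi *+ 2 * h)) | q <- s].

Lemma tpoly_shift h s x : tpoly (tshift h s) x = tpoly s (x + h).
Proof.
rewrite /tpoly /tshift big_map; apply: eq_bigr => q _ /=; congr (_ * _).
by rewrite /wave; congr cos; ring.
Qed.

Lemma lint_tpoly s : lint 0 1 (tpoly s) =
  \sum_(q <- s) q.1.1 * (if q.1.2 == 0 then cos q.2 else 0).
Proof.
rewrite /tpoly lint_sum; last by move=> q; apply: bmZ; exact: bm_wave.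
by apply: eq_bigr => q _; rewrite lintZ ?lint_wave//; exact: bm_wave.
Qed.

(** Only frequency zero contributes to the mean, and a translation leaves its phase alone. *)
Lemma lint_tpoly_shift h s : lint 0 1 (fun x => tpoly s (x + h)) = lint 0 1 (tpoly s).
Proof.
under eq_lint do rewrite -tpoly_shift.
rewrite !lint_tpoly /tshift big_map; apply: eq_bigr => q _ /=.
by case: eqP => // ->; rewrite mul0r addr0.
Qed.

(** The de la Vallée Poussin kernel $\cos^{2n}(\pi x)$, not normalised: a nonnegative trigonometric
    polynomial concentrating at the integers. *)
Definition kern (n : nat) x : R := (2^-1 * (1 + cos (pi *+ 2 * x))) ^+ n.

Lemma kern_tpoly n : exists s, forall x, kern n x = tpoly s x.
Proof.
elim: n => [|n [s IH]].
  exists [:: (1, 0, 0)] => x.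
  by rewrite tpoly_cons /tpoly big_nil /wave mul0r !addr0 cos0 mulr1 /kern expr0.
(* Multiplying a wave of frequency $k$ by $(1+\cos2\pi x)/2$ leaves half of it and adds, by the
   product formula, a quarter of the waves of frequencies $1+k$ and $1-k$. *)
exists ([seq (2^-1 * q.1.1, q.1.2, q.2) | q <- s] ++
  [seq (4^-1 * q.1.1, 1 + q.1.2, q.2) | q <- s] ++
  [seq (4^-1 * q.1.1, 1 - q.1.2, - q.2) | q <- s]) => x.
rewrite /kern exprS -/(kern n x) IH /tpoly !big_cat !big_map/= -!big_split mulr_sumr.
apply: eq_bigr => q _ /=.
have -> : cos (pi *+ 2 * x) = wave 1 0 x by rewrite /wave mul1r addr0.
have := waveM 1 q.1.2 0 q.2 x; rewrite add0r sub0r => H.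
transitivity (2^-1 * (q.1.1 * wave q.1.2 q.2 x + q.1.1 * (wave 1 0 x * wave q.1.2 q.2 x))).
  by ring.
by rewrite H; field.
Qed.

Lemma kern_ge0 n x : 0 <= kern n x.
Proof.
by rewrite /kern exprn_ge0// mulr_ge0//; have := cos_geN1 (pi *+ 2 * x); lra.
Qed.

Lemma continuous_kern n : continuous (kern n).
Proof.
have [s Hs] := kern_tpoly n.
by rewrite (_ : kern n = tpoly s); [exact: continuous_tpoly|apply/funext].
Qed.

Lemma kern_shift_bm n x : bm (@T01 R) (fun y => kern n (x - y)).
Proof.
apply: (@bm_cont _ 0 1) => y; apply: (@continuous_comp _ _ _ (fun y => x - y) (kern n)).
  by apply: cvgB; [exact: cvg_cst|exact: cvg_id].
exact: continuous_kern.
Qed.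

Lemma kern_even n x : kern n (- x) = kern n x.
Proof. by rewrite /kern mulrN cosN. Qed.

Lemma lint_kern_shift n x : lint 0 1 (fun y => kern n (x - y)) = lint 0 1 (kern n).
Proof.
have [s Hs] := kern_tpoly n.
under eq_lint do rewrite -kern_even opprB Hs.
by rewrite lint_tpoly_shift; apply: eq_lint => y _; rewrite Hs.
Qed.

Lemma cos2pi_le (d x : R) : 0 <= d <= 2^-1 -> d <= x -> x <= 1 - d ->
  cos (pi *+ 2 * x) <= cos (pi *+ 2 * d).
Proof.
move=> /andP[d0 d2] dx x1d.
wlog x2 : x dx x1d / x <= 2^-1.
  move=> H; have [|x2] := leP x 2^-1; first exact: H.
  have -> : cos (pi *+ 2 * x) = cos (pi *+ 2 * (1 - x)).
    rewrite -[RHS]cosN -[RHS]cosD2pi; congr cos; ring.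
  by apply: H; lra.
have p0 := @pi_gt0 R.
have I y : 0 <= y -> y <= 2^-1 -> pi *+ 2 * y \in `[0, pi].
  by move=> y0 y2; rewrite in_itv/=; apply/andP; split; nra.
move: dx; rewrite le_eqVlt => /predU1P[->//|dx].
by rewrite ltW// ltr_cos ?I//; try lra; rewrite ltr_pM2l// mulrn_wgt0.
Qed.

(* At an interior point the mass of the kernel away from [x] is negligible against the mass near [x]. *)
Lemma kern_mean_bound n (g : R -> R) C x d e :
  0 < d -> d <= x -> x <= 1 - d -> continuous g -> 0 <= e ->
  (forall y, `|g y| <= C) ->
  (forall y, `|x - y| <= d -> `|g y - g x| <= e) ->
  `|lint 0 1 (fun y => g y * kern n (x - y)) - g x * lint 0 1 (kern n)| <=
  e * lint 0 1 (kern n) + 2 * C * kern n d.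
Proof.
move=> d0 dx x1d cg e0 gC gx.
have bk := kern_shift_bm n x.
have bg : bm (@T01 R) g by exact: (@bm_cont _ 0 1).
rewrite -(lint_kern_shift n x) -!lintZ// -lintB; [|exact: bmM|exact: bmZ].
apply: le_trans (lint_norm _) _; first by apply: bmB; [exact: bmM|exact: bmZ].
have -> : 2 * C * kern n d = lint 0 1 (fun=> 2 * C * kern n d).
  by rewrite lint_cst// subr0 mulr1.
rewrite -lintD; [|exact: bmZ|exact: bm_cst].
have C0 : 0 <= C := le_trans (normr_ge0 _) (gC 0).
apply: le_lint.
- by apply: bm_norm; apply: bmB; [exact: bmM|exact: bmZ].
- by apply: bmD; [exact: bmZ|exact: bm_cst].
move=> y /andP[y0 y1]; rewrite -mulrBl normrM (ger0_norm (kern_ge0 _ _)).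
have k0 := kern_ge0 n (x - y); have kd0 := kern_ge0 n d.
have [xy|xy] := leP `|x - y| d.
  apply: ler_wpDr; first by rewrite !mulr_ge0.
  by rewrite ler_wpM2r// gx.
apply: ler_wpDl; first by rewrite mulr_ge0.
apply: ler_pM => //.
  by apply: le_trans (ler_normB _ _) _; rewrite mulr_natl mulr2n lerD.
rewrite /kern; apply: lerXn2r; rewrite ?nnegrE.
- by rewrite mulr_ge0//; have := cos_geN1 (pi *+ 2 * (x - y)); lra.
- by rewrite mulr_ge0//; have := cos_geN1 (pi *+ 2 * d); lra.
rewrite ler_pM2l// lerD2l.
have -> : cos (pi *+ 2 * (x - y)) = cos (pi *+ 2 * `|x - y|).
  by case: (ger0P (x - y)) => _ //; rewrite mulrN cosN.
apply: cos2pi_le; [lra|exact: ltW|].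
by rewrite ler_norml; lra.
Qed.

(** Only $[0,d/2]$ is kept, where the kernel is at least its value at $d/2$. Bounding the mass by a
    value closer to the peak than [d] is what makes the next quotient decay geometrically. *)
Lemma kern_mass_ge n d : 0 < d -> d <= 1 -> d <= 2^-1 ->
  d / 2 * kern n (d / 2) <= lint 0 1 (kern n).
Proof.
move=> d0 d1 d2.
have bk : bm (@T01 R) (kern n) by exact: (@bm_cont _ 0 1 _ (@continuous_kern n)).
rewrite (@lint_split _ 0 (d / 2) 1); [|lra|lra|exact: bk].
apply: ler_wpDr; first by apply: lint_ge0 => x _; exact: kern_ge0.
have -> : d / 2 * kern n (d / 2) = lint 0 (d / 2) (fun=> kern n (d / 2)).
  by rewrite lint_cst ?divr_ge0 ?ltW// subr0 mulrC.
apply: le_lint; [exact: bm_cst|apply: (bm_itvS _ _ bk); lra|].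
move=> x /andP[x0 xd]; rewrite /kern; apply: lerXn2r; rewrite ?nnegrE.
- by rewrite mulr_ge0//; have := cos_geN1 (pi *+ 2 * (d / 2)); lra.
- by rewrite mulr_ge0//; have := cos_geN1 (pi *+ 2 * x); lra.
by rewrite ler_pM2l// lerD2l; apply: cos2pi_le; lra.
Qed.

Lemma kern_mass_gt0 n : 0 < lint 0 1 (kern n).
Proof.
apply: lt_le_trans (@kern_mass_ge n 2^-1 _ _ _); try lra.
rewrite mulr_gt0 ?divr_gt0//.
rewrite /kern exprn_gt0// mulr_gt0//.
have -> : pi *+ 2 * (2^-1 / 2) = pi / 2 :> R by field.
by rewrite cos_pihalf; lra.
Qed.

Lemma kern_concentration d : 0 < d -> d <= 2^-1 ->
  (kern n d / lint 0 1 (kern n)) @[n --> \oo] --> (0 : R).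
Proof.
move=> d0 d2.
(* The quotient of the bases whose $n$-th powers are [kern n d] and [kern n (d / 2)]. It is below
   $1$ by strict monotonicity of the cosine, and bounds the ratio in question by $(2/d)r^n$. *)
pose r := (2^-1 * (1 + cos (pi *+ 2 * d))) / (2^-1 * (1 + cos (pi *+ 2 * (d / 2)))).
have p0 := @pi_gt0 R.
have I y : 0 <= y -> y <= 2^-1 -> pi *+ 2 * y \in `[0, pi].
  by move=> y0 y2; rewrite in_itv/=; apply/andP; split; nra.
have cd : cos (pi *+ 2 * d) < cos (pi *+ 2 * (d / 2)).
  have i1 : pi *+ 2 * d \in `[0, pi] by apply: I; lra.
  have i2 : pi *+ 2 * (d / 2) \in `[0, pi] by apply: I; lra.
  rewrite ltr_cos// ltr_pM2l; last by rewrite mulrn_wgt0.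
  by lra.
have c1 := cos_geN1 (pi *+ 2 * d).
have b0 : 0 < 2^-1 * (1 + cos (pi *+ 2 * (d / 2))) by rewrite mulr_gt0//; lra.
have r0 : 0 <= r by rewrite divr_ge0 ?(ltW b0)// mulr_ge0//; lra.
have r1 : r < 1 by rewrite ltr_pdivrMr// mul1r ltr_pM2l// ltrD2l.
have rcvg : ((2 / d) * r ^+ n) @[n --> \oo] --> (0 : R).
  rewrite -(mulr0 (2 / d)); apply: cvgM; first exact: cvg_cst.
  by apply: cvg_expr; rewrite ger0_norm.
apply: (@squeeze_cvgr _ _ _ _ (fun=> 0) (fun n => (2 / d) * r ^+ n)) => //; last exact: cvg_cst.
apply: nearW => n; rewrite divr_ge0 ?kern_ge0 ?(ltW (kern_mass_gt0 _))//=.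
rewrite ler_pdivrMr ?kern_mass_gt0//.
have kn0 : 0 < kern n (d / 2) by rewrite exprn_gt0.
apply: (@le_trans _ _ ((2 / d) * r ^+ n * (d / 2 * kern n (d / 2)))); last first.
  rewrite ler_wpM2l ?kern_mass_ge//; try lra.
  by rewrite mulr_ge0 ?exprn_ge0// divr_ge0// ltW.
have -> : (2 / d) * r ^+ n * (d / 2 * kern n (d / 2)) = r ^+ n * kern n (d / 2).
  by field; rewrite gt_eqF.
by rewrite -exprMn /r divfK// gt_eqF.
Qed.

End Trig.

(** * Density of trigonometric polynomials that respect given bounds *)

Section TrigDensity.
Context {R : realType}.
Implicit Types (x y phi d e h lo hi C : R) (k l : int) (f g : R -> R).
Notation leb := (@lebesgue_measure R).

Lemma kern_conv_tpoly n f : bm (@T01 R) f -> exists s, forall x,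
  tpoly s x = lint 0 1 (fun y => f y * kern n (x - y)) / lint 0 1 (kern n).
Proof.
move=> bf; have [s0 Hs0] := @kern_tpoly R n.
pose Z := lint 0 1 (@kern R n).
pose c k psi := lint 0 1 (fun y => f y * wave k psi y).
exists ([seq (q.1.1 * c q.1.2 0 / Z, q.1.2, q.2) | q <- s0] ++
   [seq (q.1.1 * c q.1.2 (- (pi / 2)) / Z, q.1.2, q.2 - pi / 2) | q <- s0]) => x.
rewrite /tpoly big_cat !big_map/= -big_split/= -/Z.
under eq_lint do rewrite Hs0 /tpoly mulr_sumr.
have bw k psi : bm (@T01 R) (fun y => f y * wave k psi y).
  by apply: bmM => //; exact: bm_wave.
(* The addition formula separates [x] from [y], both sines being written as waves of phase lowered
   by $\pi/2$; integrating in [y] then leaves a polynomial in [x]. *)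
have E (q : R * int * R) y : f y * (q.1.1 * wave q.1.2 q.2 (x - y)) =
  (q.1.1 * wave q.1.2 q.2 x) * (f y * wave q.1.2 0 y) +
  (q.1.1 * wave q.1.2 (q.2 - pi / 2) x) * (f y * wave q.1.2 (- (pi / 2)) y).
  rewrite /wave !addr0 addrA !cosBpihalf.
  have -> : q.1.2%:~R * (pi *+ 2 * (x - y)) + q.2 =
    (q.1.2%:~R * (pi *+ 2 * x) + q.2) - q.1.2%:~R * (pi *+ 2 * y) by ring.
  by rewrite cosB; ring.
rewrite lint_sum; last first.
  move=> q; apply: (bm_ext (fun y _ => esym (E q y))).
  by apply: bmD; apply: bmZ; exact: bw.
rewrite mulr_suml; apply: eq_bigr => q _.
under eq_lint do rewrite E.
rewrite lintD; [|by apply: bmZ; exact: bw|by apply: bmZ; exact: bw].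
by rewrite !lintZ; [rewrite /c; ring|exact: bw|exact: bw].
Qed.

(** An average against a nonnegative kernel stays within the bounds, which Fourier partial sums
    would not do. The maximum principle relies on this to obtain nonnegative test polynomials. *)
Lemma kern_conv_between n g lo hi x : continuous g ->
  (forall y, lo <= g y <= hi) ->
  lo <= lint 0 1 (fun y => g y * kern n (x - y)) / lint 0 1 (kern n) <= hi.
Proof.
move=> cg glh; have Z0 := @kern_mass_gt0 R n.
have bg : bm (@T01 R) g by exact: (@bm_cont _ 0 1).
have bk := kern_shift_bm n x.
rewrite ler_pdivlMr// ler_pdivrMr// -(lint_kern_shift n x) -!lintZ//.
by apply/andP; split; apply: le_lint; try (exact: bmM); try (exact: bmZ);
  move=> y _; rewrite ler_wpM2r ?kern_ge0//; case/andP: (glh y).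
Qed.

(** As [g] is not assumed periodic, at an endpoint the limit would be the mean of [g 0] and [g 1];
    these two points form a null set. *)
Lemma kern_conv_cvg g C x : continuous g -> (forall y, `|g y| <= C) -> 0 < x < 1 ->
  (lint 0 1 (fun y => g y * kern n (x - y)) / lint 0 1 (kern n)) @[n --> \oo] --> g x.
Proof.
move=> cg gC /andP[x0 x1]; apply/cvgrPdist_le => /= e e0.
have e2 : 0 < e / 2 by rewrite divr_gt0.
have /cvgrPdist_le/(_ (e / 2) e2) := cg x.
move=> [d /= d0 gd].
pose d' := Num.min (d / 2) (Num.min (x / 2) ((1 - x) / 2)).
have [d'0 d'd d'x d'1] : [/\ 0 < d', d' < d, d' <= x & d' <= 1 - x].
  rewrite /d'; split; rewrite ?lt_min ?gt_min ?ge_min.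
  - by rewrite !divr_gt0// subr_gt0.
  - by apply/orP; left; lra.
  - by apply/orP; right; apply/orP; left; lra.
  - by apply/orP; right; apply/orP; right; lra.
have C0 : 0 <= C := le_trans (normr_ge0 _) (gC 0).
have /cvgrPdist_le/(_ (e / (2 * (2 * C + 1)))) := @kern_concentration R d' d'0 ltac:(lra).
have eC : 0 < e / (2 * (2 * C + 1)) by rewrite divr_gt0// mulr_gt0// ltr_wpDl// mulr_ge0.
move=> /(_ eC) H; near=> n.
have Z0 := @kern_mass_gt0 R n.
have := @kern_mean_bound R n g C x d' (e / 2) d'0 d'x ltac:(lra) cg ltac:(lra) gC.
have gx y : `|x - y| <= d' -> `|g y - g x| <= e / 2.
  by move=> xy; rewrite distrC; apply: gd; apply: le_lt_trans xy d'd.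
move=> /(_ gx) K.
have : `|0 - kern n d' / lint 0 1 (kern n)| <= e / (2 * (2 * C + 1)) by near: n; exact: H.
rewrite sub0r normrN ger0_norm ?divr_ge0 ?kern_ge0 ?(ltW Z0)// => K'.
rewrite distrC -[g x](mulfK (lt0r_neq0 Z0)) -mulrBl normrM normfV (gtr0_norm Z0).
rewrite ler_pdivrMr//; apply: le_trans K _.
rewrite (_ : e * lint 0 1 (kern n) = e / 2 * lint 0 1 (kern n) + e / 2 * lint 0 1 (kern n)); last first.
  by rewrite -mulrDl -splitr.
rewrite lerD2l.
move: K'; rewrite ler_pdivrMr// => K'.
apply: le_trans (ler_wpM2l _ K') _; first by rewrite mulr_ge0.
rewrite mulrA ler_wpM2r ?(ltW Z0)// mulrCA ler_wpM2l ?(ltW e0)//.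
rewrite invfM mulrCA -[leRHS]mulr1 ler_wpM2l// ler_pdivrMr ?mul1r ?ltr_wpDl ?mulr_ge0//.
by rewrite lerDl.
Unshelve. all: by end_near. Qed.

Lemma tpoly_dense_cont g lo hi e : continuous g -> (forall y, lo <= g y <= hi) -> 0 < e ->
  exists s, (forall x, lo <= tpoly s x <= hi) /\
    lint 0 1 (fun x => (g x - tpoly s x) ^+ 2) <= e.
Proof.
move=> cg glh e0.
have bg : bm (@T01 R) g by exact: (@bm_cont _ 0 1).
pose P n x := lint 0 1 (fun y => g y * kern n (x - y)) / lint 0 1 (kern n).
have Ps n : exists s, forall x, tpoly s x = P n x by exact: kern_conv_tpoly.
have Plh n x : lo <= P n x <= hi by exact: kern_conv_between.
have bP n : bm (@T01 R) (P n).
  by have [s Hs] := Ps n; apply: (bm_ext _ (bm_tpoly s)) => x _.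
have gC y : `|g y| <= `|lo| + `|hi|.
  have /andP[h1 h2] := glh y; rewrite ler_norml.
  by have := ler_norm hi; have := ler_norm (- lo); rewrite normrN;
     have := normr_ge0 lo; have := normr_ge0 hi; move=> *; apply/andP; split; lra.
have : lint 0 1 (fun x => (g x - P n x) ^+ 2) @[n --> \oo] --> lint 0 1 (fun=> (0:R)).
  apply: (@lint_cvg _ _ _ _ _ ((hi - lo) ^+ 2)).
  - by move=> n; apply: bmX; apply: bmB.
  - exact: bm_cst.
  - move=> n x _; rewrite normrX lerXn2r ?nnegrE//.
      by have /andP[] := glh x; lra.
    by rewrite ler_norml; have /andP[? ?] := glh x; have /andP[? ?] := Plh n x; apply/andP; split; lra.
  - exists ([set 0] `|` [set 1]); split.
    + by apply: measurableU; exact: measurable_set1.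
    + by rewrite measureU0//; exact: lebesgue_measure_set1.
    + move=> x /= nx; apply: contrapT => /not_orP[x0 x1]; apply: nx.
      rewrite in_itv/= => /andP[x0' x1'].
      rewrite [X in _ --> X](_ : _ = (g x - g x) ^+ 2); last by rewrite subrr expr0n.
      apply: (@cvg_comp _ _ _ (fun n => g x - P n x) (fun z => z ^+ 2)); last exact: exprn_continuous.
      apply: cvgB; first exact: cvg_cst.
      apply: kern_conv_cvg gC _ => //.
      by rewrite !lt_neqAle x0' x1' !andbT; apply/andP; split; apply/eqP => // /esym.
rewrite lint0 => /cvgrPdist_le /(_ e e0) [n _ /(_ n (leqnn n))].
rewrite sub0r normrN => H; have [s Hs] := Ps n.
exists s; split; first by move=> x; rewrite Hs.
apply: le_trans H; apply: le_trans (ler_norm _); apply: le_lint.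
- by apply: bmX; apply: bmB => //; exact: bm_tpoly.
- by apply: bmX; apply: bmB.
- by move=> x _; rewrite Hs.
Qed.

(** Approximation in $L^1$ by continuous functions becomes approximation in $L^2$ after clipping to
    [[lo, hi]]: clipping to $c$ does not increase the distance to [f], and $(f-c)^2\le(hi-lo)|f-c|$.
    The tolerances [e / (4 * (D + 1))] and [e / 4] each cost at most $e/2$ in
    $(f-p)^2\le2(f-c)^2+2(c-p)^2$. *)
Lemma tpoly_dense f lo hi e : bm (@T01 R) f -> lo <= hi ->
  (forall x, 0 <= x <= 1 -> lo <= f x <= hi) -> 0 < e ->
  exists s, (forall x, lo <= tpoly s x <= hi) /\
    lint 0 1 (fun x => (f x - tpoly s x) ^+ 2) <= e.
Proof.
move=> bf lohi flh e0.
have [g_ [cg ig gcvg]] := @approximation_continuous_integrable R (@T01 R) f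
  (measurable_itv _) (leb_itv_fin 0 1) (bm_lint bf).
pose cl (z : R) := Num.max lo (Num.min z hi).
have cll z : lo <= cl z <= hi by rewrite /cl le_max lexx/= ge_max lohi ge_min lexx orbT.
have clc : continuous cl.
  move=> z; apply: (@continuous_max _ _ (fun=> lo) (fun z => Num.min z hi)); first exact: cvg_cst.
  by apply: (@continuous_min _ _ id (fun=> hi)); [exact: cvg_id|exact: cvg_cst].
have cgn n : continuous (cl \o g_ n).
  by move=> x; apply: continuous_comp; [exact: cg|exact: clc].
have clf x z : 0 <= x <= 1 -> `|f x - cl z| <= `|f x - z|.
  move=> /flh /andP[h1 h2]; rewrite /cl.
  by case: (leP z hi) => zh; case: (leP lo _) => lz; rewrite ler_norml;
    case: (ger0P (f x - z)) => ?; apply/andP; split; lra.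
have bg n : bm (@T01 R) (g_ n) by exact: (@bm_cont _ 0 1).
have bcg n : bm (@T01 R) (cl \o g_ n) by exact: (@bm_cont _ 0 1).
have {}gcvg : lint 0 1 (fun x => `|f x - g_ n x|) @[n --> \oo] --> (0 : R).
  apply: cvg_trans (fine_cvg gcvg); apply: near_eq_cvg; near=> n.
  by [].
pose D := hi - lo.
have D0 : 0 <= D by rewrite subr_ge0.
have e1 : 0 < e / (4 * (D + 1)) by rewrite divr_gt0// mulr_gt0// ltr_wpDl.
move/cvgrPdist_le : gcvg => /(_ _ e1) [n _ /(_ n (leqnn n))].
rewrite sub0r normrN => H.
have e4 : 0 < e / 4 by rewrite divr_gt0.
have [s [slh Hs]] := tpoly_dense_cont (cgn n) (fun y => cll _) e4.
exists s; split => //.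
have bs := bm_tpoly s.
apply: (@le_trans _ _ (lint 0 1 (fun x => 2 * D * `|f x - g_ n x| +
   2 * ((cl \o g_ n) x - tpoly s x) ^+ 2))).
  apply: le_lint.
  - by apply: bmX; exact: bmB.
  - apply: bmD; first by apply: bmZ; apply: bm_norm; exact: bmB.
    by apply: bmZ; apply: bmX; exact: bmB.
  move=> x x01 /=; set c := cl (g_ n x); set p := tpoly s x.
  have h1 : (f x - c) ^+ 2 <= D * `|f x - g_ n x|.
    rewrite -real_normK ?num_real// expr2 ler_pM ?clf//.
    have /andP[? ?] := flh x x01; have /andP[? ?] := cll (g_ n x).
    by rewrite ler_norml /D /c; apply/andP; split; lra.
  have : 0 <= (f x - c - (c - p)) ^+ 2 by exact: sqr_ge0.
  nra.
rewrite lintD; last 2 first.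
- by apply: bmZ; apply: bm_norm; exact: bmB.
- by apply: bmZ; apply: bmX; exact: bmB.
rewrite !lintZ; [|by apply: bmX; exact: bmB|by apply: bm_norm; exact: bmB].
have H' : lint 0 1 (fun x => `|f x - g_ n x|) <= e / (4 * (D + 1)).
  exact: le_trans (ler_norm _) H.
have : 2 * D * lint 0 1 (fun x => `|f x - g_ n x|) <= 2 * D * (e / (4 * (D + 1))).
  by rewrite ler_wpM2l// mulr_ge0.
have : 2 * D * (e / (4 * (D + 1))) <= e / 2.
  rewrite mulrA ler_pdivrMr; last by rewrite mulr_gt0// ltr_wpDl.
  nra.
by move: Hs; lra.
Unshelve. all: by end_near. Qed.

End TrigDensity.

(** * Parseval's identity *)

Section Parseval.
Context {R : realType}.
Implicit Types (x y phi e : R) (f g h : R -> R) (k N : nat).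

Definition fcos f k := lint 0 1 (fun x => f x * wave k%:Z 0 x).
Definition fsin f k := lint 0 1 (fun x => f x * wave k%:Z (- (pi / 2)) x).
(** Reciprocal of the mean square of a wave of frequency [k]; at frequency zero the cosine is $1$
    and the sine vanishes. *)
Definition wt k : R := if k == 0%N then 1 else 2.

Definition fbil N f g :=
  \sum_(k < N) wt k * (fcos f k * fcos g k + fsin f k * fsin g k).

Definition fproj N f x :=
  \sum_(k < N) wt k * (fcos f k * wave k%:Z 0 x + fsin f k * wave k%:Z (- (pi / 2)) x).

Lemma wt_ge0 k : 0 <= wt k. Proof. by rewrite /wt; case: ifP. Qed.

Lemma bmMw f k phi : bm (@T01 R) f -> bm (@T01 R) (fun x => f x * wave k%:Z phi x).
Proof. by move=> bf; apply: bmM => //; exact: bm_wave. Qed.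

Lemma bm_fproj N f : bm (@T01 R) (fproj N f).
Proof.
by apply: bm_sum => k; apply: bmZ; apply: bmD; apply: bmZ; exact: bm_wave.
Qed.

Lemma lint_mul_fproj N f g : bm (@T01 R) g ->
  lint 0 1 (fun x => g x * fproj N f x) = fbil N f g.
Proof.
move=> bg; have b k phi := bmMw k phi bg.
under eq_lint do rewrite /fproj mulr_sumr.
have E k x : g x * (wt k * (fcos f k * wave k%:Z 0 x + fsin f k * wave k%:Z (- (pi / 2)) x))
  = wt k * fcos f k * (g x * wave k%:Z 0 x) + wt k * fsin f k * (g x * wave k%:Z (- (pi / 2)) x).
  by ring.
rewrite lint_sum; last first.
  by move=> k; apply: (bm_ext (fun x _ => esym (E k x))); apply: bmD; apply: bmZ.
apply: eq_bigr => k _; under eq_lint do rewrite E.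
rewrite lintD; [|exact: bmZ|exact: bmZ].
by rewrite !lintZ// /fcos /fsin; ring.
Qed.

Lemma freqD_eq0 k l : (k%:Z + l%:Z == 0) = (k == 0%N) && (l == 0%N).
Proof. by rewrite -addn_eq0. Qed.

Lemma freqB_eq0 k l : (k%:Z - l%:Z == 0) = (k == l).
Proof. by rewrite subr_eq0. Qed.

Lemma lint_cos_cos k l : lint 0 1 (fun x => @wave R k%:Z 0 x * wave l%:Z 0 x) =
  if k == l then (wt k)^-1 else 0.
Proof.
rewrite lint_waveM addr0 subr0 cos0 freqD_eq0 freqB_eq0 /wt.
case: (k =P l) => [<-|kl]; first by rewrite andbb; case: ifP => _; field.
rewrite ifF ?addr0 ?mulr0//; apply/negP => /andP[/eqP k0 /eqP l0].
by apply: kl; rewrite k0 l0.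
Qed.

Lemma lint_sin_sin k l :
  lint 0 1 (fun x => @wave R k%:Z (- (pi / 2)) x * wave l%:Z (- (pi / 2)) x) =
  if (k == l) && (k != 0%N) then 2^-1 else 0.
Proof.
rewrite lint_waveM subrr cos0 freqD_eq0 freqB_eq0.
have -> : - (pi / 2) + - (pi / 2) = - pi :> R by field.
rewrite cosN cospi.
case: (k =P l) => [<-|kl]; first by rewrite andbb/=; case: ifP => _ /=; field.
rewrite ifF ?addr0 ?mulr0//; apply/negP => /andP[/eqP k0 /eqP l0].
by apply: kl; rewrite k0 l0.
Qed.

Lemma lint_cos_sin k l :
  lint 0 1 (fun x => @wave R k%:Z 0 x * wave l%:Z (- (pi / 2)) x) = 0.
Proof.
rewrite lint_waveM add0r sub0r opprK cosN cos_pihalf.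
by do 2 case: ifP => _; rewrite addr0 mulr0.
Qed.

Lemma fcos_fproj N f k : (k < N)%N -> fcos (fproj N f) k = fcos f k.
Proof.
move=> kN; rewrite {1}/fcos; under eq_lint do rewrite mulrC.
rewrite lint_mul_fproj; last exact: bm_wave.
rewrite /fbil (bigD1 (Ordinal kN))//= big1 ?addr0.
  rewrite /fcos /fsin lint_cos_cos lint_cos_sin eqxx mulr0 addr0 mulrCA mulfV ?mulr1//.
  by rewrite /wt; case: ifP => _; rewrite ?oner_eq0// pnatr_eq0.
move=> i ik; rewrite /fcos /fsin lint_cos_cos lint_cos_sin ifF ?mulr0 ?addr0 ?mulr0//.
by rewrite eq_sym; apply: contraNF ik => /eqP ik; apply/eqP/val_inj.
Qed.

Lemma fsin0 f : fsin f 0 = 0.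
Proof.
rewrite /fsin -[RHS](lint0 0 1); apply: eq_lint => x _.
by rewrite /wave mul0r add0r cosN cos_pihalf mulr0.
Qed.

Lemma fsin_fproj N f k : (k < N)%N -> fsin (fproj N f) k = fsin f k.
Proof.
case: k => [_|k kN]; first by rewrite !fsin0.
rewrite {1}/fsin; under eq_lint do rewrite mulrC.
rewrite lint_mul_fproj; last exact: bm_wave.
have cs l : fcos (@wave R k.+1%:Z (- (pi / 2))) l = 0.
  by rewrite /fcos; under eq_lint do rewrite mulrC; rewrite lint_cos_sin.
rewrite /fbil (bigD1 (Ordinal kN))//= big1 ?addr0.
  rewrite cs /fsin lint_sin_sin eqxx/= mulr0 add0r /wt/=; by field.
move=> i ik; rewrite cs /fsin lint_sin_sin ifF ?mulr0 ?addr0 ?mulr0//.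
by apply/negbTE/nandP; left; rewrite eq_sym; apply: contraNN ik => /eqP ik; apply/eqP/val_inj.
Qed.

Lemma fbil_fproj N f : fbil N f (fproj N f) = fbil N f f.
Proof. by apply: eq_bigr => k _; rewrite fcos_fproj// fsin_fproj. Qed.

Lemma fproj_error N f : bm (@T01 R) f ->
  lint 0 1 (fun x => (f x - fproj N f x) ^+ 2) = lint 0 1 (fun x => f x ^+ 2) - fbil N f f.
Proof.
move=> bf; have bp := bm_fproj N f.
have E x : (f x - fproj N f x) ^+ 2 = f x ^+ 2 - (2 * (f x * fproj N f x) - fproj N f x * fproj N f x).
  by ring.
under eq_lint do rewrite E.
have b1 := bmX 2 bf; have b2 := bmM bf bp; have b3 := bmM bp bp.
have b4 := bmZ 2 b2; have b5 := bmB b4 b3.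
rewrite lintB// lintB// lintZ// !lint_mul_fproj// fbil_fproj; ring.
Qed.

Lemma bessel N f : bm (@T01 R) f -> fbil N f f <= lint 0 1 (fun x => f x ^+ 2).
Proof.
by move=> bf; rewrite -subr_ge0 -fproj_error//; apply: lint_ge0 => x _; exact: sqr_ge0.
Qed.

(** Both sides see their function only through its coefficients of index below [N], and the
    projection preserves these. Negative frequencies are folded by parity, whence the sign in front
    of the sine. *)
Lemma lint_tpoly_orth N f s : bm (@T01 R) f -> all (fun q => (`|q.1.2| < N)%N) s ->
  lint 0 1 (fun x => f x * tpoly s x) = lint 0 1 (fun x => fproj N f x * tpoly s x).
Proof.
move=> bf sN.
have E (q : R * int * R) x : q.1.1 * wave q.1.2 q.2 x =
   (q.1.1 * cos q.2) * wave `|q.1.2|%N 0 x -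
   (q.1.1 * (Num.sg q.1.2%:~R * sin q.2)) * wave `|q.1.2|%N (- (pi / 2)) x.
  rewrite /wave addr0 cosD cosBpihalf.
  case: q => [[a [n|n]] phi] /=.
    case: n => [|n]; first by rewrite !mul0r sin0 cos0 sgr0; ring.
    by rewrite gtr0_sg ?ltr0n//; ring.
  rewrite NegzE mulrNz mulNr cosN sinN sgrN gtr0_sg ?ltr0n//; ring.
have K g : bm (@T01 R) g -> lint 0 1 (fun x => g x * tpoly s x) =
   \sum_(q <- s) (q.1.1 * cos q.2 * fcos g `|q.1.2|%N -
   (q.1.1 * (Num.sg q.1.2%:~R * sin q.2)) * fsin g `|q.1.2|%N).
  move=> bg; under eq_lint do rewrite /tpoly mulr_sumr.
  have E' q x : g x * (q.1.1 * wave q.1.2 q.2 x) =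
     (q.1.1 * cos q.2) * (g x * wave `|q.1.2|%N 0 x) -
     (q.1.1 * (Num.sg q.1.2%:~R * sin q.2)) * (g x * wave `|q.1.2|%N (- (pi / 2)) x).
    by rewrite E; ring.
  have b k phi := bmMw k phi bg.
  rewrite lint_sum; last first.
    by move=> q; apply: (bm_ext (fun x _ => esym (E' q x))); apply: bmB; apply: bmZ.
  apply: eq_bigr => q _; under eq_lint do rewrite E'.
  by rewrite lintB ?lintZ//; exact: bmZ.
rewrite !K//; last exact: bm_fproj.
rewrite !big_seq; apply: eq_bigr => q qs.
by rewrite fcos_fproj ?fsin_fproj//; exact: (allP sN).
Qed.

(** Pythagoras: the error of the projection is orthogonal to the projection and to every
    trigonometric polynomial of frequencies below [N]. *)
Lemma fproj_best N f s : bm (@T01 R) f -> all (fun q => (`|q.1.2| < N)%N) s ->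
  lint 0 1 (fun x => f x ^+ 2) - fbil N f f <= lint 0 1 (fun x => (f x - tpoly s x) ^+ 2).
Proof.
move=> bf sN; rewrite -fproj_error//.
have bp := bm_fproj N f; have bs := bm_tpoly s.
have E x : (f x - tpoly s x) ^+ 2 = (f x - fproj N f x) ^+ 2 +
   ((fproj N f x - tpoly s x) ^+ 2 +
    2 * ((f x * fproj N f x - fproj N f x * fproj N f x) - (f x * tpoly s x - fproj N f x * tpoly s x))).
  by ring.
under [leRHS]eq_lint do rewrite E.
have b1 := bmX 2 (bmB bf bp); have b2 := bmX 2 (bmB bp bs).
have b3 := bmM bf bp; have b4 := bmM bp bp; have b5 := bmM bf bs; have b6 := bmM bp bs.
have b7 := bmB (bmB b3 b4) (bmB b5 b6).
rewrite lintD//; last by apply: bmD => //; exact: bmZ.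
rewrite lintD//; last exact: bmZ.
rewrite lintZ// lintB//; [|exact: bmB|exact: bmB].
rewrite !lintB// !lint_mul_fproj// fbil_fproj (lint_tpoly_orth bf sN) !subrr mulr0 addr0.
by rewrite lerDl; apply: lint_ge0 => x _; exact: sqr_ge0.
Qed.

(** By density some polynomial is close to [f]; as soon as [N] exceeds its frequencies, the
    projection is at least as close. *)
Lemma parseval f : bm (@T01 R) f ->
  fbil N f f @[N --> \oo] --> lint 0 1 (fun x => f x ^+ 2).
Proof.
move=> bf; apply/cvgrPdist_le => /= e e0.
have [mf [C fC]] := bf.
have {}fC x : 0 <= x <= 1 -> `|f x| <= C by move=> x01; apply: fC; rewrite /T01/= in_itv.
have C0 : 0 <= C by apply: le_trans (fC 0 _); rewrite // lexx ler01.
have flh x : 0 <= x <= 1 -> - C <= f x <= C by rewrite -ler_norml; exact: fC.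
have [s [_ Hs]] := @tpoly_dense R f (- C) C e bf ltac:(lra) flh e0.
have [N0 HN0] : exists N0, all (fun q => (`|q.1.2| < N0)%N) s.
  elim: s {Hs} => [|q s [N0 IH]]; first by exists 0%N.
  exists (maxn N0 `|q.1.2|.+1); rewrite /= leq_max leqnn orbT/=.
  by apply: sub_all IH => p h; rewrite leq_max h.
exists N0 => // N /= N0N.
rewrite ger0_norm ?subr_ge0 ?bessel//; apply: le_trans Hs.
by apply: fproj_best => //; apply: sub_all HN0 => q h; apply: leq_trans h N0N.
Qed.

Lemma fcosD f g k : bm (@T01 R) f -> bm (@T01 R) g ->
  fcos (fun x => f x + g x) k = fcos f k + fcos g k.
Proof.
move=> bf bg; rewrite /fcos -lintD; [|exact: bmMw|exact: bmMw].
by apply: eq_lint => x _; rewrite mulrDl.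
Qed.

Lemma fsinD f g k : bm (@T01 R) f -> bm (@T01 R) g ->
  fsin (fun x => f x + g x) k = fsin f k + fsin g k.
Proof.
move=> bf bg; rewrite /fsin -lintD; [|exact: bmMw|exact: bmMw].
by apply: eq_lint => x _; rewrite mulrDl.
Qed.

Lemma parseval_bil f g : bm (@T01 R) f -> bm (@T01 R) g ->
  fbil N f g @[N --> \oo] --> lint 0 1 (fun x => f x * g x).
Proof.
move=> bf bg; have bfg := bmD bf bg.
have -> : (fun N => fbil N f g) = (fun N => 2^-1 *
   (fbil N (fun x => f x + g x) (fun x => f x + g x) - fbil N f f - fbil N g g)).
  apply/funext => N; rewrite /fbil -!sumrB mulr_sumr; apply: eq_bigr => k _.
  by rewrite fcosD// fsinD//; field.
have -> : lint 0 1 (fun x => f x * g x) = 2^-1 * (lint 0 1 (fun x => (f x + g x) ^+ 2) -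
   lint 0 1 (fun x => f x ^+ 2) - lint 0 1 (fun x => g x ^+ 2)).
  have b1 := bmX 2 bfg; have b2 := bmX 2 bf; have b3 := bmX 2 bg.
  have b4 := bmB b1 b2; have b5 := bmB b4 b3.
  rewrite -!lintB// -lintZ//; apply: eq_lint => x _; by field.
apply: cvgM; first exact: cvg_cst.
by apply: cvgB; [apply: cvgB|]; exact: parseval.
Qed.

End Parseval.

(** * Smooth test functions *)

Section SmoothFunctions.
Context {R : realType}.
Implicit Types (x y s t a b c : R).

Definition tower (D : nat -> R -> R) := forall n x, is_derive x (1 : R) (D n) (D n.+1 x).

Lemma is_derive_quadratic (f : R -> R) x C :
  (forall h, `|f (x + h) - f x| <= C * h ^+ 2) -> is_derive x (1 : R) f 0.
Proof.
move=> fC.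
have K : (fun h : R => h^-1 *: (f (h *: (1 : R) + x) - f x)) @ 0^' --> (0 : R).
  apply/cvgrPdist_le => /= e e0; near=> h.
  have h0 : h != 0 by near: h; exact: nbhs_dnbhs_neq.
  rewrite sub0r normrN /GRing.scale/= mulr1 (addrC h) normrM normfV.
  rewrite mulrC ler_pdivrMr ?normr_gt0//; apply: le_trans (fC h) _.
  rewrite -real_normK ?num_real// expr2 mulrA ler_wpM2r//.
  have : `|h| <= e / (`|C| + 1).
    near: h; apply: dnbhs0_le; rewrite divr_gt0// ltr_wpDl//.
  rewrite ler_pdivlMr ?ltr_wpDl// => He; apply: le_trans He.
  rewrite mulrC ler_wpM2l//; apply: le_trans (ler_norm _) _.
  by rewrite lerDl.
apply: DeriveDef; first by apply/cvg_ex; exists 0.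
by apply/cvg_lim.
Unshelve. all: by end_near. Qed.

(** The standard flat function $e^{-1/s}$ with a polynomial factor in $1/s$, which makes the family
    stable under differentiation. *)
Definition flat (p : {poly R}) s : R := if 0 < s then p.[s^-1] * expR (- s^-1) else 0.

(** From $\frac{d}{ds}\,p(1/s)e^{-1/s}=s^{-2}(p-p')(1/s)\,e^{-1/s}$. *)
Definition flat_step (p : {poly R}) : {poly R} := 'X^2 * (p - p^`()).

(** The power [j] is part of the induction because the Horner step $pX+c$ moves a factor $y$ into
    it; the constant term is bounded through $e^y\ge1+y^n/n!$. *)
Lemma poly_expRN_bounded (p : {poly R}) j :
  exists C, forall y, 0 <= y -> `|p.[y]| * y ^+ j * expR (- y) <= C.
Proof.
elim/poly_ind: p j => [|p c IH] j.
  by exists 0 => y _; rewrite horner0 normr0 !mul0r.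
have [C HC] := IH j.+1.
exists (C + `|c| * j.+1`!%:R + `|c|) => y y0.
rewrite !hornerE.
have e0 := expR_gt0 (- y).
apply: (@le_trans _ _ (`|p.[y]| * y ^+ j.+1 * expR (- y) + `|c| * (y ^+ j * expR (- y)))).
  have -> : `|p.[y]| * y ^+ j.+1 * expR (- y) + `|c| * (y ^+ j * expR (- y)) =
    (`|p.[y]| * y + `|c|) * y ^+ j * expR (- y) by rewrite exprS; ring.
  rewrite ler_wpM2r ?(ltW e0)// ler_wpM2r ?exprn_ge0//.
  by apply: le_trans (ler_normD _ _) _; rewrite normrM (ger0_norm y0).
rewrite -[leRHS]addrA lerD ?HC//.
rewrite -[X in _ <= _ + X]mulr1 -mulrDr ler_wpM2l//.
have E : expR y * expR (- y) = 1 by rewrite -expRD subrr expR0.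
have := expR_ge1Dx y; have ey := expR_gt0 y; move=> h1.
case: j {IH HC C} => [|j].
  rewrite expr0 mul1r; apply: (@le_trans _ _ 1); last by rewrite lerDr.
  by rewrite -(ler_pM2l ey) E mulr1; lra.
have /(ler_wpM2r (ltW e0)) := expR_ge1Dxn j y0; rewrite E => h2.
have f0 : (0 : R) < j.+1`!%:R by rewrite ltr0n fact_gt0.
have : y ^+ j.+1 / j.+1`!%:R * expR (- y) <= 1.
  by apply: le_trans h2; rewrite mulrDl mul1r lerDr ltW.
rewrite mulrAC ler_pdivrMr// mul1r => /le_trans; apply.
have : (j.+1`!%:R : R) <= j.+2`!%:R by rewrite ler_nat factS leq_pmull.
lra.
Qed.

(** A quadratic bound suffices to make the derivative at the origin vanish; since it holds for every
    [p], all higher derivatives follow along [flat_step]. *)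
Lemma flat_quadratic p : exists C, forall s, `|flat p s| <= C * s ^+ 2.
Proof.
have [C HC] := poly_expRN_bounded p 2.
have C0 : 0 <= C by apply: le_trans (HC 0 (lexx _)); rewrite expr0n/= mulr0 mul0r.
exists C => s; rewrite /flat; case: ifP => s0; last by rewrite normr0 mulr_ge0// sqr_ge0.
rewrite normrM (ger0_norm (expR_ge0 _)).
have -> : `|p.[s^-1]| * expR (- s^-1) = `|p.[s^-1]| * s^-1 ^+ 2 * expR (- s^-1) * s ^+ 2.
  by field; rewrite gt_eqF.
by rewrite ler_wpM2r ?exprn_ge0 ?HC ?invr_ge0// ltW.
Qed.

Lemma flat_derive p s : is_derive s (1 : R) (flat p) (flat (flat_step p) s).
Proof.
have [s0|s0|s0] := ltgtP 0 s.
- have -> : flat (flat_step p) s = (flat_step p).[s^-1] * expR (- s^-1) by rewrite /flat s0.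
  apply: (@near_eq_is_derive _ _ _ (fun s => p.[s^-1] * expR (- s^-1))).
    by near=> y; rewrite /flat ifT//; near: y; exact: lt_nbhsr.
  have s1 : s != 0 by rewrite gt_eqF.
  have DV : is_derive s (1 : R) (fun y : R => y^-1) (- s ^- 2).
    apply: DeriveDef; first exact: derivableV.
    by rewrite deriveV// derive_id /GRing.scale/= mulr1.
  have D1 := @is_derive1_comp R (horner p) (fun y => y^-1) s _ _ (is_derive_poly p s^-1) DV.
  have DN : is_derive s (1 : R) (fun y : R => - y^-1) (s ^- 2).
    by apply: is_derive_eq; rewrite opprK.
  have D2 := @is_derive1_comp R expR (fun y => - y^-1) s _ _ (is_derive_expR (- s^-1)) DN.
  apply: (is_derive_eq (is_deriveM D1 D2)).
  rewrite /flat_step hornerM hornerXn hornerD hornerN -exprVn /GRing.scale/=; ring.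
- have -> : flat (flat_step p) s = 0 by rewrite /flat ltNge (ltW s0).
  apply: (@near_eq_is_derive _ _ _ (cst (0 : R))).
  by near=> y; rewrite /flat ifF//; apply/negbTE; rewrite -leNgt ltW//; near: y; exact: lt_nbhsl.
- rewrite -s0 /flat ltxx; have [C HC] := flat_quadratic p.
  apply: (@is_derive_quadratic _ _ C) => h.
  by rewrite add0r ltxx subr0; exact: HC.
Unshelve. all: by end_near. Qed.

Lemma tower_flat p : tower (fun n => flat (iter n flat_step p)).
Proof. by move=> n x; exact: flat_derive. Qed.

Lemma tower_cos : tower (fun n x => cos (x + n%:R * (pi / 2))).
Proof.
move=> n x /=; have -> : x + n.+1%:R * (pi / 2) = (x + n%:R * (pi / 2)) + pi / 2 by rewrite -(natr1 n); ring.
rewrite cosDpihalf.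
by apply: is_derive_eq; rewrite /GRing.scale/=; ring.
Qed.

Lemma tower_expR c : tower (fun n x => c ^+ n * expR (c * x)).
Proof.
by move=> n x; apply: is_derive_eq; rewrite /GRing.scale/= exprS; ring.
Qed.

Lemma tower_cst c : tower (fun n x => if n == 0%N then c else 0).
Proof. by case=> [|n] x /=; exact: is_derive_cst. Qed.

Lemma tower_cont D n : tower D -> continuous (D n).
Proof.
move=> tD x; apply/differentiable_continuous/derivable1_diffP.
by case: (tD n x).
Qed.

(** An inductively generated class stable under both partial derivatives, so that the quantification
    over words of derivatives in [smooth2] becomes an induction on the word. Atoms are functions of
    one variable, given with all their derivatives, at an affine form in $(t,x)$: travelling waves,
    exponentials in time and cutoffs are all of this shape. *)
Inductive smooth : (R -> R -> R) -> Prop :=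
| smooth_atom D a b c : tower D -> smooth (fun t x => D 0%N (a * t + b * x + c))
| smoothD f g : smooth f -> smooth g -> smooth (fun t x => f t x + g t x)
| smoothM f g : smooth f -> smooth g -> smooth (fun t x => f t x * g t x).

Lemma smooth_cst c : smooth (fun _ _ => c).
Proof. exact: (smooth_atom 0 0 0 (tower_cst c)). Qed.

Lemma smooth_sum (I : Type) (r : seq I) (F : I -> R -> R -> R) :
  (forall i, smooth (F i)) -> smooth (fun t x => \sum_(i <- r) F i t x).
Proof.
move=> sF; elim: r => [|i r IH].
  rewrite (_ : (fun _ _ => _) = fun _ _ => 0); first exact: smooth_cst.
  by apply/funext => t; apply/funext => x; rewrite big_nil.
rewrite (_ : (fun _ _ => _) = fun t x => F i t x + \sum_(i <- r) F i t x).
  exact: smoothD.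
by apply/funext => t; apply/funext => x; rewrite big_cons.
Qed.

Lemma smooth_pdt f : smooth f -> exists2 f', smooth f' &
  forall t x, is_derive t (1 : R) (fun s => f s x) (f' t x).
Proof.
elim=> [D a b c tD|{}f g _ [f' sf' df] _ [g' sg' dg]|{}f g sf [f' sf' df] sg [g' sg' dg]].
- exists (fun t x => a * D 1%N (a * t + b * x + c)).
    apply: smoothM; first exact: smooth_cst.
    by apply: (@smooth_atom (fun n => D n.+1)) => n x; exact: tD.
  move=> t x.
  have dl : is_derive t (1 : R) (fun s => a * s + b * x + c) a.
    by apply: is_derive_eq; rewrite /GRing.scale/= !addr0 mulr1.
  by apply: (is_derive_eq (@is_derive1_comp R (D 0%N) _ t _ _ (tD 0%N _) dl)); rewrite mulrC.
- by exists (fun t x => f' t x + g' t x); [exact: smoothD|move=> t x; exact: is_deriveD].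
- exists (fun t x => f t x * g' t x + g t x * f' t x); first by apply: smoothD; exact: smoothM.
  by move=> t x; exact: is_deriveM.
Qed.

Lemma smooth_pdx f : smooth f -> exists2 f', smooth f' &
  forall t x, is_derive x (1 : R) (fun y => f t y) (f' t x).
Proof.
elim=> [D a b c tD|{}f g _ [f' sf' df] _ [g' sg' dg]|{}f g sf [f' sf' df] sg [g' sg' dg]].
- exists (fun t x => b * D 1%N (a * t + b * x + c)).
    apply: smoothM; first exact: smooth_cst.
    by apply: (@smooth_atom (fun n => D n.+1)) => n x; exact: tD.
  move=> t x.
  have dl : is_derive x (1 : R) (fun y => a * t + b * y + c) b.
    by apply: is_derive_eq; rewrite /GRing.scale/=; ring.
  by apply: (is_derive_eq (@is_derive1_comp R (D 0%N) _ x _ _ (tD 0%N _) dl)); rewrite mulrC.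
- by exists (fun t x => f' t x + g' t x); [exact: smoothD|move=> t x; exact: is_deriveD].
- exists (fun t x => f t x * g' t x + g t x * f' t x); first by apply: smoothD; exact: smoothM.
  by move=> t x; exact: is_deriveM.
Qed.

Lemma smooth_continuous f : smooth f -> continuous (fun p : R * R => f p.1 p.2).
Proof.
elim=> [D a b c tD|{}f g _ cf _ cg|{}f g _ cf _ cg] p.
- apply: (@continuous_comp _ _ _ (fun p : R * R => a * p.1 + b * p.2 + c) (D 0%N)); last exact: tower_cont.
  apply: cvgD; last exact: cvg_cst.
  apply: cvgD; apply: cvgM; try exact: cvg_cst; [exact: cvg_fst|exact: cvg_snd].
- by apply: cvgD; [exact: cf|exact: cg].
- by apply: cvgM; [exact: cf|exact: cg].
Qed.

Lemma derive1_of (f : R -> R) x d : is_derive x (1 : R) f d -> derive1 f x = d.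
Proof. by move=> h; rewrite derive1E derive_val. Qed.

Lemma smooth_smooth2 f : smooth f -> smooth2 f.
Proof.
move=> sf w; suff: smooth (iterpd w f).
  move=> si; split; last exact: smooth_continuous.
  have [f1 _ d1] := smooth_pdt si; have [f2 _ d2] := smooth_pdx si.
  by move=> t x; split; [case: (d1 t x)|case: (d2 t x)].
elim: w => //= b w IH; case: b.
  have [f1 s1 d1] := smooth_pdt IH; rewrite (_ : pdt _ = f1)//.
  by apply/funext => t; apply/funext => x; exact: derive1_of.
have [f1 s1 d1] := smooth_pdx IH; rewrite (_ : pdx _ = f1)//.
by apply/funext => t; apply/funext => x; exact: derive1_of.
Qed.

Lemma smooth_pdtS f : smooth f -> smooth (pdt f) /\
  forall t x, is_derive t (1 : R) (fun s => f s x) (pdt f t x).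
Proof.
move=> /smooth_pdt[f1 s1 d1]; have -> : pdt f = f1 by
  apply/funext => t; apply/funext => x; exact: derive1_of.
by [].
Qed.

Lemma smooth_pdxS f : smooth f -> smooth (pdx f) /\
  forall t x, is_derive x (1 : R) (fun y => f t y) (pdx f t x).
Proof.
move=> /smooth_pdx[f1 s1 d1]; have -> : pdx f = f1 by
  apply/funext => t; apply/funext => x; exact: derive1_of.
by [].
Qed.

End SmoothFunctions.

(** * From the weak formulation to integral equations *)

Section WeakToIntegral.
Context {R : realType}.
Implicit Types (x y s t T d e : R).
Notation leb := (@lebesgue_measure R).

Lemma bm_strip_smooth T f : 0 <= T -> smooth f -> bm (strip T) (fun p : R * R => f p.1 p.2).
Proof.
move=> T0; elim=> [D a b c tD|{}f g _ bf _ bg|{}f g _ bf _ bg]; last 2 first.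
- exact: bmD.
- exact: bmM.
have cD := @tower_cont _ D 0%N tD.
split.
  apply: (@measurableT_comp _ _ _ _ _ _ (D 0%N)); first exact: continuous_measurable_fun.
  apply: measurable_funD; last exact: measurable_cst.
  apply: measurable_funD; apply: measurable_funM; try exact: measurable_cst;
    apply: measurable_funTS; [exact: measurable_fst|exact: measurable_snd].
pose L := `|a| * T + `|b| + `|c|.
have [_ [C DC]] := @bm_cont _ (- L) L _ cD.
exists C => -[t x] [/=]; rewrite !in_itv/= => /andP[t0 tT] /andP[x0 x1].
apply: DC; rewrite /= in_itv/= -ler_norml.
apply: le_trans (ler_normD _ _) _; rewrite lerD2r.
apply: le_trans (ler_normD _ _) _; rewrite !normrM (ger0_norm t0) (ger0_norm x0).
by rewrite lerD// ?ler_wpM2l// ler_piMr.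
Qed.

Lemma smooth_lip T f : 0 <= T -> smooth f -> exists2 C, 0 <= C & forall s t x,
  0 <= s <= T -> 0 <= t <= T -> 0 <= x <= 1 -> `|f t x - f s x| <= C * `|t - s|.
Proof.
move=> T0 sf; have [sf' df] := smooth_pdtS sf.
have [_ [C fC]] := bm_strip_smooth T0 sf'.
have S0 : strip T (0, 0) by split; rewrite /= in_itv/= lexx ?T0 ?ler01.
have C0 : 0 <= C := le_trans (normr_ge0 _) (fC (0, 0) S0).
exists C => // s t x sT tT x01.
wlog st : s t sT tT / s <= t.
  by move=> H; have [/H|/ltW/H] := leP s t; [apply|rewrite distrC (distrC t); apply].
have /andP[s0 _] := sT; have /andP[_ tT'] := tT.
have [|d dst ->] := @MVT_segment _ (fun s => f s x) (fun s => pdt f s x) s t st (fun z _ => df z x).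
  apply: continuous_subspaceT => z.
  by apply/differentiable_continuous/derivable1_diffP; case: (df z x).
rewrite normrM ler_wpM2r//; apply: (fC (d, x)); split; rewrite /= in_itv//=.
by move: dst; rewrite in_itv/= => /andP[sd dt]; rewrite (le_trans s0)//= (le_trans dt).
Qed.

(** The argument $(n+1)(t_0-t)$ is spelled out as an affine form in [t], to match the atoms of
    [smooth]. *)
Definition cutoff (t0 : R) n t := flat 1 (- n.+1%:R * t + n.+1%:R * t0).
Definition cutoff' (t0 : R) n t :=
  - n.+1%:R * flat (flat_step 1) (- n.+1%:R * t + n.+1%:R * t0).

Lemma cutoff_arg t0 n t : - n.+1%:R * t + n.+1%:R * t0 = n.+1%:R * (t0 - t) :> R.
Proof. by ring. Qed.

Lemma cutoff_derive t0 n t : is_derive t (1 : R) (cutoff t0 n) (cutoff' t0 n t).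
Proof.
have dl : is_derive t (1 : R) (fun s => - n.+1%:R * s + n.+1%:R * t0) (- n.+1%:R).
  by apply: is_derive_eq; rewrite /GRing.scale/=; ring.
apply: (is_derive_eq (@is_derive1_comp R (flat 1) _ t _ _ (flat_derive 1 _) dl)).
by rewrite /cutoff' mulrC.
Qed.

Lemma continuous_cutoff' t0 n : continuous (cutoff' t0 n).
Proof.
move=> t; apply: cvgM; first exact: cvg_cst.
apply: (@continuous_comp _ _ _ (fun t => - n.+1%:R * t + n.+1%:R * t0) (flat (flat_step 1))).
  apply: cvgD; last exact: cvg_cst.
  by apply: cvgM; [exact: cvg_cst|exact: cvg_id].
exact: (@tower_cont _ _ 0%N (tower_flat (flat_step 1))).
Qed.

Lemma continuous_cutoff t0 n : continuous (cutoff t0 n).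
Proof.
move=> t; apply/differentiable_continuous/derivable1_diffP.
by case: (cutoff_derive t0 n t).
Qed.

Lemma cutoff'_le0 t0 n t : cutoff' t0 n t <= 0.
Proof.
rewrite /cutoff' mulNr oppr_le0 mulr_ge0// /flat; case: ifP => // _.
rewrite mulr_ge0 ?expR_ge0//.
rewrite /flat_step hornerM hornerXn hornerD hornerN derivC horner0 subr0 hornerC mulr1.
exact: sqr_ge0.
Qed.

Lemma cutoff_vanish t0 n t : t0 <= t -> cutoff t0 n t = 0 /\ cutoff' t0 n t = 0.
Proof.
move=> t0t; have F : (0 < n.+1%:R * (t0 - t)) = false.
  by apply/negbTE; rewrite -leNgt mulr_ge0_le0// subr_le0.
by rewrite /cutoff /cutoff' !cutoff_arg /flat F mulr0.
Qed.

Lemma cutoff_01 t0 n t : 0 <= cutoff t0 n t <= 1.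
Proof.
rewrite /cutoff /flat; case: ifP => [h|_]; last by rewrite lexx ler01.
by rewrite hornerC mul1r expR_ge0/= expR_le1 oppr_le0 invr_ge0 ltW.
Qed.

Lemma cutoff_cvg t0 t : t < t0 -> cutoff t0 n t @[n --> \oo] --> (1 : R).
Proof.
move=> tt0; have d0 : 0 < t0 - t by rewrite subr_gt0.
have -> : (fun n => cutoff t0 n t) = (fun n => expR (- ((t0 - t)^-1 * harmonic n))).
  apply/funext => n; rewrite /cutoff cutoff_arg /flat ifT ?mulr_gt0// hornerC mul1r.
  by rewrite invfM mulrC.
rewrite -[X in _ --> X]expR0 -oppr0.
apply: (@cvg_comp _ _ _ _ expR); last exact: continuous_expR.
apply: cvgN; rewrite -[X in _ --> X](mulr0 (t0 - t)^-1).
by apply: cvgM; [exact: cvg_cst|exact: cvg_harmonic].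
Qed.

Lemma lint_cutoff' t0 n a b : 0 <= a -> a <= b ->
  lint a b (cutoff' t0 n) = cutoff t0 n b - cutoff t0 n a.
Proof.
move=> a0 ab; have [_ H] := prim_derive b (@continuous_cutoff' t0 n) (cutoff_derive t0 n).
by rewrite H.
Qed.

(* The measures [- cutoff' t0 n dt] on [0, t0] converge weakly to the Dirac mass at [t0]. *)
Lemma cutoff'_cvg (t0 : R) (A : R -> R) : 0 < t0 -> bm `[0, t0] A ->
  (forall e, 0 < e -> exists2 d : R, 0 < d & forall t, 0 <= t <= t0 -> t0 - d <= t -> `|A t - A t0| <= e) ->
  lint 0 t0 (fun t => cutoff' t0 n t * A t) @[n --> \oo] --> - A t0.
Proof.
move=> t00 bA cA; have [mA [C AC]] := bA.
have {}AC t : 0 <= t <= t0 -> `|A t| <= C by move=> h; apply: AC; rewrite /= in_itv.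
have C0 : 0 <= C by apply: le_trans (AC 0 _) => //; rewrite lexx ltW.
have bc n : bm `[0, t0] (cutoff' t0 n) by exact: bm_cont (@continuous_cutoff' t0 n).
apply/cvgrPdist_le => /= e e0.
have e3 : 0 < e / 3 by rewrite divr_gt0.
have [d d0 Hd] := cA (e / 3) e3.
pose s := Num.max 0 (t0 - d).
have [s0 st0] : 0 <= s /\ s < t0.
  by rewrite /s le_max lexx gt_max t00/=; split => //; rewrite ltrBlDr ltrDl.
(* [K1] controls the mass that the measure puts on $[0,s]$, [K2] the defect of its total mass from
   $1$. Both vanish because the cutoffs tend to $1$ at every time before [t0]. *)
have K1 : (C + C) * `|cutoff t0 n 0 - cutoff t0 n s| @[n --> \oo] --> (0 : R).
  rewrite -[X in _ --> X](mulr0 (C + C)); apply: cvgM; first exact: cvg_cst.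
  rewrite -[X in _ --> X](@normr0 _ R); apply: cvg_norm.
  by rewrite -[X in _ --> X](subrr (1 : R)); apply: cvgB; exact: cutoff_cvg.
have K2 : C * `|1 - cutoff t0 n 0| @[n --> \oo] --> (0 : R).
  rewrite -[X in _ --> X](mulr0 C); apply: cvgM; first exact: cvg_cst.
  rewrite -[X in _ --> X](@normr0 _ R); apply: cvg_norm.
  rewrite -[X in _ --> X](subrr (1 : R)); apply: cvgB; first exact: cvg_cst.
  exact: cutoff_cvg.
move/cvgrPdist_le : K1 => /(_ _ e3) K1; move/cvgrPdist_le : K2 => /(_ _ e3) K2.
near=> n.
have k1 : `|0 - (C + C) * `|cutoff t0 n 0 - cutoff t0 n s| | <= e / 3 by near: n; exact: K1.
have k2 : `|0 - C * `|1 - cutoff t0 n 0| | <= e / 3 by near: n; exact: K2.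
rewrite sub0r normrN (ger0_norm (_ : 0 <= _)) ?mulr_ge0 ?addr_ge0// in k1.
rewrite sub0r normrN (ger0_norm (_ : 0 <= _)) ?mulr_ge0// in k2.
have E : lint 0 t0 (fun t => cutoff' t0 n t * A t) =
   lint 0 t0 (fun t => cutoff' t0 n t * (A t - A t0)) - cutoff t0 n 0 * A t0.
  have -> : - (cutoff t0 n 0 * A t0) = A t0 * lint 0 t0 (cutoff' t0 n).
    rewrite lint_cutoff' ?(ltW t00)//; have [-> _] := cutoff_vanish n (lexx t0); ring.
  rewrite -lintZ// -lintD; [|by apply: bmM => //; apply: bmB => //; exact: bm_cst|exact: bmZ].
  by apply: eq_lint => t _; ring.
have bd : bm `[0, t0] (fun t => cutoff' t0 n t * (A t - A t0)).
  by apply: bmM => //; apply: bmB => //; exact: bm_cst.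
rewrite E (@lint_split _ 0 s t0)//; last exact: ltW.
have n1 : `|lint 0 s (fun t => cutoff' t0 n t * (A t - A t0))| <=
    (C + C) * `|cutoff t0 n 0 - cutoff t0 n s|.
  have bs := bm_itvS (lexx 0) (ltW st0) bd; have bcs := bm_itvS (lexx 0) (ltW st0) (bc n).
  apply: le_trans (lint_norm bs) _.
  apply: le_trans (ler_wpM2l _ (ler_norm _)); last by rewrite addr_ge0.
  have -> : (C + C) * (cutoff t0 n 0 - cutoff t0 n s) = lint 0 s (fun t => (C + C) * - cutoff' t0 n t).
    by rewrite lintZ ?lintN ?lint_cutoff'//; [ring|exact: bmN].
  apply: le_lint; [exact: bm_norm|by apply: bmZ; exact: bmN|].
  move=> t /andP[t_0 ts]; rewrite normrM (ler0_norm (cutoff'_le0 _ _ _)) mulrC.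
  rewrite ler_wpM2r ?oppr_ge0 ?cutoff'_le0//.
  apply: le_trans (ler_normB _ _) _; rewrite lerD ?AC ?lexx ?(ltW t00)//.
  by rewrite t_0 (le_trans ts)// ltW.
have n2 : `|lint s t0 (fun t => cutoff' t0 n t * (A t - A t0))| <= e / 3.
  have bs := bm_itvS s0 (lexx t0) bd; have bcs := bm_itvS s0 (lexx t0) (bc n).
  apply: le_trans (lint_norm bs) _.
  apply: (@le_trans _ _ (lint s t0 (fun t => (e / 3) * - cutoff' t0 n t))).
    apply: le_lint; [exact: bm_norm|by apply: bmZ; exact: bmN|].
    move=> t /andP[st tt]; rewrite normrM (ler0_norm (cutoff'_le0 _ _ _)) mulrC.
    rewrite ler_wpM2r ?oppr_ge0 ?cutoff'_le0//; apply: Hd.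
      by rewrite (le_trans s0).
    by apply: le_trans st; rewrite /s le_max lexx orbT.
  rewrite lintZ ?lintN ?lint_cutoff'// ?(ltW st0)//; last exact: bmN.
  have [-> _] := cutoff_vanish n (lexx t0); rewrite sub0r opprK.
  rewrite -[leRHS]mulr1 ler_wpM2l ?(ltW e3)//.
  by case/andP: (cutoff_01 t0 n s).
set X1 := lint 0 s _ in n1 *; set X2 := lint s t0 _ in n2 *.
have n3 : `|(1 - cutoff t0 n 0) * A t0| <= e / 3.
  by rewrite normrM mulrC (le_trans _ k2)// ler_wpM2r// AC// lexx ltW.
have -> : - A t0 - (X1 + X2 - cutoff t0 n 0 * A t0) = - ((1 - cutoff t0 n 0) * A t0) - X1 - X2 by ring.
apply: le_trans (ler_normB _ _) _.
have := ler_normB (- ((1 - cutoff t0 n 0) * A t0)) X1; rewrite normrN.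
move: n1 n2 n3 k1; lra.
Unshelve. all: by end_near. Qed.

End WeakToIntegral.

(** * Time-integrated form of the weak formulation *)

Section WeakPrim.
Context {R : realType}.
Implicit Types (x y s t T d e : R).
Notation leb := (@lebesgue_measure R).

Lemma Rintegral_support (t0 : R) (f g : R -> R) : 0 <= t0 ->
  (forall t, 0 <= t <= t0 -> f t = g t) -> (forall t, t0 < t -> f t = 0) ->
  \int[leb]_(t in @Tpos R) f t = lint 0 t0 g.
Proof.
move=> t00 fg f0; rewrite /lint Rintegral_mkcond [RHS]Rintegral_mkcond.
apply: eq_Rintegral => t _; rewrite !patchE.
case: ifPn => [/set_mem ht|/negP ht]; case: ifPn => [/set_mem h|/negP h] //.
- by apply: fg; move: h; rewrite /= in_itv.
- apply: f0; rewrite ltNge; apply/negP => tt; apply: h; apply/mem_set.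
  by rewrite /= in_itv/= tt andbT.
- exfalso; apply: ht; apply/mem_set; move: h; rewrite /= in_itv/= => /andP[h _].
  exact: h.
Qed.

(** The weak formulation is tested with [chi] times a cutoff at [t0]; in the limit the derivative of
    the cutoff evaluates the pairing at [t0]. Continuity in time with values in $L^1$ makes this
    work at every [t0] instead of almost every one. [U] and [G] stand for bounded, jointly
    measurable representatives of the solution and of its source. *)
Lemma weak_prim (c Tf : R) (u F : R -> R -> R) (u0 U0 : R -> R) (U G : R * R -> R) :
  0 < Tf -> bm (strip Tf) U -> bm (strip Tf) G -> bm (@T01 R) U0 ->
  (forall t, 0 <= t <= Tf -> {ae leb, forall x, T01 x -> u t x = U (t, x)}) ->
  (forall t, 0 <= t <= Tf -> {ae leb, forall x, T01 x -> F t x = G (t, x)}) ->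
  {ae leb, forall x, T01 x -> u0 x = U0 x} ->
  (forall t0, Tpos t0 -> (fun t => intT (fun x => `|u t x - u t0 x| `^ 1))
       @ within (@Tpos R) (nbhs t0) --> (0 : R)) ->
  (forall psi, test_fun psi ->
    \int[leb]_(t in @Tpos R) intT (fun x => u t x * (pdt psi t x + c * pdx psi t x))
    + intT (fun x => psi 0 x * u0 x)
    + \int[leb]_(t in @Tpos R) intT (fun x => F t x * psi t x) = 0) ->
  forall chi, smooth chi -> (forall t x, chi t (x + 1) = chi t x) ->
  prim Tf (fun t => lint 0 1 (fun x => U (t, x) * chi t x))
    (fun t => lint 0 1 (fun x => U (t, x) * (pdt chi t x + c * pdx chi t x) + G (t, x) * chi t x))
  /\ lint 0 1 (fun x => U (0, x) * chi 0 x) = lint 0 1 (fun x => U0 x * chi 0 x).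
Proof.
move=> Tf0 bU bG bU0 uU FG uU0 ucont weak chi schi pchi.
have [st dt] := smooth_pdtS schi; have [sx dx] := smooth_pdxS schi.
have bchi := bm_strip_smooth (ltW Tf0) schi.
have bt := bm_strip_smooth (ltW Tf0) st; have bx := bm_strip_smooth (ltW Tf0) sx.
pose A t := lint 0 1 (fun x => U (t, x) * chi t x).
pose P t := lint 0 1 (fun x => U (t, x) * (pdt chi t x + c * pdx chi t x)).
pose Q t := lint 0 1 (fun x => G (t, x) * chi t x).
pose A0 := lint 0 1 (fun x => U0 x * chi 0 x).
have bA : bm `[0, Tf] A by apply: (@bm_strip_lint _ Tf (fun p => U p * chi p.1 p.2)); exact: bmM.
have bPs : bm (strip Tf) (fun p => U p * (pdt chi p.1 p.2 + c * pdx chi p.1 p.2)).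
  by apply: bmM => //; apply: bmD => //; exact: bmZ.
have bP : bm `[0, Tf] P by exact: (@bm_strip_lint _ Tf _ bPs).
have bQs : bm (strip Tf) (fun p => G p * chi p.1 p.2) by exact: bmM.
have bQ : bm `[0, Tf] Q by exact: (@bm_strip_lint _ Tf _ bQs).
have slice (H : R * R -> R) t : bm (strip Tf) H -> 0 <= t <= Tf -> bm (@T01 R) (fun x => H (t, x)).
  by move=> bH tT; exact: (bm_strip_slice tT bH).
(* Continuity of the pairing: the change of [U] is small in $L^1$, that of [chi] is controlled by a
   Lipschitz constant, and [D] dominates both coefficients. *)
have cA t0 : 0 <= t0 <= Tf -> forall e, 0 < e -> exists2 d : R, 0 < d &
    forall t, 0 <= t <= Tf -> `|t - t0| < d -> `|A t - A t0| <= e.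
  move=> t0T e e0; have [C C0 lip] := smooth_lip (ltW Tf0) schi.
  have [_ [C1 HC1]] := bchi; have [_ [C2 HC2]] := bU.
  have t0p : Tpos t0 by case/andP: t0T.
  pose D := `|C1| + `|C2| * C + 1.
  have D0 : 0 < D by rewrite ltr_wpDl// addr_ge0// mulr_ge0.
  have eD : 0 < e / (2 * D) by rewrite divr_gt0// mulr_gt0.
  have /cvgrPdist_le/(_ _ eD) := ucont t0 t0p.
  rewrite near_withinE => -[d /= d0 Hd].
  exists (Num.min d (e / (2 * D))); first by rewrite lt_min d0.
  move=> t tT; rewrite lt_min => /andP[td tD].
  have tp : Tpos t by case/andP: tT.
  have := Hd t; rewrite /= distrC => /(_ td tp); rewrite sub0r normrN => H1.
  have E1 : intT (fun x => `|u t x - u t0 x| `^ 1) = lint 0 1 (fun x => `|U (t, x) - U (t0, x)|).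
    rewrite intTE; apply: lint_ae_eq.
    apply: ae_mono (ae_and (uU t tT) (uU t0 t0T)) => x [h1 h2] x01.
    by rewrite h1// h2// powRr1.
  rewrite E1 in H1; have {}H1 := le_trans (ler_norm _) H1.
  have bUt := slice _ _ bU tT; have bUt0 := slice _ _ bU t0T.
  have bct := slice _ _ bchi tT; have bct0 := slice _ _ bchi t0T.
  rewrite /= in bct bct0.
  rewrite /A -lintB; [|exact: bmM|exact: bmM].
  apply: le_trans (lint_norm _) _; first by apply: bmB; exact: bmM.
  apply: (@le_trans _ _ (lint 0 1 (fun x => `|C1| * `|U (t, x) - U (t0, x)| + `|C2| * C * `|t - t0|))).
    apply: le_lint.
    - by apply: bm_norm; apply: bmB; exact: bmM.
    - by apply: bmD; [apply: bmZ; apply: bm_norm; exact: bmB|exact: bm_cst].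
    move=> x x01.
    have -> : U (t, x) * chi t x - U (t0, x) * chi t0 x =
      chi t x * (U (t, x) - U (t0, x)) + U (t0, x) * (chi t x - chi t0 x) by ring.
    apply: le_trans (ler_normD _ _) _; rewrite !normrM lerD//.
      rewrite ler_wpM2r//; apply: le_trans (ler_norm _).
      by apply: (HC1 (t, x)); split; rewrite /= in_itv.
    rewrite -mulrA ler_pM//; last exact: lip.
    apply: le_trans (ler_norm _).
    by apply: HC2; split; rewrite /= in_itv.
  rewrite lintD; [|by apply: bmZ; apply: bm_norm; exact: bmB|exact: bm_cst].
  rewrite lintZ; last by apply: bm_norm; exact: bmB.
  rewrite lint_cst// subr0 mulr1.
  apply: (@le_trans _ _ (D * (e / (2 * D)) + D * (e / (2 * D)))).
    by rewrite lerD// ler_pM// ?mulr_ge0 ?lint_ge0//; rewrite ?(ltW tD) /D; have := normr_ge0 C1; have := normr_ge0 C2; move: C0; nra.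
  have -> : D * (e / (2 * D)) + D * (e / (2 * D)) = e by field; rewrite gt_eqF.
  exact: lexx.
have bnd (f : R -> R) : bm `[0, Tf] f -> forall t, t <= Tf -> bm `[0, t] f.
  by move=> bf t tT; exact: (bm_itvS (lexx 0) tT bf).
have key t0 : 0 < t0 -> t0 <= Tf -> A t0 = A0 + lint 0 t0 (fun t => P t + Q t).
  move=> t00 t0T.
  have bA0 := bnd _ bA _ t0T; have bP0 := bnd _ bP _ t0T; have bQ0 := bnd _ bQ _ t0T.
  have bc n : bm `[0, t0] (cutoff t0 n) by exact: bm_cont (@continuous_cutoff _ t0 n).
  have bc' n : bm `[0, t0] (cutoff' t0 n) by exact: bm_cont (@continuous_cutoff' _ t0 n).
  pose psi n t x := chi t x * cutoff t0 n t.
  have psiE n : psi n = fun t x => chi t x * flat 1 (- n.+1%:R * t + 0 * x + n.+1%:R * t0).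
    by apply/funext => t; apply/funext => x; rewrite mul0r addr0.
  have spsi n : smooth (psi n).
    rewrite psiE; apply: smoothM => //.
    exact: (smooth_atom (- n.+1%:R) 0 (n.+1%:R * t0) (tower_flat 1)).
  have tpsi n : test_fun (psi n).
    split; first exact: smooth_smooth2.
    split; first by move=> t x; rewrite /psi pchi.
    by exists t0 => t x t0t; rewrite /psi (cutoff_vanish n t0t).1 mulr0.
  have dtpsi n t x : pdt (psi n) t x = pdt chi t x * cutoff t0 n t + chi t x * cutoff' t0 n t.
    apply: derive1_of; apply: (is_derive_eq (is_deriveM (dt t x) (cutoff_derive t0 n t))).
    by rewrite /GRing.scale/=; ring.
  have dxpsi n t x : pdx (psi n) t x = pdx chi t x * cutoff t0 n t.
    apply: derive1_of; apply: (is_derive_eq (is_deriveM (dx t x) (is_derive_cst (cutoff t0 n t) x (1 : R)))).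
    by rewrite /GRing.scale/=; ring.
  have W n : lint 0 t0 (fun t => cutoff t0 n t * (P t + Q t)) +
      cutoff t0 n 0 * A0 + lint 0 t0 (fun t => cutoff' t0 n t * A t) = 0.
    have R0 : intT (fun x => psi n 0 x * u0 x) = cutoff t0 n 0 * A0.
      rewrite intTE /A0 -lintZ; last first.
        apply: bmM => //; apply: (slice _ 0 bchi); by rewrite lexx ltW.
      by apply: lint_ae_eq; apply: ae_mono uU0 => x h x01; rewrite h// /psi; ring.
    have b1 := bmM (bc n) bP0; have b2 := bmM (bc n) bQ0; have b3 := bmM (bc' n) bA0.
    have R1 : \int[leb]_(t in @Tpos R) intT (fun x => u t x * (pdt (psi n) t x + c * pdx (psi n) t x)) =
        lint 0 t0 (fun t => cutoff t0 n t * P t) + lint 0 t0 (fun t => cutoff' t0 n t * A t).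
      rewrite -(lintD b1 b3); apply: (Rintegral_support (ltW t00)) => t.
        move=> /andP[t0' tt0].
        have tT : 0 <= t <= Tf by rewrite t0' (le_trans tt0).
        have b4 : bm (@T01 R) (fun x => U (t, x) * (pdt chi t x + c * pdx chi t x)) := slice _ _ bPs tT.
        have b5 : bm (@T01 R) (fun x => U (t, x) * chi t x).
          by apply: bmM; [exact: slice _ _ bU tT|exact: slice _ _ bchi tT].
        rewrite /P /A -(lintZ _ b4) -(lintZ _ b5) -(lintD (bmZ _ b4) (bmZ _ b5)).
        rewrite intTE; apply: lint_ae_eq; apply: ae_mono (uU t tT) => x h x01.
        by rewrite h// dtpsi dxpsi; ring.
      move=> tt; rewrite intTE -[RHS](lint0 0 1); apply: eq_lint => x _.
      have [h1 h2] := cutoff_vanish n (ltW tt).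
      by rewrite dtpsi dxpsi h1 h2 !mulr0 !addr0 mulr0.
    have R2 : \int[leb]_(t in @Tpos R) intT (fun x => F t x * psi n t x) =
        lint 0 t0 (fun t => cutoff t0 n t * Q t).
      apply: (Rintegral_support (ltW t00)) => t.
        move=> /andP[t0' tt0].
        have tT : 0 <= t <= Tf by rewrite t0' (le_trans tt0).
        have b4 : bm (@T01 R) (fun x => G (t, x) * chi t x) := slice _ _ bQs tT.
        rewrite /Q -(lintZ _ b4) intTE; apply: lint_ae_eq; apply: ae_mono (FG t tT) => x h x01.
        by rewrite h// /psi; ring.
      move=> tt; rewrite intTE -[RHS](lint0 0 1); apply: eq_lint => x _.
      by rewrite /psi (cutoff_vanish n (ltW tt)).1 !mulr0.
    have R3 : lint 0 t0 (fun t => cutoff t0 n t * (P t + Q t)) =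
        lint 0 t0 (fun t => cutoff t0 n t * P t) + lint 0 t0 (fun t => cutoff t0 n t * Q t).
      by rewrite -(lintD b1 b2); apply: eq_lint => t _; rewrite mulrDr.
    have := weak _ (tpsi n); rewrite R0 R1 R2 R3.
    move: (lint 0 t0 (fun t => cutoff t0 n t * P t)) (lint 0 t0 (fun t => cutoff t0 n t * Q t))
      (lint 0 t0 (fun t => cutoff' t0 n t * A t)) (cutoff t0 n 0 * A0) => x y z w <-.
    by ring.
  have bPQ := bmD bP0 bQ0; have [_ [C HC]] := bPQ.
  have L1 : lint 0 t0 (fun t => cutoff t0 n t * (P t + Q t)) @[n --> \oo] -->
      lint 0 t0 (fun t => P t + Q t).
    apply: (@lint_cvg _ _ _ _ _ C) => //.
    - by move=> n; apply: bmM.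
    - move=> n t tt; rewrite normrM.
      have /andP[h1 h2] := cutoff_01 t0 n t.
      rewrite (ger0_norm h1) (le_trans (ler_piMl _ h2))//.
      by apply: HC; rewrite /= in_itv.
    - exists [set t0]; split; [exact: measurable_set1|exact: lebesgue_measure_set1|].
      move=> t /= nt; apply: contrapT => tt0; apply: nt; rewrite in_itv/= => /andP[_ tt].
      rewrite -[X in _ --> X]mul1r; apply: cvgM; last exact: cvg_cst.
      by apply: cutoff_cvg; rewrite lt_neqAle tt andbT; apply/eqP.
  have L2 : cutoff t0 n 0 * A0 @[n --> \oo] --> A0.
    rewrite -[X in _ --> X]mul1r; apply: cvgM; last exact: cvg_cst.
    exact: cutoff_cvg.
  have L3 : lint 0 t0 (fun t => cutoff' t0 n t * A t) @[n --> \oo] --> - A t0.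
    apply: cutoff'_cvg => // e e0.
    have [|d d0 Hd] := cA t0 _ e e0; first by rewrite ltW.
    exists (d / 2); first by rewrite divr_gt0.
    move=> t /andP[t1 t2] t3; apply: Hd; first by rewrite t1 (le_trans t2).
    by rewrite distrC ger0_norm ?subr_ge0//; lra.
  have L := cvgD (cvgD L1 L2) L3.
  have L0 : (fun _ : nat => (0 : R)) @ \oo --> lint 0 t0 (fun t => P t + Q t) + A0 + - A t0.
    rewrite (_ : (fun _ : nat => _) = (fun n => lint 0 t0 (fun t => cutoff t0 n t * (P t + Q t)) +
      cutoff t0 n 0 * A0 + lint 0 t0 (fun t => cutoff' t0 n t * A t))); first exact: L.
    by apply/funext => n; rewrite W.
  have : lint 0 t0 (fun t => P t + Q t) + A0 - A t0 = 0.
    exact: (@cvg_unique _ (@Rhausdorff R) _ _ _ _ L0 (@cvg_cst _ (0 : R) nat \oo _)).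
  by move=> /eqP; rewrite subr_eq0 => /eqP <-; rewrite addrC.
(* The identity [key] is available for positive times only. As [t] decreases to $0$, its right side
   tends to [A0], the integrand being bounded, while its left side tends to [A 0] by continuity. *)
have cont0 : A 0 = A0.
  apply/eqP; rewrite -subr_eq0 -normr_le0; apply/ler_addgt0Pr => e e0; rewrite add0r.
  have bPQ := bmD bP bQ; have [_ [C HC]] := bPQ.
  have e2 : 0 < e / 2 by rewrite divr_gt0.
  have [|d d0 Hd] := cA 0 _ _ e2; first by rewrite lexx ltW.
  pose D := `|C| + 1; have D0 : 0 < D by rewrite ltr_wpDl.
  pose t := Num.min (Num.min (d / 2) Tf) (e / (2 * D)).
  have t0 : 0 < t.
    have h1 : 0 < d / 2 by rewrite divr_gt0.
    have h2 : 0 < e / (2 * D) by rewrite divr_gt0 ?mulr_gt0.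
    by rewrite /t !lt_min h1 h2 Tf0.
  have [td tT te] : [/\ t <= d / 2, t <= Tf & t <= e / (2 * D)].
    by rewrite /t !ge_min !lexx ?orbT.
  have := Hd t; rewrite (ltW t0) tT subr0 gtr0_norm// => /(_ isT).
  have td' : t < d by lra.
  move=> /(_ td'); rewrite (key t t0 tT) => H1.
  have H2 : `|lint 0 t (fun t => P t + Q t)| <= e / 2.
    apply: (@le_trans _ _ (D * (t - 0))).
      apply: lint_norm_le; [exact: ltW|exact: (bm_itvS (lexx 0) tT bPQ)|].
      move=> s /andP[s0 st']; apply: (@le_trans _ _ `|C|); last by rewrite lerDl.
      apply: le_trans (ler_norm C); apply: HC; rewrite /= in_itv/= s0 (le_trans st')//.
    rewrite subr0 (le_trans (ler_wpM2l (ltW D0) te))//.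
    have -> : D * (e / (2 * D)) = e / 2 by field; rewrite gt_eqF.
    exact: lexx.
  move: H1 H2; rewrite !ler_norml => /andP[? ?] /andP[? ?]; apply/andP; split; lra.
have PQ t : 0 <= t <= Tf -> P t + Q t =
   lint 0 1 (fun x => U (t, x) * (pdt chi t x + c * pdx chi t x) + G (t, x) * chi t x).
  move=> tT; rewrite /P /Q lintD//; first exact: (slice _ _ bPs tT).
  exact: (slice _ _ bQs tT).
split; last exact: cont0.
apply: (@prim_ext _ _ A (fun t => P t + Q t)) => //.
split; first exact: bmD.
have key' t : 0 <= t -> t <= Tf -> A t = A0 + lint 0 t (fun t => P t + Q t).
  rewrite le_eqVlt => /predU1P[<- _|]; last exact: key.
  by rewrite lint_pt addr0.
move=> s t s0 st' tT.
have sT : s <= Tf by exact: le_trans tT.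
have t0 : 0 <= t by exact: le_trans st'.
rewrite key'// (key' s)// (@lint_split _ 0 s t)//; first by ring.
by apply: (bnd _ _ _ tT); exact: bmD.
Qed.

End WeakPrim.

(** * Maximum principle *)

Section MaximumPrinciple.
Context {R : realType}.
Implicit Types (x y s t T d e : R).
Notation leb := (@lebesgue_measure R).

(** On a null set [g] is replaced by [f] plus the positive part of [g - f], which dominates [f]
    everywhere. *)
Lemma le_lint_ae (f g : R -> R) : bm (@T01 R) f -> bm (@T01 R) g ->
  {ae leb, forall x, T01 x -> f x <= g x} -> lint 0 1 f <= lint 0 1 g.
Proof.
move=> bf bg fg.
have bm' : bm (@T01 R) (fun x => f x + Num.max 0 (g x - f x)).
  apply: bmD => //; have [mh [C hC]] := bmB bg bf; split.
    by apply: measurable_maxr => //; exact: measurable_cst.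
  exists C => x /hC; rewrite !ler_norml => /andP[h1 h2].
  case: (leP 0 (g x - f x)) => ?; apply/andP; split; lra.
have -> : lint 0 1 g = lint 0 1 (fun x => f x + Num.max 0 (g x - f x)).
  apply: lint_ae_eq; apply: ae_mono fg => x h x01; have {}h := h x01.
  by rewrite max_r ?subr_ge0// addrC subrK.
by apply: le_lint => // x _; rewrite lerDl le_max lexx.
Qed.

Lemma lint_eq0_ae (f : R -> R) : bm (@T01 R) f -> (forall x, 0 <= x <= 1 -> 0 <= f x) ->
  lint 0 1 f = 0 -> {ae leb, forall x, T01 x -> f x = 0}.
Proof.
move=> bf f0 I0.
have mf : measurable_fun (@T01 R : set (measurableTypeR R)) (EFin \o f).
  by apply/measurable_EFinP; exact: bf.1.
have H : (\int[leb]_(x in `[0%R, 1%R]) (f x)%:E = 0)%E.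
  transitivity (lint 0 1 f)%:E; last by rewrite I0.
  rewrite /lint /Rintegral fineK//; exact: (integrable_fin_num _ (bm_lint bf)).
have /(ae_eq_integral_abs leb (measurable_itv _) mf) : (\int[leb]_(x in `[0%R, 1%R]) `|(EFin \o f) x| = 0)%E.
  rewrite -H; apply: eq_integral => x /set_mem /=; rewrite in_itv/= => x01.
  by rewrite ger0_norm// f0.
by apply: ae_mono => x h x01; have [] := h x01.
Qed.

(** The ideal test function is the positive part $F$ of $f-L$, since $F^2=(f-L)F$. A nonnegative
    polynomial $p$ close to $F$ in $L^2$ replaces it, and the difference $(f-L)(F-p)$ is handled by
    Young's inequality. *)
Lemma tpoly_test_le (f : R -> R) (L : R) : bm (@T01 R) f ->
  (forall p, (forall x, 0 <= tpoly p x) ->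
    lint 0 1 (fun x => f x * tpoly p x) <= L * lint 0 1 (tpoly p)) ->
  {ae leb, forall x, T01 x -> f x <= L}.
Proof.
move=> bf test.
pose F x := Num.max 0 (f x - L).
have bfL : bm (@T01 R) (fun x => f x - L) by apply: bmB => //; exact: bm_cst.
have [mfL [C fLC]] := bfL.
have {}fLC x : 0 <= x <= 1 -> `|f x - L| <= C by move=> h; apply: fLC; rewrite /T01/= in_itv.
have C0 : 0 <= C by apply: le_trans (fLC 0 _); rewrite // lexx ler01.
have FC x : 0 <= x <= 1 -> 0 <= F x <= C.
  move=> /fLC; rewrite ler_norml /F => /andP[h1 h2].
  by case: (leP 0 (f x - L)) => ?; apply/andP; split; lra.
have bF : bm (@T01 R) F.
  split; first by apply: measurable_maxr => //; exact: measurable_cst.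
  exists C => x; rewrite /T01/= in_itv/= => /FC /andP[h1 h2].
  by rewrite ger0_norm.
suff I0 : lint 0 1 (fun x => F x ^+ 2) = 0.
  have := lint_eq0_ae (bmX 2 bF) (fun x _ => sqr_ge0 _) I0.
  apply: ae_mono => x h x01; have /eqP := h x01.
  rewrite sqrf_eq0 /F => /eqP h'.
  by rewrite -subr_le0 -h' le_max lexx orbT.
apply/eqP; rewrite eq_le; apply/andP; split; last by apply: lint_ge0 => x _; exact: sqr_ge0.
apply/ler_addgt0Pr => e e0; rewrite add0r.
(* The Young weight: $d\int(f-L)^2\le dC^2\le e/2$, and the accuracy $de$ requested for [p] makes
   the other term $(2d)^{-1}de=e/2$. *)
pose d := e / (2 * (C ^+ 2 + 1)).
have C21 : 0 < C ^+ 2 + 1 by rewrite ltr_wpDl// sqr_ge0.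
have d0 : 0 < d by rewrite divr_gt0// mulr_gt0.
have de0 : 0 < d * e by rewrite mulr_gt0.
have [p [plh Hp]] := tpoly_dense bF C0 FC de0.
have bp := bm_tpoly p.
have p0 x : 0 <= tpoly p x by case/andP: (plh x).
have := test p p0; rewrite -lintZ// -subr_le0 -lintB; [|exact: bmM|exact: bmZ].
move=> H1.
have bFp := bmB bF bp.
apply: (@le_trans _ _ (lint 0 1 (fun x => (d * (f x - L) ^+ 2 + (2 * d)^-1 * (F x - tpoly p x) ^+ 2)
   + (f x * tpoly p x - L * tpoly p x)))).
  apply: le_lint.
  - exact: bmX.
  - by apply: bmD; [apply: bmD; apply: bmZ; exact: bmX|apply: bmB; [exact: bmM|exact: bmZ]].
  move=> x _.
  have -> : F x ^+ 2 = (f x - L) * F x.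
    rewrite /F; have [h|h] := leP 0 (f x - L); first by rewrite expr2.
    by rewrite expr0n mulr0.
  set a := f x - L; set b := F x - tpoly p x.
  have -> : f x * tpoly p x - L * tpoly p x = a * tpoly p x by rewrite /a mulrBl.
  rewrite -lerBlDr -mulrBr -/b -subr_ge0.
  have -> : d * a ^+ 2 + (2 * d)^-1 * b ^+ 2 - a * b =
     (2 * d)^-1 * ((d * a - b) ^+ 2 + (d * a) ^+ 2) by field; rewrite gt_eqF.
  apply: mulr_ge0; first by rewrite invr_ge0 mulr_ge0// ltW.
  by rewrite addr_ge0 ?sqr_ge0.
rewrite lintD; last 2 first.
- by apply: bmD; apply: bmZ; exact: bmX.
- by apply: bmB; [exact: bmM|exact: bmZ].
rewrite lintD; [|by apply: bmZ; exact: bmX|by apply: bmZ; exact: bmX].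
rewrite !lintZ; [|exact: bmX|exact: bmX].
have I1 : lint 0 1 (fun x => (f x - L) ^+ 2) <= C ^+ 2.
  rewrite -[leRHS]mulr1 -[X in _ * X]subr0 -lint_cst//.
  apply: le_lint; [exact: bmX|exact: bm_cst|] => x x01.
  by rewrite -real_normK ?num_real// lerXn2r ?nnegrE// fLC.
have K1 : d * lint 0 1 (fun x => (f x - L) ^+ 2) <= e / 2.
  apply: le_trans (ler_wpM2l (ltW d0) I1) _.
  rewrite /d mulrAC ler_pdivrMr ?mulr_gt0//.
  by have := sqr_ge0 C; nra.
have K2 : (2 * d)^-1 * lint 0 1 (fun x => (F x - tpoly p x) ^+ 2) <= e / 2.
  have d2 : 0 <= (2 * d)^-1 by rewrite invr_ge0 mulr_ge0// ltW.
  apply: le_trans (ler_wpM2l d2 Hp) _.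
  have -> : (2 * d)^-1 * (d * e) = e / 2 by field; rewrite gt_eqF.
  exact: lexx.
lra.
Qed.

(* Integrated weak form of [U_t + c U_x = kap (W - U)] on [0, Tf], tested against smooth periodic functions. *)
Definition mild (c Tf : R) (U W kap : R * R -> R) (U0 : R -> R) :=
  forall chi, smooth chi -> (forall t x, chi t (x + 1) = chi t x) ->
  prim Tf (fun t => lint 0 1 (fun x => U (t, x) * chi t x))
    (fun t => lint 0 1 (fun x => U (t, x) * (pdt chi t x + c * pdx chi t x) +
       kap (t, x) * (W (t, x) - U (t, x)) * chi t x))
  /\ lint 0 1 (fun x => U (0, x) * chi 0 x) = lint 0 1 (fun x => U0 x * chi 0 x).

Lemma smooth_wave k phi : smooth (fun _ x : R => wave k phi x).
Proof.
have -> : (fun _ x : R => wave k phi x) = fun t x : R =>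
    (fun n y => cos (y + n%:R * (pi / 2))) 0%N (0 * t + (k%:~R * (pi *+ 2)) * x + phi).
  by apply/funext => t; apply/funext => x; rewrite /wave/=; congr cos; ring.
exact: (smooth_atom 0 _ phi tower_cos).
Qed.

Lemma smooth_travelling_tpoly (a h : R) p : smooth (fun t x : R => tpoly p (x + (h - a * t))).
Proof.
apply: smooth_sum => q; apply: smoothM; first exact: smooth_cst.
have -> : (fun t x : R => wave q.1.2 q.2 (x + (h - a * t))) = fun t x : R =>
    (fun n y => cos (y + n%:R * (pi / 2))) 0%N
      ((- (q.1.2%:~R * (pi *+ 2) * a)) * t + (q.1.2%:~R * (pi *+ 2)) * x +
       (q.1.2%:~R * (pi *+ 2) * h + q.2)).
  by apply/funext => t; apply/funext => x; rewrite /wave/=; congr cos; ring.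
exact: (smooth_atom _ _ _ tower_cos).
Qed.

Lemma smooth_expR lam : smooth (fun t _ : R => expR (lam * t)).
Proof.
have -> : (fun t _ : R => expR (lam * t)) = fun t x : R =>
    (fun n y => lam ^+ n * expR (lam * y)) 0%N (1 * t + 0 * x + 0).
  by apply/funext => t; apply/funext => x; rewrite /= mul0r !addr0 !mul1r.
exact: (smooth_atom _ _ _ (tower_expR lam)).
Qed.

Lemma is_derive_tpoly p : exists q : R -> R, forall x, is_derive x (1 : R) (tpoly p) (q x).
Proof.
have sp : smooth (fun _ x : R => tpoly p x).
  by apply: smooth_sum => q; apply: smoothM; [exact: smooth_cst|exact: smooth_wave].
by have [f _ df] := smooth_pdx sp; exists (f 0); exact: df.
Qed.

(* [e^(lam t)] times a nonnegative travelling wave turns the equation into one with the source [(lam - kap) U + kap W], which is monotone in [U] and [W]. *)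
Lemma transport_max (c Tf lam M n : R) (U W kap : R * R -> R) (U0 : R -> R) :
  0 < Tf -> 0 < lam -> 0 <= n ->
  bm (strip Tf) U -> bm (strip Tf) W -> bm (strip Tf) kap -> bm (@T01 R) U0 ->
  mild c Tf U W kap U0 ->
  (forall t x, 0 <= t <= Tf -> 0 <= x <= 1 -> 0 <= kap (t, x) <= lam) ->
  {ae leb, forall x, T01 x -> U0 x <= M} ->
  (forall t, 0 <= t <= Tf -> {ae leb, forall x, T01 x -> U (t, x) <= M + n}) ->
  (forall t, 0 <= t <= Tf -> {ae leb, forall x, T01 x -> W (t, x) <= M + n}) ->
  forall t, 0 <= t <= Tf ->
    {ae leb, forall x, T01 x -> U (t, x) <= M + n * (1 - expR (- lam * Tf))}.
Proof.
move=> Tf0 lam0 n0 bU bW bk bU0 mU kl U0M UM WM tau tauT.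
have /andP[tau0 tauTf] := tauT.
apply: tpoly_test_le; first exact: bm_strip_slice tauT bU.
move=> p p0.
(* The wave is aligned so that at time [tau] it equals [p] up to the exponential factor; it is
   constant along characteristics, so the transport operator sees that factor alone. *)
pose chi t x := expR (lam * t) * tpoly p (x + (c * tau - c * t)).
have schi : smooth chi by apply: smoothM; [exact: smooth_expR|exact: smooth_travelling_tpoly].
have pchi t x : chi t (x + 1) = chi t x by rewrite /chi addrAC tpoly_periodic.
have [[bB AB] A0] := mU chi schi pchi.
have [q dq] := is_derive_tpoly p.
have dtx t x : pdt chi t x + c * pdx chi t x = lam * chi t x.
  have dE : is_derive t (1 : R) (fun t => expR (lam * t)) (lam * expR (lam * t)).
    by apply: is_derive_eq; rewrite /GRing.scale/=; ring.
  have dl : is_derive t (1 : R) (fun t => x + (c * tau - c * t)) (- c).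
    by apply: is_derive_eq; rewrite /GRing.scale/=; ring.
  have dr : is_derive x (1 : R) (fun x => x + (c * tau - c * t)) 1.
    by apply: is_derive_eq; rewrite addr0.
  have -> : pdt chi t x = expR (lam * t) * (q (x + (c * tau - c * t)) * - c) +
      tpoly p (x + (c * tau - c * t)) * (lam * expR (lam * t)).
    apply: derive1_of.
    exact: (is_deriveM dE (@is_derive1_comp R (tpoly p) _ t _ _ (dq _) dl)).
  have -> : pdx chi t x = expR (lam * t) * (q (x + (c * tau - c * t)) * 1).
    exact: derive1_of.
  by rewrite /chi; ring.
pose Z := lint 0 1 (tpoly p).
have Z0 : 0 <= Z by apply: lint_ge0 => x _; exact: p0.
have Zs t : lint 0 1 (fun x => tpoly p (x + (c * tau - c * t))) = Z by exact: lint_tpoly_shift.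
have bsh h : bm (@T01 R) (fun x => tpoly p (x + h)).
  by apply: (bm_ext _ (bm_tpoly (tshift h p))) => x _; rewrite tpoly_shift.
have bchi t : bm (@T01 R) (chi t) by apply: bmZ; exact: bsh.
have chi0 t x : 0 <= chi t x by rewrite mulr_ge0 ?expR_ge0.
have Ichi t : lint 0 1 (chi t) = expR (lam * t) * Z by rewrite lintZ ?Zs//; exact: bsh.
have cexp : continuous (fun r : R => lam * expR (lam * r)).
  move=> z; apply: cvgM; first exact: cvg_cst.
  apply: (@continuous_comp _ _ _ (fun r => lam * r) expR); last exact: continuous_expR.
  by apply: cvgM; [exact: cvg_cst|exact: cvg_id].
have pE : prim Tf (fun r => expR (lam * r)) (fun r => lam * expR (lam * r)).
  apply: prim_derive => // z.
  by apply: is_derive_eq; rewrite /GRing.scale/= mulr1 mulrC.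
have := AB 0 tau (lexx _) tau0 tauTf.
have -> : lint 0 1 (fun x => U (tau, x) * chi tau x) =
   expR (lam * tau) * lint 0 1 (fun x => U (tau, x) * tpoly p x).
  rewrite -lintZ; last by apply: bmM; [exact: bm_strip_slice tauT bU|exact: bm_tpoly].
  by apply: eq_lint => x _; rewrite /chi subrr addr0; ring.
rewrite A0.
have I0 : lint 0 1 (fun x => U0 x * chi 0 x) <= M * Z.
  have -> : M * Z = lint 0 1 (fun x => M * chi 0 x) by rewrite lintZ// Ichi mulr0 expR0 mul1r.
  apply: le_lint_ae; [exact: bmM|exact: bmZ|].
  by apply: ae_mono U0M => x h x01; rewrite ler_wpM2r// h.
have IB : lint 0 tau (fun t => lint 0 1 (fun x => U (t, x) * (pdt chi t x + c * pdx chi t x) +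
       kap (t, x) * (W (t, x) - U (t, x)) * chi t x)) <= (M + n) * Z * (expR (lam * tau) - 1).
  have -> : expR (lam * tau) - 1 = lint 0 tau (fun r => lam * expR (lam * r)).
    by have [_ <-] := pE; rewrite ?mulr0 ?expR0.
  have bE := bm_itvS (lexx 0) tauTf pE.1.
  rewrite -lintZ//; apply: le_lint; [exact: (bm_itvS (lexx 0) tauTf bB)|exact: bmZ|].
  move=> t /andP[t0 tt]; have tT : 0 <= t <= Tf by rewrite t0 (le_trans tt).
  have b1 := bm_strip_slice tT bU; have b2 := bm_strip_slice tT bW; have b3 := bm_strip_slice tT bk.
  have -> : (M + n) * Z * (lam * expR (lam * t)) = lint 0 1 (fun x => lam * (M + n) * chi t x).
    by rewrite lintZ// Ichi; ring.
  apply: le_lint_ae.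
  - apply: bmD; last by apply: bmM => //; apply: bmM => //; exact: bmB.
    by apply: bmM => //; apply: (bm_ext _ (bmZ lam (bchi t))) => x _; rewrite dtx.
  - exact: bmZ.
  apply: ae_mono (ae_and (UM t tT) (WM t tT)) => x [h1 h2] x01.
  have {}h1 := h1 x01; have {}h2 := h2 x01.
  have /andP[k0 k1] : 0 <= kap (t, x) <= lam.
    by apply: kl => //; move: x01; rewrite /T01/= in_itv.
  rewrite dtx.
  have -> : U (t, x) * (lam * chi t x) + kap (t, x) * (W (t, x) - U (t, x)) * chi t x =
    ((lam - kap (t, x)) * U (t, x) + kap (t, x) * W (t, x)) * chi t x by ring.
  rewrite ler_wpM2r//.
  have : (lam - kap (t, x)) * U (t, x) <= (lam - kap (t, x)) * (M + n).
    by rewrite ler_wpM2l// subr_ge0.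
  have : kap (t, x) * W (t, x) <= kap (t, x) * (M + n) by rewrite ler_wpM2l.
  lra.
move=> E; set J := lint 0 1 (fun x => U (tau, x) * tpoly p x) in E *.
have E0 := expR_gt0 (lam * tau).
rewrite -(ler_pM2l E0) -/Z.
(* Divided by $e^{\lambda\tau}$ this bound reads $M+n(1-e^{-\lambda\tau})$ times [Z]; $\tau=T_f$ is
   the worst time and gives a factor common to the whole interval. *)
have : expR (lam * tau) * J <= Z * (M + (M + n) * (expR (lam * tau) - 1)).
  by move: E IB I0; lra.
move=> /le_trans; apply.
have -> : expR (lam * tau) * ((M + n * (1 - expR (- lam * Tf))) * Z) =
   Z * ((M + n) * expR (lam * tau) - n * (expR (lam * tau) * expR (- lam * Tf))) by ring.
rewrite ler_wpM2l// -expRD.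
have : expR (lam * tau + - lam * Tf) <= 1.
  by rewrite expR_le1 mulNr subr_le0 ler_wpM2l// ltW.
by move=> h; have := ler_wpM2l n0 h; lra.
Qed.

End MaximumPrinciple.

(** * Bounded representatives of the solution and the bound by the initial data *)

Section ClippedSolution.
Context {R : realType}.
Implicit Types (x y s t T d e : R).
Notation leb := (@lebesgue_measure R).

Definition clip (b z : R) := Num.max 0 (Num.min z b).

Lemma clip_between b z : 0 <= b -> 0 <= clip b z <= b.
Proof. by move=> b0; rewrite /clip le_max lexx/= ge_max b0 ge_min lexx orbT. Qed.

Lemma clip_id b z : 0 <= z -> z <= b -> clip b z = z.
Proof. by move=> z0 zb; rewrite /clip (min_idPl zb) max_r. Qed.

Lemma measurable_clip (disp : measure_display) (S : measurableType disp) (D : set S) b (f : S -> R) :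
  measurable_fun D f -> measurable_fun D (fun p => clip b (f p)).
Proof.
move=> mf; apply: measurable_maxr; first exact: measurable_cst.
by apply: measurable_minr => //; exact: measurable_cst.
Qed.

Lemma bm_clip b (f : R -> R) : 0 <= b -> measurable_fun (@T01 R) f ->
  bm (@T01 R) (fun x => clip b (f x)).
Proof.
move=> b0 mf; split; first exact: measurable_clip.
by exists b => x _; have /andP[h1 h2] := clip_between (f x) b0; rewrite ger0_norm.
Qed.

(** The bounds $0\le u,v\le b$ hold almost everywhere, with an exceptional set that depends on the
    time. Clipping turns them into bounds at every point, so that [k] is evaluated only where it is
    known to be measurable, nonnegative and at most [K]. *)
Lemma weak_solution_clipped (c K b Tf : R) (k : R -> R -> R -> R) (u0 v0 : R -> R)
    (u v : R -> R -> R) :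
  0 < Tf -> 0 <= b -> interaction_rate k ->
  (forall a a' x, 0 <= a <= b -> 0 <= a' <= b -> T01 x -> k a a' x <= K) ->
  measurable_fun (@T01 R) u0 -> measurable_fun (@T01 R) v0 ->
  {ae leb, forall x, T01 x -> 0 <= u0 x <= b} ->
  {ae leb, forall x, T01 x -> 0 <= v0 x <= b} ->
  weak_solution c k u0 v0 u v ->
  (forall t, 0 <= t <= Tf -> {ae leb, forall x, T01 x -> u t x <= b}) ->
  (forall t, 0 <= t <= Tf -> {ae leb, forall x, T01 x -> v t x <= b}) ->
  exists U V kap : R * R -> R,
  [/\ [/\ bm (strip Tf) U, bm (strip Tf) V & bm (strip Tf) kap],
      (forall p, 0 <= U p <= b) /\ (forall p, 0 <= V p <= b),
      (forall t x, 0 <= t <= Tf -> 0 <= x <= 1 -> kap (t, x) = k (U (t, x)) (V (t, x)) x),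
      forall t, 0 <= t <= Tf -> {ae leb, forall x, T01 x -> u t x = U (t, x)} /\
        {ae leb, forall x, T01 x -> v t x = V (t, x)} &
      mild c Tf U V kap (fun x => clip b (u0 x)) /\
      mild (- c) Tf V U kap (fun x => clip b (v0 x))].
Proof.
move=> Tf0 b0 [k0 mk] kK mu0 mv0 u0b v0b [[mu [_ [u_ge0 [_ ucont]]]] [[mv [_ [v_ge0 [_ vcont]]]] weak]] ub vb.
have S p : strip Tf p -> [/\ 0 <= p.1, p.1 <= Tf & 0 <= p.2 <= 1].
  by case=> /=; rewrite !in_itv/= => /andP[? ?] ?; split.
have mS := measurable_strip Tf.
pose U := (fun p : R * R => clip b (u p.1 p.2)) \_ (strip Tf).
pose V := (fun p : R * R => clip b (v p.1 p.2)) \_ (strip Tf).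
have S1 : strip Tf `<=` [set p : R * R | Tpos p.1 /\ T01 p.2].
  by move=> p /[dup] /S[h1 _ _] [_ h2]; split.
have mD : measurable [set p : R * R | Tpos p.1 /\ T01 p.2].
  rewrite (_ : [set p | _] = (`[0, +oo[%classic `*` (@T01 R))).
    by apply: measurableX; [exact: measurable_itv|exact: measurable_itv].
  apply/seteqP; split => p /= [h1 h2]; split => //.
    by rewrite /= in_itv/= andbT.
  by move: h1; rewrite in_itv/= andbT.
have mU : measurable_fun setT U.
  apply/(measurable_restrictT _ mS); apply: measurable_clip.
  exact: measurable_funS mu.
have mV : measurable_fun setT V.
  apply/(measurable_restrictT _ mS); apply: measurable_clip.
  exact: measurable_funS mv.
have rb (w : R -> R -> R) p : 0 <= ((fun p : R * R => clip b (w p.1 p.2)) \_ (strip Tf)) p <= b.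
  by rewrite patchE; case: ifP => _; [exact: clip_between|rewrite lexx].
have Ub p : 0 <= U p <= b := rb u p.
have Vb p : 0 <= V p <= b := rb v p.
pose kap (p : R * R) := k (U p) (V p) p.2.
have bU : bm (strip Tf) U.
  split; first exact: measurable_funTS.
  by exists b => p _; have /andP[h1 h2] := Ub p; rewrite ger0_norm.
have bV : bm (strip Tf) V.
  split; first exact: measurable_funTS.
  by exists b => p _; have /andP[h1 h2] := Vb p; rewrite ger0_norm.
have bk : bm (strip Tf) kap.
  split.
    pose phi (p : R * R) := ((U p, V p), p.2).
    apply: (@measurable_comp _ _ _ _ _ _ [set p : (R * R) * R | 0 <= p.1.1 /\ 0 <= p.1.2 /\ T01 p.2]
      (fun p : (R * R) * R => k p.1.1 p.1.2 p.2) _ phi) => //.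
    - rewrite (_ : [set p | _] = (`[0, +oo[%classic `*` `[0, +oo[%classic) `*` (@T01 R)).
        by repeat apply: measurableX; exact: measurable_itv.
      apply/seteqP; split => p /=; rewrite /= !in_itv/= !andbT.
        by move=> [h1 [h2 h3]].
      by move=> [[h1 h2] h3].
    - move=> _ /= [p Sp <-] /=; have /andP[h1 _] := Ub p; have /andP[h2 _] := Vb p.
      by split => //; split => //; case: Sp.
    - apply: measurable_funTS; apply: measurable_fun_pair; last exact: measurable_snd.
      exact: measurable_fun_pair.
  exists K => p Sp; have [p1 p1' p2] := S p Sp.
  have tp2 : T01 p.2 by case: Sp.
  have /andP[h1 _] := Ub p; have /andP[h2 _] := Vb p.
  by rewrite ger0_norm ?kK ?k0.
have restr (w : R -> R -> R) t x : 0 <= t <= Tf -> T01 x -> 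
  ((fun p : R * R => clip b (w p.1 p.2)) \_ (strip Tf)) (t, x) = clip b (w t x).
  by move=> tT x01; rewrite patchE ifT//; apply/mem_set; split => //=; rewrite in_itv.
have uU t : 0 <= t <= Tf -> {ae leb, forall x, T01 x -> u t x = U (t, x)}.
  move=> tT; have tp : Tpos t by case/andP: tT.
  apply: ae_mono (ae_and (u_ge0 t tp) (ub t tT)) => x [h1 h2] x01.
  by rewrite /U restr// clip_id// ?h1 ?h2.
have vV t : 0 <= t <= Tf -> {ae leb, forall x, T01 x -> v t x = V (t, x)}.
  move=> tT; have tp : Tpos t by case/andP: tT.
  apply: ae_mono (ae_and (v_ge0 t tp) (vb t tT)) => x [h1 h2] x01.
  by rewrite /V restr// clip_id// ?h1 ?h2.
exists U, V, kap; split => //.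
  by move=> t tT; split; [exact: uU|exact: vV].
have cl0 (w : R -> R) : {ae leb, forall x, T01 x -> 0 <= w x <= b} ->
    {ae leb, forall x, T01 x -> w x = clip b (w x)}.
  by apply: ae_mono => x h x01; have /andP[h1 h2] := h x01; rewrite clip_id.
have bG (P Q : R * R -> R) : bm (strip Tf) P -> bm (strip Tf) Q ->
    bm (strip Tf) (fun p => kap p * (P p - Q p)).
  by move=> bP bQ; apply: bmM => //; exact: bmB.
split=> chi schi pchi.
- apply: (@weak_prim _ c Tf u (fun t x => k (u t x) (v t x) x * (v t x - u t x)) u0
    (fun x => clip b (u0 x)) U (fun p => kap p * (V p - U p)) Tf0 bU (bG _ _ bV bU)
    (bm_clip b0 mu0) uU _ (cl0 _ u0b) _ _ chi schi pchi).
  + move=> t tT; apply: ae_mono (ae_and (uU t tT) (vV t tT)) => x [h1 h2] x01.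
    by rewrite h1// h2.
  + by move=> t0; apply: ucont.
  + by move=> psi /weak[].
- apply: (@weak_prim _ (- c) Tf v (fun t x => k (u t x) (v t x) x * (u t x - v t x)) v0
    (fun x => clip b (v0 x)) V (fun p => kap p * (U p - V p)) Tf0 bV (bG _ _ bU bV)
    (bm_clip b0 mv0) vV _ (cl0 _ v0b) _ _ chi schi pchi).
  + move=> t tT; apply: ae_mono (ae_and (uU t tT) (vV t tT)) => x [h1 h2] x01.
    by rewrite h1// h2.
  + by move=> t0; apply: vcont.
  + move=> psi /weak[_ H]; rewrite -[RHS]H; congr (_ + _ + _).
    apply: eq_Rintegral => t _; apply: eq_Rintegral => x _.
    by rewrite mulNr.
Qed.

(** [transport_max] is applied to both components at once, since each is the source of the other;
    every pass multiplies the excess by $1-e^{-\lambda T_f}<1$. The countably many exceptional sets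
    are united before passing to the limit. *)
Lemma mild_le_initial (c Tf lam M n : R) (U V kap : R * R -> R) (U0 V0 : R -> R) :
  0 < Tf -> 0 < lam -> 0 <= n ->
  bm (strip Tf) U -> bm (strip Tf) V -> bm (strip Tf) kap ->
  bm (@T01 R) U0 -> bm (@T01 R) V0 ->
  mild c Tf U V kap U0 -> mild (- c) Tf V U kap V0 ->
  (forall t x, 0 <= t <= Tf -> 0 <= x <= 1 -> 0 <= kap (t, x) <= lam) ->
  {ae leb, forall x, T01 x -> U0 x <= M} -> {ae leb, forall x, T01 x -> V0 x <= M} ->
  (forall p, U p <= M + n) -> (forall p, V p <= M + n) ->
  forall t, 0 <= t <= Tf -> {ae leb, forall x, T01 x -> U (t, x) <= M /\ V (t, x) <= M}.
Proof.
move=> Tf0 lam0 n0 bU bV bk bU0 bV0 mU mV kl U0M V0M Un Vn.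
pose th := 1 - expR (- lam * Tf).
have th0 : 0 <= th by rewrite subr_ge0 expR_le1 mulNr oppr_le0 mulr_ge0// ltW.
have th1 : `|th| < 1 by rewrite ger0_norm// ltrBlDr ltrDl expR_gt0.
have step j : (forall t, 0 <= t <= Tf -> {ae leb, forall x, T01 x -> U (t, x) <= M + n * th ^+ j}) /\
   (forall t, 0 <= t <= Tf -> {ae leb, forall x, T01 x -> V (t, x) <= M + n * th ^+ j}).
  elim: j => [|j [IU IV]].
    by split => t tT; apply: aeW => x _; rewrite expr0 mulr1.
  have nj : 0 <= n * th ^+ j by rewrite mulr_ge0 ?exprn_ge0.
  split => t tT; rewrite exprSr mulrA.
    exact: (transport_max Tf0 lam0 nj bU bV bk bU0 mU kl U0M IU IV).
  exact: (transport_max Tf0 lam0 nj bV bU bk bV0 mV kl V0M IV IU).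
move=> t tT.
have all_j : {ae leb, forall x, forall j : nat, T01 x ->
    U (t, x) <= M + n * th ^+ j /\ V (t, x) <= M + n * th ^+ j}.
  apply: ae_foralln => j; have [h1 h2] := step j.
  by apply: ae_mono (ae_and (h1 t tT) (h2 t tT)) => x [g1 g2] x01; split; [exact: g1|exact: g2].
have lim : M + n * th ^+ j @[j --> \oo] --> M.
  rewrite -[X in _ --> X]addr0; apply: cvgD; first exact: cvg_cst.
  rewrite -[X in _ --> X](mulr0 n); apply: cvgM; first exact: cvg_cst.
  exact: cvg_expr.
have le_lim z : (forall j, z <= M + n * th ^+ j) -> z <= M.
  move=> h; apply/ler_addgt0Pr => e e0.
  have Me : M < M + e by rewrite ltrDl.
  have [N _ /(_ N (leqnn N))] := cvgr_le _ lim _ Me.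
  exact: le_trans (h N).
by apply: ae_mono all_j => x h x01; split; apply: le_lim => j; case: (h j x01).
Qed.

End ClippedSolution.

(** * Exponential decay *)

Section Decay.
Context {R : realType}.
Notation leb := (@lebesgue_measure R).
Implicit Types (t : R) (N k : nat).
Context (c Tf m K kap0 : R) (U V kap : R * R -> R) (U0 V0 : R -> R).
Context (c0 : 0 < c) (Tf0 : 0 < Tf) (m0 : 0 < m) (K0 : 0 < K) (kap00 : 0 < kap0).
Context (bU : bm (strip Tf) U) (bV : bm (strip Tf) V) (bkap : bm (strip Tf) kap).
Context (bU0 : bm (@T01 R) U0) (bV0 : bm (@T01 R) V0).
Context (U_ge0 : forall p, 0 <= U p) (V_ge0 : forall p, 0 <= V p).
Context (kap_bnd : forall t x, 0 <= t <= Tf -> 0 <= x <= 1 -> 0 <= kap (t, x) <= K).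
Context (kap_low : forall t, 0 <= t <= Tf ->
  {ae leb, forall x, T01 x -> kap0 * (U (t, x) + V (t, x)) <= kap (t, x)}).
Context (mU : mild c Tf U V kap U0) (mV : mild (- c) Tf V U kap V0).
Context (mE : lint 0 1 (fun x => U0 x + V0 x) = 2 * m).

(** [S], [W] and [g] are $\rho-2m$, $w$ and the source $-2kw$ of the overview, with the rate frozen
    as [kap]. *)
Let S (p : R * R) := U p + V p - 2 * m.
Let W (p : R * R) := U p - V p.
Let g (p : R * R) := 2 * (kap p * (V p - U p)).
Let S0 x := U0 x + V0 x - 2 * m.
Let W0 x := U0 x - V0 x.

Let om (k : nat) : R := k%:R * (pi *+ 2).

Let bS : bm (strip Tf) S.
Proof. by apply: bmB; [exact: bmD|exact: bm_cst]. Qed.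
Let bW : bm (strip Tf) W. Proof. exact: bmB. Qed.
Let bg : bm (strip Tf) g.
Proof. by apply: bmZ; apply: bmM => //; exact: bmB. Qed.
Let bS0 : bm (@T01 R) S0.
Proof. by apply: bmB; [exact: bmD|exact: bm_cst]. Qed.
Let bW0 : bm (@T01 R) W0. Proof. exact: bmB. Qed.

Let sl (H : R * R -> R) t : bm (strip Tf) H -> 0 <= t <= Tf ->
  bm (@T01 R) (fun x => H (t, x)).
Proof. by move=> bH tT; exact: (bm_strip_slice tT bH). Qed.

Let lint_wave_shift k phi : om k * lint 0 1 (@wave R k%:Z phi) = 0.
Proof.
rewrite lint_wave; case: k => [|k] /=; last by rewrite mulr0.
by rewrite /om !mul0r.
Qed.

Let pdt_wave k phi t x : pdt (fun _ x : R => wave k%:Z phi x) t x = 0.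
Proof. by apply: derive1_of; exact: is_derive_cst. Qed.

Let pdx_wave k phi t x :
  pdx (fun _ x : R => wave k%:Z phi x) t x = om k * wave k%:Z (phi + pi / 2) x.
Proof. by apply: derive1_of; exact: wave_derive. Qed.

(** In the sum of the two equations the exchange terms cancel and the transport terms combine into
    the difference; subtracting $2m$ only adds a term independent of time. *)
Let mode_S k phi : prim Tf (fun t => lint 0 1 (fun x => S (t, x) * wave k%:Z phi x))
  (fun t => c * om k * lint 0 1 (fun x => W (t, x) * wave k%:Z (phi + pi / 2) x))
  /\ lint 0 1 (fun x => S (0, x) * wave k%:Z phi x) = lint 0 1 (fun x => S0 x * wave k%:Z phi x).
Proof.
have bw psi : bm (@T01 R) (@wave R k%:Z psi) by exact: bm_wave.
have [pU eU] := mU (smooth_wave k%:Z phi) (fun _ => wave_periodic k%:Z phi).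
have [pV eV] := mV (smooth_wave k%:Z phi) (fun _ => wave_periodic k%:Z phi).
have lin (f h : R -> R) : bm (@T01 R) f -> bm (@T01 R) h ->
    lint 0 1 (fun x => f x * wave k%:Z phi x) + lint 0 1 (fun x => h x * wave k%:Z phi x)
    + - (2 * m) * lint 0 1 (wave k%:Z phi) =
    lint 0 1 (fun x => (f x + h x - 2 * m) * wave k%:Z phi x).
  move=> bf bh; have b1 := bmM bf (bw phi); have b2 := bmM bh (bw phi).
  have b3 := bmZ (- (2 * m)) (bw phi); have b4 := bmD b1 b2.
  by rewrite -lintZ// -!lintD//; apply: eq_lint => x _; ring.
split; last first.
  have T0 : 0 <= (0 : R) <= Tf by rewrite lexx ltW.
  by rewrite -(lin _ _ (sl bU T0) (sl bV T0)) eU eV lin.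
apply: (prim_ext _ _ (primD (primD pU pV) (prim_cst Tf (- (2 * m) * lint 0 1 (@wave R k%:Z phi))))).
  by move=> t tT; exact: (lin _ _ (sl bU tT) (sl bV tT)).
move=> t tT; rewrite addr0 -lintZ; last by apply: bmM => //; exact: (sl bW tT).
have bUt := sl bU tT; have bVt := sl bV tT; have bkt := sl bkap tT.
rewrite -lintD; last 2 first.
- apply: bmD; last by apply: bmM => //; apply: bmM => //; exact: bmB.
  apply: bmM => //; apply: (bm_ext _ (bmZ (c * om k) (bw (phi + pi / 2)))) => x _.
  by rewrite pdt_wave pdx_wave; ring.
- apply: bmD; last by apply: bmM => //; apply: bmM => //; exact: bmB.
  apply: bmM => //; apply: (bm_ext _ (bmZ (- (c * om k)) (bw (phi + pi / 2)))) => x _.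
  by rewrite pdt_wave pdx_wave; ring.
by apply: eq_lint => x _; rewrite pdt_wave pdx_wave /W; ring.
Qed.

Let mode_W k phi : prim Tf (fun t => lint 0 1 (fun x => W (t, x) * wave k%:Z phi x))
  (fun t => c * om k * lint 0 1 (fun x => S (t, x) * wave k%:Z (phi + pi / 2) x) +
     lint 0 1 (fun x => g (t, x) * wave k%:Z phi x))
  /\ lint 0 1 (fun x => W (0, x) * wave k%:Z phi x) = lint 0 1 (fun x => W0 x * wave k%:Z phi x).
Proof.
have bw psi : bm (@T01 R) (@wave R k%:Z psi) by exact: bm_wave.
have [pU eU] := mU (smooth_wave k%:Z phi) (fun _ => wave_periodic k%:Z phi).
have [pV eV] := mV (smooth_wave k%:Z phi) (fun _ => wave_periodic k%:Z phi).
have lin (f h : R -> R) : bm (@T01 R) f -> bm (@T01 R) h ->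
    lint 0 1 (fun x => f x * wave k%:Z phi x) + -1 * lint 0 1 (fun x => h x * wave k%:Z phi x) =
    lint 0 1 (fun x => (f x - h x) * wave k%:Z phi x).
  move=> bf bh; have b1 := bmM bf (bw phi); have b2 := bmM bh (bw phi).
  have b3 := bmZ (-1) b2.
  by rewrite -lintZ// -!lintD//; apply: eq_lint => x _; ring.
split; last first.
  have T0 : 0 <= (0 : R) <= Tf by rewrite lexx ltW.
  by rewrite -(lin _ _ (sl bU T0) (sl bV T0)) eU eV lin.
apply: (prim_ext _ _ (primD pU (primZ (-1) pV))).
  by move=> t tT; exact: (lin _ _ (sl bU tT) (sl bV tT)).
move=> t tT.
have bUt := sl bU tT; have bVt := sl bV tT; have bkt := sl bkap tT.
have bgt := sl bg tT; have bSt := sl bS tT.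
have b5 := bmM bSt (bw (phi + pi / 2)); have b6 := bmM bgt (bw phi).
have b7 := bmZ (c * om k) b5.
have b8 := bmZ (2 * m * c * om k) (bw (phi + pi / 2)).
(* The constant $2m$ in [S] is harmless: a wave of nonzero frequency has mean zero, and [om 0] is
   zero. *)
have -> : c * om k * lint 0 1 (fun x => S (t, x) * wave k%:Z (phi + pi / 2) x) =
  lint 0 1 (fun x => c * om k * (S (t, x) * wave k%:Z (phi + pi / 2) x) +
     2 * m * c * om k * wave k%:Z (phi + pi / 2) x).
  by rewrite lintD// !lintZ// -[X in _ = _ + X]mulrA lint_wave_shift mulr0 addr0.
rewrite -lintD//; last exact: bmD.
have b9 : bm (@T01 R) (fun x => U (t, x) * (pdt (fun _ x : R => wave k%:Z phi x) t x +
    c * pdx (fun _ x : R => wave k%:Z phi x) t x) + kap (t, x) * (V (t, x) - U (t, x)) * wave k%:Z phi x).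
  apply: bmD; last by apply: bmM => //; apply: bmM => //; exact: bmB.
  apply: bmM => //; apply: (bm_ext _ (bmZ (c * om k) (bw (phi + pi / 2)))) => x _.
  by rewrite pdt_wave pdx_wave; ring.
have b10 : bm (@T01 R) (fun x => V (t, x) * (pdt (fun _ x : R => wave k%:Z phi x) t x +
    - c * pdx (fun _ x : R => wave k%:Z phi x) t x) + kap (t, x) * (U (t, x) - V (t, x)) * wave k%:Z phi x).
  apply: bmD; last by apply: bmM => //; apply: bmM => //; exact: bmB.
  apply: bmM => //; apply: (bm_ext _ (bmZ (- (c * om k)) (bw (phi + pi / 2)))) => x _.
  by rewrite pdt_wave pdx_wave; ring.
rewrite -lintZ// -lintD//; last exact: bmZ.
by apply: eq_lint => x _; rewrite pdt_wave pdx_wave /S /g; ring.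
Qed.

Let a k t := fcos (fun x => S (t, x)) k.
Let b k t := fsin (fun x => S (t, x)) k.
Let p k t := fcos (fun x => W (t, x)) k.
Let q k t := fsin (fun x => W (t, x)) k.
Let Gc k t := fcos (fun x => g (t, x)) k.
Let Gs k t := fsin (fun x => g (t, x)) k.
(** At [k = 0] the inverse of zero is zero, so the mean carries no cross term. *)
Let nu k := (om k)^-1.

Let om_ge0 k : 0 <= om k.
Proof. by rewrite mulr_ge0// mulrn_wge0// pi_ge0. Qed.

Let nu_01 k : 0 <= nu k <= 1.
Proof.
rewrite invr_ge0 om_ge0/=; case: k => [|k]; first by rewrite /nu /om mul0r invr0.
have h : 1 <= om k.+1.
  have := @pi_ge2 R; have : (1 : R) <= k.+1%:R by rewrite ler1n.
  by rewrite /om; nra.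
by rewrite invf_le1// (lt_le_trans ltr01).
Qed.

Let nu_om k : nu k * om k = (k != 0%N)%:R.
Proof.
case: k => [|k]; first by rewrite /nu /om mul0r mulr0.
by rewrite mulVf// /om mulf_neq0// ?pnatr_eq0// mulrn_eq0/= gt_eqF// pi_gt0.
Qed.

Let lint_quarter (f : R -> R) k : bm (@T01 R) f ->
  lint 0 1 (fun x => f x * wave k%:Z (0 + pi / 2) x) = - fsin f k.
Proof.
move=> bf; rewrite /fsin -lintN; last exact: bmMw.
by apply: eq_lint => x _; rewrite /wave add0r cosDpihalf cosBpihalf mulrN.
Qed.

Let prim_a k : prim Tf (a k) (fun t => - (c * om k) * q k t).
Proof.
apply: (prim_ext _ _ (mode_S k 0).1) => // t tT.
by rewrite lint_quarter ?mulrN ?mulNr//; exact: (sl bW tT).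
Qed.

Let prim_b k : prim Tf (b k) (fun t => c * om k * p k t).
Proof. by apply: (prim_ext _ _ (mode_S k (- (pi / 2))).1) => // t tT; rewrite addNr. Qed.

Let prim_p k : prim Tf (p k) (fun t => - (c * om k) * b k t + Gc k t).
Proof.
apply: (prim_ext _ _ (mode_W k 0).1) => // t tT.
by rewrite lint_quarter ?mulrN ?mulNr//; exact: (sl bS tT).
Qed.

Let prim_q k : prim Tf (q k) (fun t => c * om k * a k t + Gs k t).
Proof. by apply: (prim_ext _ _ (mode_W k (- (pi / 2))).1) => // t tT; rewrite addNr. Qed.

(** Conservation of mass. The cross term dissipates no mean of [S], so this mean has to vanish for
    the estimate to close. *)
Let a0_0 t : 0 <= t <= Tf -> a 0 t = 0.
Proof.
move=> /andP[t0 tT]; have [_ /(_ 0 t (lexx _) t0 tT)] := prim_a 0.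
have -> : lint 0 t (fun t => - (c * om 0) * q 0 t) = 0.
  by rewrite -[RHS](lint0 0 t); apply: eq_lint => r _; rewrite /om mul0r mulr0 oppr0 mul0r.
move=> /eqP; rewrite subr_eq0 => /eqP ->.
rewrite /a /fcos (mode_S 0 0).2.
have -> : lint 0 1 (fun x => S0 x * wave 0 0 x) = lint 0 1 (fun x => U0 x + V0 x - 2 * m).
  by apply: eq_lint => x _; rewrite /wave mul0r addr0 cos0 mulr1.
rewrite lintB; [|exact: bmD|exact: bm_cst].
by rewrite mE lint_cst// subr0 mulr1 subrr.
Qed.

(** With [eps] at most $1/2$ the cross term is at most a quarter of the truncated energy, so [L]
    lies between $1/4$ and $1$ times it. The condition [epsC] lets one copy of [Dis] absorb what the
    cross term produces. *)
Context (eps : R) (eps0 : 0 < eps) (eps2 : eps <= 2^-1)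
  (epsC : eps * (3 * c / (2 * m * kap0) + 4 * K / c) <= 1).

(** The combination [p * b - q * a] is the real form of the pairing of $w_k$ with $i\rho_k$. *)
Let L N t := \sum_(k < N) (2^-1 * @wt R k * (a k t * a k t + b k t * b k t + (p k t * p k t + q k t * q k t))
  + eps * (@wt R k * nu k) * (p k t * b k t + -1 * (q k t * a k t))).

Let fb N (F G : R * R -> R) t := fbil N (fun x => F (t, x)) (fun x => G (t, x)).

(** The time derivative of [L]: the transport terms cancel in the energy, and in the cross term they
    leave $c(|w_k|^2-|\rho_k|^2)$ for $k\ne0$, because [nu k * om k] is then $1$. *)
Let X N t := \sum_(k < N) (@wt R k * (p k t * Gc k t + q k t * Gs k t) +
  eps * @wt R k * (c * (k != 0%N :> nat)%:R * (p k t ^+ 2 + q k t ^+ 2 - (a k t ^+ 2 + b k t ^+ 2)) +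
     nu k * (Gc k t * b k t - Gs k t * a k t))).

Let prim_L N : prim Tf (L N) (X N).
Proof.
apply: (prim_sum (index_enum 'I_N)) => i; move: (nat_of_ord i) => k.
have T0 := ltW Tf0.
apply: (prim_ext _ _ (primD (primZ (2^-1 * @wt R k) (primD
    (primD (primM T0 (prim_a k) (prim_a k)) (primM T0 (prim_b k) (prim_b k)))
    (primD (primM T0 (prim_p k) (prim_p k)) (primM T0 (prim_q k) (prim_q k)))))
   (primZ (eps * (@wt R k * nu k)) (primD (primM T0 (prim_p k) (prim_b k))
     (primZ (-1) (primM T0 (prim_q k) (prim_a k))))))) => // t _.
by rewrite -(nu_om k); field.
Qed.

Let norm2 (F : R * R -> R) t := lint 0 1 (fun x => F (t, x) ^+ 2).
Let Dis t := lint 0 1 (fun x => kap (t, x) * W (t, x) ^+ 2).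
(** What truncation loses: the pairing of [W] with [g] equals $-2\,Dis$ only in the limit, and only
    the first [N] modes of [S] are dissipated. *)
Let err N t := (fb N W g t - lint 0 1 (fun x => W (t, x) * g (t, x))) +
  eps * c * (norm2 S t - fb N S S t).

Let L_le N t : 0 <= t <= Tf -> L N t <= norm2 S t + norm2 W t.
Proof.
move=> tT.
apply: (@le_trans _ _ (fb N S S t + fb N W W t)); last first.
  by rewrite lerD// bessel//; [exact: (sl bS tT)|exact: (sl bW tT)].
rewrite /L /fb /fbil -big_split/=; apply: ler_sum => k _.
rewrite -!/(a k t) -!/(b k t) -!/(p k t) -!/(q k t).
have w0 := @wt_ge0 R k; have /andP[n0 n1] := nu_01 k.
have -> : @wt R k * (a k t * a k t + b k t * b k t) + @wt R k * (p k t * p k t + q k t * q k t) =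
  @wt R k * (a k t ^+ 2 + b k t ^+ 2 + p k t ^+ 2 + q k t ^+ 2) by ring.
have -> : 2^-1 * @wt R k * (a k t * a k t + b k t * b k t + (p k t * p k t + q k t * q k t)) +
    eps * (@wt R k * nu k) * (p k t * b k t + -1 * (q k t * a k t)) =
  @wt R k * (2^-1 * (a k t ^+ 2 + b k t ^+ 2 + p k t ^+ 2 + q k t ^+ 2) + (eps * nu k) * (p k t * b k t - q k t * a k t)).
  by field.
rewrite ler_wpM2l//.
have en : 0 <= eps * nu k <= 2^-1 by rewrite mulr_ge0 ?(ltW eps0)//= (le_trans (ler_piMr (ltW eps0) n1)).
move: en (sqr_ge0 (p k t - b k t)) (sqr_ge0 (p k t + b k t)) (sqr_ge0 (q k t - a k t)) (sqr_ge0 (q k t + a k t)).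
move: (eps * nu k) (a k t) (b k t) (p k t) (q k t) => e x y z w /andP[e0 e1] h1 h2 h3 h4; nra.
Qed.

Let L_ge N t : 4^-1 * (fb N S S t + fb N W W t) <= L N t.
Proof.
rewrite /L /fb /fbil -big_split/= mulr_sumr; apply: ler_sum => k _.
rewrite -!/(a k t) -!/(b k t) -!/(p k t) -!/(q k t).
have w0 := @wt_ge0 R k; have /andP[n0 n1] := nu_01 k.
have -> : 4^-1 * (@wt R k * (a k t * a k t + b k t * b k t) + @wt R k * (p k t * p k t + q k t * q k t)) =
  @wt R k * (4^-1 * (a k t ^+ 2 + b k t ^+ 2 + p k t ^+ 2 + q k t ^+ 2)) by ring.
have -> : 2^-1 * @wt R k * (a k t * a k t + b k t * b k t + (p k t * p k t + q k t * q k t)) +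
    eps * (@wt R k * nu k) * (p k t * b k t + -1 * (q k t * a k t)) =
  @wt R k * (2^-1 * (a k t ^+ 2 + b k t ^+ 2 + p k t ^+ 2 + q k t ^+ 2) + (eps * nu k) * (p k t * b k t - q k t * a k t)).
  by field.
rewrite ler_wpM2l//.
have en : 0 <= eps * nu k <= 2^-1 by rewrite mulr_ge0 ?(ltW eps0)//= (le_trans (ler_piMr (ltW eps0) n1)).
move: en (sqr_ge0 (p k t - b k t)) (sqr_ge0 (p k t + b k t)) (sqr_ge0 (q k t - a k t)) (sqr_ge0 (q k t + a k t)).
move: (eps * nu k) (a k t) (b k t) (p k t) (q k t) => e x y z w /andP[e0 e1] h1 h2 h3 h4; nra.
Qed.

(** The first entry gives $4\,rate\,|W|^2\le Dis+rate\,|S|^2$ through [W_dissipated], the second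
    $2\,rate\,|S|^2\le\frac12 eps\,c\,|S|^2$; together they bound $rate(|S|^2+|W|^2)$ by the
    dissipation that [X_le] retains. *)
Let rate := Num.min (2 * m * kap0 / 3) (eps * c) / 4.

(* Where the density is below 2m/3 its deviation from 2m dominates [W]; elsewhere the dissipation does. *)
Let W_dissipated t : 0 <= t <= Tf ->
  norm2 W t <= 4^-1 * norm2 S t + 3 / (2 * m * kap0) * Dis t.
Proof.
move=> tT; have bSt := sl bS tT; have bWt := sl bW tT; have bkt := sl bkap tT.
have b1 := bmX 2 bSt; have b2 := bmX 2 bWt; have b3 := bmM bkt b2.
rewrite /norm2 /Dis -!lintZ// -lintD; [|exact: bmZ|exact: bmZ].
apply: le_lint_ae; [exact: bmX|by apply: bmD; apply: bmZ|].
apply: ae_mono (kap_low tT) => x h x01; have {}h := h x01; rewrite /S /W.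
have u0 := U_ge0 (t, x); have v0 := V_ge0 (t, x).
move: h u0 v0; move: (U (t, x)) (V (t, x)) (kap (t, x)) => u v ka h u0 v0.
have mk0 : 0 < 2 * m * kap0 by rewrite !mulr_gt0.
have w2 := sqr_ge0 (u - v).
have [r|r] := leP (2 * m) (3 * (u + v)).
  have h3 : 1 <= 3 / (2 * m * kap0) * ka.
    rewrite mulrAC ler_pdivlMr// mul1r.
    have : 2 * m * kap0 <= 3 * (u + v) * kap0 by rewrite ler_wpM2r// ltW.
    by move: h; lra.
  apply: ler_wpDl; first by rewrite mulr_ge0// sqr_ge0.
  by rewrite mulrA -[X in X <= _]mul1r ler_wpM2r.
have ka0 : 0 <= ka by apply: le_trans h; rewrite mulr_ge0 ?addr_ge0// ltW.
apply: ler_wpDr; first by rewrite mulr_ge0 ?(mulr_ge0 ka0)// divr_ge0// ltW.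
have h4 : (u - v) ^+ 2 <= (u + v) ^+ 2 by nra.
by nra.
Qed.

Let X_le N t : 0 <= t <= Tf -> X N t <= - rate * L N t + err N t.
Proof.
move=> tT; have bSt := sl bS tT; have bWt := sl bW tT; have bkt := sl bkap tT.
have bgt := sl bg tT.
have bw2 := bmX 2 bWt; have bkw := bmM bkt bw2.
have H1 : X N t <= fb N W g t + eps * (c * (fb N W W t - fb N S S t) +
    c / 4 * fb N S S t + c^-1 * fb N g g t).
  rewrite /X /fb /fbil -sumrB !mulr_sumr -!big_split/= mulr_sumr -big_split/=.
  apply: ler_sum => k _.
  rewrite -!/(a k t) -!/(b k t) -!/(p k t) -!/(q k t) -!/(Gc k t) -!/(Gs k t).
  have w0 := @wt_ge0 R k; have /andP[n0 n1] := nu_01 k.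
  rewrite lerD2l.
  have -> : eps * (c * (@wt R k * (p k t * p k t + q k t * q k t) - @wt R k * (a k t * a k t + b k t * b k t)) +
      c / 4 * (@wt R k * (a k t * a k t + b k t * b k t)) +
      c^-1 * (@wt R k * (Gc k t * Gc k t + Gs k t * Gs k t))) =
    eps * @wt R k * (c * (p k t ^+ 2 + q k t ^+ 2 - (a k t ^+ 2 + b k t ^+ 2)) +
     (c / 4 * (a k t ^+ 2 + b k t ^+ 2) + c^-1 * (Gc k t ^+ 2 + Gs k t ^+ 2))) by ring.
  rewrite ler_wpM2l ?mulr_ge0 ?(ltW eps0)// lerD//.
    (* At mode zero the factor is missing, but [S] has no mean and the sine vanishes, so only the
       nonnegative contribution of [W] is added. *)
    case: (nat_of_ord k) => [|k'] /=; last by rewrite mulr1.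
    rewrite mulr0 mul0r mulr_ge0 ?(ltW c0)//.
    by rewrite a0_0// /b fsin0 expr0n/= addr0 subr0 addr_ge0 ?sqr_ge0.
  have am (x y : R) : `|x * y| <= c / 4 * y ^+ 2 + c^-1 * x ^+ 2.
    have -> : c / 4 * y ^+ 2 + c^-1 * x ^+ 2 = (c^-1) * ((c / 2 * y) ^+ 2 + x ^+ 2).
      by field; rewrite gt_eqF.
    rewrite -(ler_pM2l c0) mulrA mulfV ?gt_eqF// mul1r.
    have := sqr_ge0 (c / 2 * y - x); have := sqr_ge0 (c / 2 * y + x).
    by case: (ger0P (x * y)) => _ h1 h2; nra.
  have h1 := am (Gc k t) (b k t); have h2 := am (Gs k t) (a k t).
  apply: (@le_trans _ _ (`|Gc k t * b k t| + `|Gs k t * a k t|)).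
    apply: (@le_trans _ _ (1 * `|Gc k t * b k t - Gs k t * a k t|)).
      apply: le_trans (ler_norm _) _; rewrite normrM (ger0_norm n0).
      by rewrite ler_wpM2r.
    by rewrite mul1r ler_normB.
  by move: h1 h2; lra.
have H2 : fb N g g t <= 4 * K * Dis t.
  apply: le_trans (bessel N bgt) _.
  rewrite /Dis -lintZ//; apply: le_lint; [exact: bmX|exact: bmZ|] => x x01.
  have /andP[k0 k1] := kap_bnd tT x01; have := sqr_ge0 (W (t, x)) => w2.
  have -> : g (t, x) ^+ 2 = 4 * (kap (t, x) * kap (t, x) * W (t, x) ^+ 2) by rewrite /g /W; ring.
  have -> : 4 * K * (kap (t, x) * W (t, x) ^+ 2) = 4 * (K * kap (t, x) * W (t, x) ^+ 2) by ring.
  by rewrite ler_wpM2l// ler_wpM2r// ler_wpM2r.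
have H3 : fb N W W t <= norm2 W t by exact: bessel.
have H4 : lint 0 1 (fun x => W (t, x) * g (t, x)) = - 2 * Dis t.
  by rewrite /Dis -lintZ//; apply: eq_lint => x _; rewrite /g /W; ring.
have H5 : fb N S S t <= norm2 S t by exact: bessel.
have H6 := W_dissipated tT.
have H7 := L_le N tT.
have D0 : 0 <= Dis t.
  by apply: lint_ge0 => x x01; have /andP[k0 _] := kap_bnd tT x01; rewrite mulr_ge0 ?sqr_ge0.
have s0 : 0 <= norm2 S t by apply: lint_ge0 => x _; exact: sqr_ge0.
have n0 : 0 <= norm2 W t by apply: lint_ge0 => x _; exact: sqr_ge0.
have mk0 : 0 < 2 * m * kap0 by rewrite !mulr_gt0.
have r1 : 4 * rate <= 2 * m * kap0 / 3 by rewrite /rate mulrC divfK// ge_min lexx.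
have r2 : 4 * rate <= eps * c by rewrite /rate mulrC divfK// ge_min lexx orbT.
have r0 : 0 <= rate.
  by rewrite /rate divr_ge0// le_min !mulr_ge0 ?invr_ge0//; exact: ltW.
have H8 : 4 * rate * (norm2 W t - 4^-1 * norm2 S t) <= Dis t.
  have [h|h] := leP (norm2 W t - 4^-1 * norm2 S t) 0.
    by apply: le_trans D0; rewrite mulr_ge0_le0// mulr_ge0.
  apply: le_trans (ler_wpM2r (ltW h) r1) _.
  rewrite -ler_pdivlMl ?divr_gt0//; rewrite invf_div; lra.
(* Of the dissipation $eps\,c\,|S|^2$ one quarter has gone to the source by Young's inequality and
   one quarter to the bound on [W]; half survives. By [epsC] the remaining terms use one of the two
   copies of [Dis]. *)
have H9 : eps * (c * (fb N W W t - fb N S S t) + c / 4 * fb N S S t + c^-1 * fb N g g t) <=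
   Dis t - eps * c / 2 * norm2 S t + eps * c * (norm2 S t - fb N S S t).
  have i1 : c * (fb N W W t) <= c * (4^-1 * norm2 S t + 3 / (2 * m * kap0) * Dis t).
    by rewrite ler_wpM2l ?(ltW c0)// (le_trans H3).
  have i2 : c / 4 * fb N S S t <= c / 4 * norm2 S t by rewrite ler_wpM2l// divr_ge0// ltW.
  have i3 : c^-1 * fb N g g t <= c^-1 * (4 * K * Dis t) by rewrite ler_wpM2l// invr_ge0 ltW.
  have i4 : eps * (3 * c / (2 * m * kap0) + 4 * K / c) * Dis t <= Dis t.
    by rewrite -[leRHS]mul1r ler_wpM2r.
  apply: (@le_trans _ _ (eps * (c * (4^-1 * norm2 S t + 3 / (2 * m * kap0) * Dis t) - c * fb N S S t +
     c / 4 * norm2 S t + c^-1 * (4 * K * Dis t)))).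
    by rewrite ler_wpM2l ?(ltW eps0)//; lra.
  have -> : eps * (c * (4^-1 * norm2 S t + 3 / (2 * m * kap0) * Dis t) - c * fb N S S t +
     c / 4 * norm2 S t + c^-1 * (4 * K * Dis t)) =
    eps * (3 * c / (2 * m * kap0) + 4 * K / c) * Dis t +
     (- (eps * c / 2 * norm2 S t) + eps * c * (norm2 S t - fb N S S t)).
    by field; rewrite !gt_eqF.
  by move: i4; lra.
have H10 : rate * L N t <= rate * (norm2 S t + norm2 W t) by rewrite ler_wpM2l.
have H11 : 4 * rate * norm2 S t <= eps * c * norm2 S t by rewrite ler_wpM2r.
rewrite /err H4.
have : 0 <= rate * norm2 W t by rewrite mulr_ge0.
move: H1 H8 H9 H10 H11; lra.
Qed.

Let bm_coef (F : R * R -> R) k phi : bm (strip Tf) F ->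
  bm `[0, Tf] (fun t => lint 0 1 (fun x => F (t, x) * wave k%:Z phi x)).
Proof.
move=> bF; apply: (@bm_strip_lint _ Tf (fun p => F p * wave k%:Z phi p.2)); apply: bmM => //.
exact: (bm_strip_smooth (ltW Tf0) (smooth_wave k%:Z phi)).
Qed.

Let bm_fb N (F G : R * R -> R) : bm (strip Tf) F -> bm (strip Tf) G -> bm `[0, Tf] (fb N F G).
Proof.
move=> bF bG; apply: bm_sum => k; apply: bmZ.
by apply: bmD; apply: bmM; exact: bm_coef.
Qed.

Let bm_pair (F G : R * R -> R) : bm (strip Tf) F -> bm (strip Tf) G ->
  bm `[0, Tf] (fun t => lint 0 1 (fun x => F (t, x) * G (t, x))).
Proof.
by move=> bF bG; apply: (@bm_strip_lint _ Tf (fun p => F p * G p)); exact: bmM.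
Qed.

Let bm_norm2 (F : R * R -> R) : bm (strip Tf) F -> bm `[0, Tf] (norm2 F).
Proof. by move=> bF; apply: (@bm_strip_lint _ Tf (fun p => F p ^+ 2)); exact: bmX. Qed.

Let bm_err N : bm `[0, Tf] (err N).
Proof.
apply: bmD; first by apply: bmB; [exact: bm_fb|exact: bm_pair].
by apply: bmZ; apply: bmB; [exact: bm_norm2|exact: bm_fb].
Qed.

Let err_cvg t : 0 <= t <= Tf -> err N t @[N --> \oo] --> (0 : R).
Proof.
move=> tT; have bSt := sl bS tT; have bWt := sl bW tT; have bgt := sl bg tT.
rewrite -[X in _ --> X]addr0; apply: cvgD.
  rewrite -[X in _ --> X](subrr (lint 0 1 (fun x => W (t, x) * g (t, x)))).
  by apply: cvgB; [exact: parseval_bil|exact: cvg_cst].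
rewrite -[X in _ --> X](mulr0 (eps * c)); apply: cvgM; first exact: cvg_cst.
rewrite -[X in _ --> X](subrr (norm2 S t)).
by apply: cvgB; [exact: cvg_cst|exact: parseval].
Qed.

Let fbil_le N (f h : R -> R) : bm (@T01 R) f -> bm (@T01 R) h ->
  `|fbil N f h| <= lint 0 1 (fun x => f x ^+ 2) + lint 0 1 (fun x => h x ^+ 2).
Proof.
move=> bf bh; apply: (@le_trans _ _ (fbil N f f + fbil N h h)); last first.
  by rewrite lerD// bessel.
rewrite /fbil -big_split/=; apply: le_trans (ler_norm_sum _ _ _) _.
apply: ler_sum => k _; have w0 := @wt_ge0 R k.
rewrite -mulrDr normrM (ger0_norm w0) ler_wpM2l//.
move: (fcos f k) (fsin f k) (fcos h k) (fsin h k) => x y z w.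
have h1 := sqr_ge0 (x - z); have h2 := sqr_ge0 (x + z).
have h3 := sqr_ge0 (y - w); have h4 := sqr_ge0 (y + w).
by rewrite ler_norml; apply/andP; split; nra.
Qed.

(** Uniformity in [N], which comes from Bessel's inequality, is what dominated convergence in time
    requires. *)
Let err_bounded : exists C, forall N t, 0 <= t <= Tf -> `|err N t| <= C.
Proof.
have [_ [C1 HC1]] := bm_norm2 bW; have [_ [C2 HC2]] := bm_norm2 bg.
have [_ [C3 HC3]] := bm_pair bW bg; have [_ [C4 HC4]] := bm_norm2 bS.
exists (C1 + C2 + C3 + eps * c * (C4 + (C4 + C4))) => N t tT.
have I (B : R -> R) C : (forall t, `[0, Tf]%classic t -> `|B t| <= C) -> `|B t| <= C.
  by move=> h; apply: h; rewrite /= in_itv.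
have {}HC1 := I _ _ HC1; have {}HC2 := I _ _ HC2; have {}HC3 := I _ _ HC3; have {}HC4 := I _ _ HC4.
have bSt := sl bS tT; have bWt := sl bW tT; have bgt := sl bg tT.
have h1 := fbil_le N bWt bgt; have h2 := fbil_le N bSt bSt.
have ec : 0 <= eps * c by rewrite mulr_ge0// ltW.
apply: le_trans (ler_normD _ _) _; apply: lerD.
  apply: le_trans (ler_normB _ _) _; apply: lerD => //.
  apply: le_trans h1 _; apply: lerD; [apply: le_trans HC1|apply: le_trans HC2]; exact: ler_norm.
rewrite normrM (ger0_norm ec) ler_wpM2l//.
apply: le_trans (ler_normB _ _) _; apply: lerD => //.
by apply: le_trans h2 _; apply: lerD; apply: le_trans HC4; exact: ler_norm.
Qed.

(** The initial condition is attained mode by mode only; Parseval turns this into equality of the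
    norms. *)
Let norm2_eq_of_modes (F : R * R -> R) (f : R -> R) : bm (strip Tf) F -> bm (@T01 R) f ->
  (forall k phi, lint 0 1 (fun x => F (0, x) * wave k%:Z phi x) =
    lint 0 1 (fun x => f x * wave k%:Z phi x)) ->
  norm2 F 0 = lint 0 1 (fun x => f x ^+ 2).
Proof.
move=> bF bf E.
have T0 : 0 <= (0 : R) <= Tf by rewrite lexx ltW.
have h1 := parseval (sl bF T0); have h2 := parseval bf.
have h3 : (fun N => fbil N (fun x => F (0, x)) (fun x => F (0, x))) = (fun N => fbil N f f).
  by apply/funext => N; apply: eq_bigr => k _; rewrite /fcos /fsin !E.
rewrite h3 in h1.
exact: (@cvg_unique _ (@Rhausdorff R) _ _ _ _ h1 h2).
Qed.

(** The factor $4$ is the ratio of the constants in [L_le] and [L_ge]. The parallelogram law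
    translates between $(S,W)$ and the deviations of the two components from [m]. *)
Lemma mild_decay t : 0 <= t <= Tf ->
  lint 0 1 (fun x => (U (t, x) - m) ^+ 2) + lint 0 1 (fun x => (V (t, x) - m) ^+ 2)
  <= 4 * expR (- rate * t) *
     (lint 0 1 (fun x => (U0 x - m) ^+ 2) + lint 0 1 (fun x => (V0 x - m) ^+ 2)).
Proof.
move=> TT; have /andP[t0 tTf] := TT.
have T0 : 0 <= (0 : R) <= Tf by rewrite lexx ltW.
have par (f h : R -> R) : bm (@T01 R) f -> bm (@T01 R) h ->
    lint 0 1 (fun x => (f x + h x - 2 * m) ^+ 2) + lint 0 1 (fun x => (f x - h x) ^+ 2) =
    2 * (lint 0 1 (fun x => (f x - m) ^+ 2) + lint 0 1 (fun x => (h x - m) ^+ 2)).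
  move=> bf bh.
  have b1 := bmX 2 (bmB bf (bm_cst _ m)); have b2 := bmX 2 (bmB bh (bm_cst _ m)).
  have b3 := bmX 2 (bmB (bmD bf bh) (bm_cst _ (2 * m))); have b4 := bmX 2 (bmB bf bh).
  have b5 := bmD b1 b2.
  by rewrite -!lintD// -lintZ//; apply: eq_lint => x _; ring.
have r0 : 0 <= rate.
  by rewrite /rate divr_ge0// le_min !mulr_ge0 ?invr_ge0//; exact: ltW.
have bt (f : R -> R) : bm `[0, Tf] f -> bm `[0, t] f := bm_itvS (lexx 0) tTf.
have Xt N r : 0 <= r <= t -> X N r <= - rate * L N r + err N r.
  by move=> /andP[r1 r2]; apply: X_le; rewrite r1 (le_trans r2).
pose E0 := norm2 S 0 + norm2 W 0.
have G N : 4^-1 * (fb N S S t + fb N W W t) <=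
    expR (- rate * t) * E0 + lint 0 t (fun r => `|err N r|).
  apply: le_trans (L_ge N t) _.
  apply: le_trans (prim_gronwall t0 r0 (prim_restrict tTf (prim_L N)) (bt _ (bm_err N)) (Xt N)) _.
  by rewrite lerD2r ler_wpM2l ?expR_ge0// L_le.
have Ecvg : lint 0 t (fun r => `|err N r|) @[N --> \oo] --> (0 : R).
  have [C HC] := err_bounded.
  rewrite -[X in _ --> X](lint0 0 t); apply: (@lint_cvg _ _ _ _ _ C).
  - by move=> N; apply: bm_norm; exact: bt.
  - exact: bm_cst.
  - by move=> N r /andP[r1 r2]; rewrite normr_id HC// r1 (le_trans r2).
  - apply: aeW => r /=; rewrite in_itv/= => /andP[r1 r2].
    by rewrite -[X in _ --> X](@normr0 _ R); apply: cvg_norm; apply: err_cvg; rewrite r1 (le_trans r2).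
have Lcvg : 4^-1 * (fb N S S t + fb N W W t) @[N --> \oo] --> 4^-1 * (norm2 S t + norm2 W t).
  apply: cvgM; first exact: cvg_cst.
  by apply: cvgD; apply: parseval; [exact: (sl bS TT)|exact: (sl bW TT)].
have Rcvg : expR (- rate * t) * E0 + lint 0 t (fun r => `|err N r|) @[N --> \oo] -->
    expR (- rate * t) * E0 + 0.
  by apply: cvgD => //; exact: cvg_cst.
have : 4^-1 * (norm2 S t + norm2 W t) <= expR (- rate * t) * E0 + 0.
  by apply: (ler_cvg_to Lcvg Rcvg); exact: nearW.
rewrite addr0 /E0 (norm2_eq_of_modes bS bS0 (fun k phi => (mode_S k phi).2)).
rewrite (norm2_eq_of_modes bW bW0 (fun k phi => (mode_W k phi).2)).
rewrite /norm2 /S /W par; [|exact: (sl bU TT)|exact: (sl bV TT)].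
rewrite /S0 /W0 par//.
lra.
Qed.

End Decay.

(** * Essential bounds *)

Section Essential.
Context {R : realType}.
Notation leb := (@lebesgue_measure R).
Implicit Types (f : R -> R).

Lemma normLinfT_ge0 f : 0 <= normLinfT f.
Proof.
rewrite /normLinfT; set A := [set C | _].
have [->|/set0P[C AC]] := eqVneq A set0; first by rewrite inf0.
by apply: lb_le_inf; [exists C|move=> x []].
Qed.

(** The infimum is attained: the bounds with slack $1/(n+1)$ hold together off one null set. *)
Lemma le_normLinfT f : LinfT f -> {ae leb, forall x, T01 x -> `|f x| <= normLinfT f}.
Proof.
move=> [_ [C0 fC0]]; pose A := [set C : R | 0 <= C /\ {ae leb, forall x, T01 x -> `|f x| <= C}].
have A0 : has_inf A.
  split; last by exists 0 => x [].
  exists `|C0|; split => //; apply: ae_mono fC0 => x h x01.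
  by rewrite (le_trans (h x01))// ler_norm.
have H (n : nat) : {ae leb, forall x, T01 x -> `|f x| <= normLinfT f + n.+1%:R^-1}.
  have np : 0 < n.+1%:R^-1 :> R by rewrite invr_gt0.
  have [C [_ fC] CA] := inf_adherent np A0.
  by apply: ae_mono fC => x h x01; rewrite (le_trans (h x01))// ltW.
have : {ae leb, forall x, forall n : nat, T01 x -> `|f x| <= normLinfT f + n.+1%:R^-1}.
  by apply: ae_foralln.
apply: ae_mono => x h x01; apply/ler_addgt0Pr => e e0.
have [N _ /(_ N (leqnn N))] : \forall n \near \oo, harmonic n <= e.
  by apply: (cvgr_le _ (@cvg_harmonic R)).
by move=> he; rewrite (le_trans (h N x01))// lerD2l.
Qed.

(** Any value strictly below the supremum is an essential lower bound; taking half costs only a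
    factor in the rate. Positivity rules out the default value $0$ of [sup]. *)
Lemma essinfT_half f : 0 < essinfT f -> {ae leb, forall x, T01 x -> essinfT f / 2 <= f x}.
Proof.
set A := [set C : R | {ae leb, forall x, T01 x -> C <= f x}] => s0.
have hA : has_sup A.
  by apply: contrapT => h; move: s0; rewrite /essinfT sup_out// ltxx.
have e0 : 0 < essinfT f / 2 by rewrite divr_gt0.
have [C AC Ce] := sup_adherent e0 hA.
apply: ae_mono AC => x h x01; apply: le_trans (h x01).
by move: Ce; rewrite -/(essinfT f); lra.
Qed.

End Essential.

(** * The constants of the estimate *)

Section Rate.
Context {R : realType}.
Implicit Types M m c alpha kinf K r : R.

(** The slope $\kappa_0$ of the linear minorant, from $r^\alpha\ge(2M)^{\alpha-1}r$ on $[0,2M]$; the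
    half comes from [essinfT_half]. *)
Definition lower_rate M alpha kinf : R := kinf / 2 * ((2 * M) `^ (1 - alpha))^-1.

(** The largest [eps] allowed by the two constraints of the decay argument. *)
Definition cross_weight M m c alpha kinf K : R :=
  Num.min 2^-1 (3 * c / (2 * m * lower_rate M alpha kinf) + 4 * K / c)^-1.

(** The last halving matches the exponent $-2\lambda t$. The default $1$ keeps the value positive
    for all arguments, as the theorem asks. *)
Definition decay_rate M m c alpha kinf K : R :=
  if [&& 0 < M, 0 < m, 0 < c, 0 < kinf & 0 < K] then
    Num.min (2 * m * lower_rate M alpha kinf / 3) (cross_weight M m c alpha kinf K * c) / 4 / 2
  else 1.

Lemma lower_rate_gt0 M alpha kinf : 0 < M -> 0 < kinf -> 0 < lower_rate M alpha kinf.
Proof. by move=> M0 k0; rewrite mulr_gt0 ?divr_gt0// invr_gt0 powR_gt0// mulr_gt0. Qed.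

Lemma cross_weight_gt0 M m c alpha kinf K : 0 < M -> 0 < m -> 0 < c -> 0 < kinf -> 0 < K ->
  0 < cross_weight M m c alpha kinf K.
Proof.
move=> M0 m0 c0 k0 K0; have l0 := lower_rate_gt0 alpha M0 k0.
have C0 : 0 < 3 * c / (2 * m * lower_rate M alpha kinf) + 4 * K / c.
  by apply: addr_gt0; apply: divr_gt0 => //; repeat apply: mulr_gt0 => //.
by rewrite lt_min !invr_gt0 C0 andbT.
Qed.

Lemma decay_rate_gt0 M m c alpha kinf K : 0 < decay_rate M m c alpha kinf K.
Proof.
rewrite /decay_rate; case: ifP => // /and5P[M0 m0 c0 k0 K0].
have l0 := lower_rate_gt0 alpha M0 k0.
have w0 := cross_weight_gt0 alpha M0 m0 c0 k0 K0.
do 2 apply: divr_gt0 => //; rewrite lt_min (mulr_gt0 w0)// andbT.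
by apply: divr_gt0 => //; repeat apply: mulr_gt0 => //.
Qed.

Lemma lower_rate_le M alpha kinf r : 0 < M -> 0 < kinf -> alpha <= 1 -> 0 <= r <= 2 * M ->
  lower_rate M alpha kinf * r <= kinf / 2 * r `^ alpha.
Proof.
move=> M0 k0 a1 /andP[r0 r2]; rewrite /lower_rate -mulrA ler_wpM2l ?divr_ge0 ?(ltW k0)//.
have p0 : 0 < (2 * M) `^ (1 - alpha) by rewrite powR_gt0// mulr_gt0.
rewrite mulrC ler_pdivrMr//.
have [->|rn0] := eqVneq r 0; first by rewrite mulr_ge0 ?powR_ge0.
have {1}-> : r = r `^ alpha * r `^ (1 - alpha).
  by rewrite -powRD ?subrKC ?powRr1// rn0 implybT.
rewrite ler_wpM2l ?powR_ge0// ge0_ler_powR ?nnegrE ?subr_ge0//.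
by rewrite mulr_ge0// ltW.
Qed.

End Rate.

Theorem theorem2p4 (R : realType) :
  exists (Lam : R -> R -> R -> R) (lam : R -> R -> R -> R -> R -> R -> R),
    (forall M m c, 0 < Lam M m c) /\
    (forall M m c alpha kinf K, 0 < lam M m c alpha kinf K) /\
    forall (c alpha : R) (k : R -> R -> R -> R) (k1 u0 v0 : R -> R)
           (u v : R -> R -> R) (K : R),
      0 < c ->
      0 <= alpha <= 1 ->
      interaction_rate k -> type1 k ->
      LinfT k1 -> 0 < essinfT k1 ->
      (forall a b x, 0 <= a -> 0 <= b -> T01 x ->
         k1 x * (a + b) `^ alpha <= k a b x) ->
      LinfT u0 -> LinfT v0 ->
      {ae (@lebesgue_measure R), forall x, T01 x -> 0 <= u0 x} ->
      {ae (@lebesgue_measure R), forall x, T01 x -> 0 <= v0 x} ->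
      let M := Num.max (normLinfT u0) (normLinfT v0) in
      let m := 2^-1 * intT (fun x => u0 x + v0 x) in
      0 < m ->
      (* K is the bound kappa_1(M) of k on [0,M]^2 x T *)
      0 < K ->
      (forall a b x, 0 <= a <= M -> 0 <= b <= M -> T01 x -> k a b x <= K) ->
      weak_solution c k u0 v0 u v ->
      forall t : R, 0 <= t ->
        intT (fun x => (u t x - m) ^+ 2) + intT (fun x => (v t x - m) ^+ 2)
        <= Lam M m c * expR (- 2 * lam M m c alpha (essinfT k1) K * t) *
           (intT (fun x => (u0 x - m) ^+ 2) + intT (fun x => (v0 x - m) ^+ 2)).
Proof.
exists (fun _ _ _ => 4), decay_rate; split; first by [].
split; first exact: decay_rate_gt0.
move=> c alpha k k1 u0 v0 u v K c0 /andP[_ alpha1] ik k_type1 _ kinf0 k_ge Lu0 Lv0 u0_ge0 v0_ge0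
  M m m0 K0 kK sol t t0.
set kinf := essinfT k1.
have M_ge0 : 0 <= M by rewrite le_max normLinfT_ge0.
have [mu0 mv0] : measurable_fun (@T01 R) u0 /\ measurable_fun (@T01 R) v0 by split; [case: Lu0|case: Lv0].
have u0M : {ae @lebesgue_measure R, forall x, T01 x -> 0 <= u0 x <= M}.
  apply: ae_mono (ae_and u0_ge0 (le_normLinfT Lu0)) => x [h1 h2] x01.
  by rewrite h1//= le_max (le_trans (ler_norm _) (h2 x01)).
have v0M : {ae @lebesgue_measure R, forall x, T01 x -> 0 <= v0 x <= M}.
  apply: ae_mono (ae_and v0_ge0 (le_normLinfT Lv0)) => x [h1 h2] x01.
  by rewrite h1//= le_max (le_trans (ler_norm _) (h2 x01)) orbT.
have clM (b : R) (w : R -> R) : M <= b -> {ae @lebesgue_measure R, forall x, T01 x -> 0 <= w x <= M} ->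
    {ae @lebesgue_measure R, forall x, T01 x -> clip b (w x) = w x}.
  move=> Mb; apply: ae_mono => x h x01; have /andP[h1 h2] := h x01.
  by rewrite clip_id// (le_trans h2).
have mass : lint 0 1 (fun x => clip M (u0 x) + clip M (v0 x)) = 2 * m.
  rewrite /m mulrA mulfV ?pnatr_eq0// mul1r intTE; apply: lint_ae_eq.
  by apply: ae_mono (ae_and (clM _ _ (lexx _) u0M) (clM _ _ (lexx _) v0M)) => x [h1 h2] x01; rewrite h1// h2.
have M0 : 0 < M.
  rewrite lt_neqAle M_ge0 andbT; apply/eqP => M_0.
  have : 2 * m = 0.
    rewrite -mass -[RHS](lint0 0 1); apply: eq_lint => x _.
    have /andP[h1 h2] := clip_between (u0 x) M_ge0; have /andP[h3 h4] := clip_between (v0 x) M_ge0.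
    have Mle : M <= 0 by rewrite -M_0.
    apply/eqP; rewrite eq_le addr_ge0// andbT.
    by rewrite -[leRHS]addr0 lerD// ?(le_trans h2)// (le_trans h4).
  by move: m0; lra.
(* One unit makes the horizon positive even for [t = 0]; another is added below because the bounds
   of [sol_space] concern half-open intervals, while [[0, Tf]] is closed. *)
pose Tf := t + 1.
have Tf0 : 0 < Tf by rewrite ltr_wpDl.
have [Cu HCu] : exists C : R, forall s, 0 <= s < Tf + 1 ->
    {ae @lebesgue_measure R, forall x, T01 x -> `|u s x| <= C}.
  by have [[_ [_ [_ [H _]]]] _] := sol; apply: H; rewrite addr_gt0.
have [Cv HCv] : exists C : R, forall s, 0 <= s < Tf + 1 ->
    {ae @lebesgue_measure R, forall x, T01 x -> `|v s x| <= C}.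
  by have [_ [[_ [_ [_ [H _]]]] _]] := sol; apply: H; rewrite addr_gt0.
pose b := Num.max M (Num.max Cu Cv).
have Mb : M <= b by rewrite le_max lexx.
have b0 : 0 < b := lt_le_trans M0 Mb.
have [kb [kb0 Hkb]] := k_type1 b b0.
have T1 s : 0 <= s <= Tf -> 0 <= s < Tf + 1.
  by move=> /andP[-> h] /=; rewrite (le_lt_trans h)// ltrDl.
have ub s : 0 <= s <= Tf -> {ae @lebesgue_measure R, forall x, T01 x -> u s x <= b}.
  move=> sT; apply: ae_mono (HCu s (T1 s sT)) => x h x01.
  by rewrite (le_trans (ler_norm _))// (le_trans (h x01))// !le_max lexx orbT.
have vb s : 0 <= s <= Tf -> {ae @lebesgue_measure R, forall x, T01 x -> v s x <= b}.
  move=> sT; apply: ae_mono (HCv s (T1 s sT)) => x h x01.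
  by rewrite (le_trans (ler_norm _))// (le_trans (h x01))// !le_max lexx !orbT.
have widen (w : R -> R) : {ae @lebesgue_measure R, forall x, T01 x -> 0 <= w x <= M} ->
    {ae @lebesgue_measure R, forall x, T01 x -> 0 <= w x <= b}.
  by apply: ae_mono => x h x01; have /andP[-> h2] := h x01; rewrite (le_trans h2).
have [mk_ge0 _] := ik.
(* First pass: the solution is clipped at the crude level [b], whose rate bound [kb] only drives the
   contraction of the excess over [M] and leaves no trace in the final constants. *)
have [uM vM] : (forall s, 0 <= s <= Tf -> {ae @lebesgue_measure R, forall x, T01 x -> u s x <= M}) /\
    (forall s, 0 <= s <= Tf -> {ae @lebesgue_measure R, forall x, T01 x -> v s x <= M}).
  have [U [V [kap [[bU bV bkap] [Ub Vb] kapE uv [mU mV]]]]] :=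
    weak_solution_clipped Tf0 (ltW b0) ik Hkb mu0 mv0 (widen _ u0M) (widen _ v0M) sol ub vb.
  have H s : 0 <= s <= Tf -> {ae @lebesgue_measure R, forall x, T01 x -> U (s, x) <= M /\ V (s, x) <= M}.
    apply: (mild_le_initial Tf0 kb0 (_ : 0 <= b - M) bU bV bkap (bm_clip (ltW b0) mu0)
      (bm_clip (ltW b0) mv0) mU mV).
    - by rewrite subr_ge0.
    - move=> r x rT x01; have x01' : T01 x by rewrite /T01/= in_itv.
      have /andP[h1 h2] := Ub (r, x); have /andP[h3 h4] := Vb (r, x).
      by rewrite kapE// mk_ge0//= Hkb// ?h1 ?h3.
    - apply: ae_mono (ae_and u0M (clM _ _ Mb u0M)) => x [h1 h2] x01.
      by rewrite h2//; case/andP: (h1 x01).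
    - apply: ae_mono (ae_and v0M (clM _ _ Mb v0M)) => x [h1 h2] x01.
      by rewrite h2//; case/andP: (h1 x01).
    - by move=> p; rewrite subrKC; case/andP: (Ub p).
    - by move=> p; rewrite subrKC; case/andP: (Vb p).
  split=> s sT; have [h1 h2] := uv s sT.
    by apply: ae_mono (ae_and h1 (H s sT)) => x [g1 g2] x01; rewrite g1//; case: (g2 x01).
  by apply: ae_mono (ae_and h2 (H s sT)) => x [g1 g2] x01; rewrite g1//; case: (g2 x01).
have [U [V [kap [[bU bV bkap] [Ub Vb] kapE uv [mU mV]]]]] :=
  weak_solution_clipped Tf0 M_ge0 ik kK mu0 mv0 u0M v0M sol uM vM.
have l0 := lower_rate_gt0 alpha M0 kinf0.
have kap_bnd r x : 0 <= r <= Tf -> 0 <= x <= 1 -> 0 <= kap (r, x) <= K.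
  move=> rT x01; have x01' : T01 x by rewrite /T01/= in_itv.
  have /andP[h1 h2] := Ub (r, x); have /andP[h3 h4] := Vb (r, x).
  by rewrite kapE// mk_ge0//= kK// ?h1 ?h3.
have kap_low r : 0 <= r <= Tf -> {ae @lebesgue_measure R, forall x, T01 x ->
    lower_rate M alpha kinf * (U (r, x) + V (r, x)) <= kap (r, x)}.
  move=> rT; apply: ae_mono (essinfT_half kinf0) => x h x01.
  have x01' : 0 <= x <= 1 by move: x01; rewrite /T01/= in_itv.
  have /andP[h1 h2] := Ub (r, x); have /andP[h3 h4] := Vb (r, x).
  rewrite kapE//; apply: le_trans (k_ge _ _ _ h1 h3 x01).
  apply: (@le_trans _ _ (kinf / 2 * (U (r, x) + V (r, x)) `^ alpha)).
    apply: lower_rate_le => //; rewrite addr_ge0//=; lra.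
  by rewrite ler_wpM2r ?powR_ge0// h.
have e0 := cross_weight_gt0 alpha M0 m0 c0 kinf0 K0.
have e2 : cross_weight M m c alpha kinf K <= 2^-1 by rewrite ge_min lexx.
have eC : cross_weight M m c alpha kinf K *
    (3 * c / (2 * m * lower_rate M alpha kinf) + 4 * K / c) <= 1.
  have C0 : 0 < 3 * c / (2 * m * lower_rate M alpha kinf) + 4 * K / c.
    by apply: addr_gt0; apply: divr_gt0 => //; repeat apply: mulr_gt0 => //.
  by rewrite -ler_pdivlMr// mul1r ge_min lexx orbT.
have tT : 0 <= t <= Tf by rewrite t0 /Tf lerDl ler01.
have := mild_decay c0 Tf0 m0 l0 bU bV bkap (bm_clip M_ge0 mu0) (bm_clip M_ge0 mv0)
  (fun p => (andP (Ub p)).1) (fun p => (andP (Vb p)).1) kap_bnd kap_low mU mV mass e0 e2 eC tT.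
have [hu hv] := uv t tT.
have sqE (f g : R -> R) : {ae @lebesgue_measure R, forall x, T01 x -> f x = g x} ->
    lint 0 1 (fun x => (g x - m) ^+ 2) = intT (fun x => (f x - m) ^+ 2).
  by move=> fg; rewrite intTE; apply: lint_ae_eq; apply: ae_mono fg => x h x01; rewrite h.
have esymae (f g : R -> R) : {ae @lebesgue_measure R, forall x, T01 x -> f x = g x} ->
    {ae @lebesgue_measure R, forall x, T01 x -> g x = f x}.
  by apply: ae_mono => x h x01; rewrite h.
rewrite (sqE _ _ hu) (sqE _ _ hv).
rewrite (sqE _ _ (esymae _ _ (clM _ _ (lexx _) u0M))) (sqE _ _ (esymae _ _ (clM _ _ (lexx _) v0M))).
rewrite /decay_rate M0 m0 c0 kinf0 K0/=.
have E (r s : R) : - 2 * (r / 2) * s = - r * s by field.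
by rewrite E.
Qed.
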